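(* Suppose that $k_{ij}$ is a positive definite tensor and that $a>0$. Suppose moreover that the delay times satisfy either $0<\tau_q\le2\tau_T$ or $0<2\tau_T<\tau_q$. Let $\mathcal{S}=\{T,q_i\}$ be a solution of the initial boundary value problem $\mathcal{P}$ in the cylinder $B=D\times(-h,L)$, $h>0$, $L>0$, corresponding to given data $\mathcal{D}=\{r;T^0,q_i^0,\dot q_i^0;\vartheta,\xi\}$ whose support is included in the closed cylinder $\overline D\times[-h,0]$. Then there exists a constant $c>0$, depending on the thermal constitutive coefficients and on the delay times, such that $$\mathcal{S}(\mathbf{x},t)=\{T,q_i\}(\mathbf{x},t)=0\quad\text{for all }(\mathbf{x},t)\text{ with }x_3>ct,\ t>0.$$ A possible value for $c$ is $$c_0=\sqrt{\frac{\kappa_M}{a_m}}\sqrt{\frac{2\tau_T}{\tau_q^2}+\frac1{\tau_T+\tau_q}}\qquad\text{when }0<\tau_q\le2\tau_T,$$ while a possible value for $c$ is $$c_1=\frac1{\tau_q}\sqrt{\frac{\tau_T\kappa_M}{a_m}}\sqrt{\frac{5\tau_q^2+2\tau_T^2-6\tau_q\tau_T}{\tau_T^2+2\tau_q^2-3\tau_T\tau_q}}\qquad\text{when }0<2\tau_T<\tau_q,$$ where $a_m=\min_{\overline B}a$ and $\kappa_M=\max_{\overline B}k_M$, with $k_M(\mathbf{x})$ the greatest eigenvalue of $k_{ij}(\mathbf{x})$.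
   Context: Summation over repeated indices is used, indices range over $\{1,2,3\}$, and a comma followed by $i$ denotes $\partial/\partial x_i$. $B=D\times(-h,L)\subset\mathbb{R}^3$ is a cylinder whose cross section $D$ is a bounded regular domain of the $(x_1,x_2)$-plane and whose axis is the $x_3$-direction; $\overline B$, $\partial B$ and $n_i$ are its closure, boundary and outward unit normal. $\Sigma_1,\Sigma_2\subset\partial B$ satisfy $\overline\Sigma_1\cup\Sigma_2=\partial B$ and $\Sigma_1\cap\Sigma_2=\emptyset$. The coefficients $a(\mathbf{x})$, $\varrho(\mathbf{x})$ and the symmetric tensor $k_{ij}(\mathbf{x})$ are given, time-independent, and sufficiently regular on $\overline B$; the constants $\tau_q$, $\tau_T$ are the delay times. Problem $\mathcal{P}$: given smooth data $\mathcal{D}=\{r;T^0,q_i^0,\dot q_i^0;\vartheta,\xi\}$, find $\mathcal{S}=\{T,q_i\}$ on $\overline B\times[0,\infty)$ such that on $B\times(0,\infty)$ $$q_i+\tau_q\frac{\partial q_i}{\partial t}+\frac12\tau_q^2\frac{\partial^2 q_i}{\partial t^2}=-k_{ij}T_{,j}-\tau_T k_{ij}\frac{\partial T_{,j}}{\partial t},\qquad -q_{i,i}+\varrho r=a\frac{\partial T}{\partial t},$$ with initial conditions $T(\mathbf{x},0)=T^0(\mathbf{x})$, $q_i(\mathbf{x},0)=q_i^0(\mathbf{x})$, $\frac{\partial q_i}{\partial t}(\mathbf{x},0)=\dot q_i^0(\mathbf{x})$ on $\overline B$, and boundary conditions $T=\vartheta$ on $\overline\Sigma_1\times[0,\infty)$,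 $q_in_i=\xi$ on $\Sigma_2\times[0,\infty)$. That the support of the data is included in $\overline D\times[-h,0]$ means that $r(\mathbf{x},t)$, $T^0(\mathbf{x})$, $q_i^0(\mathbf{x})$, $\dot q_i^0(\mathbf{x})$, $\vartheta(\mathbf{x},t)$, $\xi(\mathbf{x},t)$ all vanish at points $\mathbf{x}$ with $x_3>0$, for all times $t\ge0$. A solution is a pair $\{T,q_i\}$ defined on $\overline B\times[0,\infty)$ with $T\in C^{1,1}(B\times(0,\infty))$ and $q_i\in C^{1,2}(B\times(0,\infty))$ (the first superscript refers to space derivatives, the second to time derivatives, the mixed derivatives appearing in the equations being included), satisfying the equations, initial and boundary conditions. Solutions are classical: the fields and the derivatives occurring in the equations and conditions are assumed regular enough up to $\partial B$ and $t=0$ for the conditions to be meaningful and the divergence theorem to be applicable. *)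

(* Defs.v *)
From HB Require Import structures.
From mathcomp Require Import all_boot all_order all_algebra.
From mathcomp Require Import all_classical all_reals all_analysis.
Import Order.TTheory GRing.Theory Num.Theory.
Import numFieldNormedType.Exports.

Set Implicit Arguments.
Unset Strict Implicit.
Unset Printing Implicit Defensive.

Local Open Scope classical_set_scope.
Local Open Scope ring_scope.

(* The coordinates x_1, x_2, x_3 are those of index 0, 1, 2 of a row vector;
   x_3 is [x ord0 ord_max]. *)

Definition boundary (X : topologicalType) (A : set X) : set X :=
  closure A `\` interior A.

(* psi is a C^1 function near p, with nonzero gradient at p, and A coincides
   with {psi < 0} near p: at such a boundary point A is locally on one side of
   a C^1 hypersurface. *)
Definition C1_defining (R : realType) (n : nat) (A : set 'rV[R]_n.+1)
    (p : 'rV[R]_n.+1) (psi : 'rV[R]_n.+1 -> R) : Prop :=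
  [/\ \forall x \near p, forall i : 'I_n.+1,
        derivable psi x (delta_mx ord0 i) /\
        {for x, continuous (fun y => 'D_(delta_mx ord0 i) psi y)},
      exists i : 'I_n.+1, 'D_(delta_mx ord0 i) psi p != 0
    & \forall x \near p, A x <-> psi x < 0].

Definition gradient (R : realType) (n : nat) (psi : 'rV[R]_n.+1 -> R)
    (p : 'rV[R]_n.+1) : 'rV[R]_n.+1 :=
  \row_i 'D_(delta_mx ord0 i) psi p.

(* [ `|v| ] is the sup norm on row vectors, whence the explicit square root.
   No n satisfies this predicate at a point where the boundary is not C^1 (for
   instance on the edges of a cylinder); at the other boundary points n is
   unique. *)
Definition outward_unit_normal (R : realType) (m : nat) (A : set 'rV[R]_m.+1)
    (p n : 'rV[R]_m.+1) : Prop :=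
  exists psi : 'rV[R]_m.+1 -> R, C1_defining A p psi /\
    n = (Num.sqrt (\sum_i (gradient psi p ord0 i) ^+ 2))^-1 *: gradient psi p.

(* Bounded plane domain with piecewise C^1 boundary: finitely many boundary
   points (corners) may fail to be regular. *)
Definition bounded_regular_domain (R : realType) (D : set 'rV[R]_2) : Prop :=
  [/\ open D, connected D, D !=set0, bounded_set D
    & exists E : set 'rV[R]_2, finite_set E /\
        forall p, boundary D p -> ~ E p -> exists psi, C1_defining D p psi].

Definition cylinder (R : realType) (D : set 'rV[R]_2) (h L : R) :
    set 'rV[R]_3 :=
  [set x | D (lsubmx (x : 'rV[R]_(2 + 1))) /\ - h < x ord0 ord_max < L].

Notation field R := ('rV[R]_3 -> R -> R).

Definition dx (R : realType) (j : 'I_3) (f : field R) : field R :=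
  fun x t => 'D_(delta_mx ord0 j) (fun y => f y t) x.

Definition dt (R : realType) (f : field R) : field R :=
  fun x t => derive1 (f x) t.

Definition has_dx (R : realType) (j : 'I_3) (f : field R) x t : Prop :=
  derivable (fun y => f y t) x (delta_mx ord0 j).

Definition has_dt (R : realType) (f : field R) x t : Prop :=
  derivable (f x) t 1.

Definition cont_inside (R : realType) (B : set 'rV[R]_3) (f : field R) : Prop :=
  forall x t, B x -> 0 < t ->
    {for (x, t), continuous (fun p : 'rV[R]_3 * R => f p.1 p.2)}.

Definition cont_closed (R : realType) (B : set 'rV[R]_3) (f : field R) : Prop :=
  {within closure B `*` [set t | 0 <= t],
    continuous (fun p : 'rV[R]_3 * R => f p.1 p.2)}.

(* For derivatives: f, meaningful on B x ]0, +oo[, extends continuously to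
   the closure of B times [0, +oo[. *)
Definition extends_to_closed (R : realType) (B : set 'rV[R]_3) (f : field R) :
    Prop :=
  exists g : field R, cont_closed B g /\
    forall x t, B x -> 0 < t -> g x t = f x t.

Definition C11 (R : realType) (B : set 'rV[R]_3) (f : field R) : Prop :=
  [/\ forall x t, B x -> 0 < t -> has_dt f x t /\
        forall j, has_dx j f x t /\ has_dt (dx j f) x t,
      cont_inside B f, cont_inside B (dt f)
    & forall j, cont_inside B (dx j f) /\ cont_inside B (dt (dx j f))].

Definition C12 (R : realType) (B : set 'rV[R]_3) (f : field R) : Prop :=
  [/\ forall x t, B x -> 0 < t -> [/\ has_dt f x t, has_dt (dt f) x t
        & forall j, has_dx j f x t],
      cont_inside B f, cont_inside B (dt f), cont_inside B (dt (dt f))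
    & forall j, cont_inside B (dx j f)].

Definition divergence (R : realType) (q : 'I_3 -> field R) : field R :=
  fun x t => \sum_i dx i (q i) x t.

(* No smoothness is imposed on the data beyond what a solution forces. *)
Record data (R : realType) := Data {
  supply : field R;                        (* r *)
  T_init : 'rV[R]_3 -> R;                  (* T^0 *)
  q_init : 'I_3 -> 'rV[R]_3 -> R;          (* q_i^0 *)
  dq_init : 'I_3 -> 'rV[R]_3 -> R;         (* initial value of dq_i/dt *)
  T_bound : field R;                       (* vartheta *)
  flux_bound : field R                     (* xi *)
}.

(* Classical solution of the initial boundary value problem in B.  Fields are
   total functions; only their values on the closure of B and for t >= 0
   matter, so the time derivative at t = 0 is one-sided.  The flux condition
   is imposed where the normal exists. *)
Record solution (R : realType) (B S1 S2 : set 'rV[R]_3) (tauq tauT : R)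
    (a rho : 'rV[R]_3 -> R) (k : 'rV[R]_3 -> 'M[R]_3) (d : data R)
    (T : field R) (q : 'I_3 -> field R) : Prop := Solution {
  sol_T_C11 : C11 B T;
  sol_q_C12 : forall i, C12 B (q i);
  sol_T_closed : [/\ cont_closed B T, extends_to_closed B (dt T)
    & forall j, extends_to_closed B (dx j T) /\
                extends_to_closed B (dt (dx j T))];
  sol_q_closed : (forall i, [/\ cont_closed B (q i),
      extends_to_closed B (dt (q i)) & extends_to_closed B (dt (dt (q i)))]) /\
    extends_to_closed B (divergence q);
  sol_constitutive : forall x t i, B x -> 0 < t ->
    q i x t + tauq * dt (q i) x t + 2^-1 * tauq ^+ 2 * dt (dt (q i)) x t =
    - (\sum_j k x i j * dx j T x t)
    - tauT * (\sum_j k x i j * dt (dx j T) x t);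
  sol_energy : forall x t, B x -> 0 < t ->
    - divergence q x t + rho x * supply d x t = a x * dt T x t;
  sol_T_init : forall x, closure B x -> T x 0 = T_init d x;
  sol_q_init : forall x i, closure B x -> q i x 0 = q_init d i x;
  sol_dq_init : forall x i, closure B x ->
    (fun s : R => s^-1 * (q i x s - q i x 0)) @ 0^'+ --> dq_init d i x;
  sol_T_bound : forall x t, closure S1 x -> 0 <= t -> T x t = T_bound d x t;
  sol_flux_bound : forall x t n, S2 x -> 0 <= t ->
    outward_unit_normal B x n ->
    \sum_i q i x t * n ord0 i = flux_bound d x t
}.

(* Each datum is tested only where the problem uses it. *)
Definition supported_below (R : realType) (B S1 S2 : set 'rV[R]_3)
    (d : data R) : Prop :=
  [/\ forall x t, B x -> 0 < x ord0 ord_max -> 0 <= t -> supply d x t = 0,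
      forall x, closure B x -> 0 < x ord0 ord_max ->
        T_init d x = 0 /\ forall i, q_init d i x = 0 /\ dq_init d i x = 0,
      forall x t, closure S1 x -> 0 < x ord0 ord_max -> 0 <= t ->
        T_bound d x t = 0
    & forall x t, S2 x -> 0 < x ord0 ord_max -> 0 <= t ->
        flux_bound d x t = 0].

Definition boundary_split (R : realType) (B S1 S2 : set 'rV[R]_3) : Prop :=
  [/\ S1 `<=` boundary B, S2 `<=` boundary B,
      closure S1 `|` S2 = boundary B & S1 `&` S2 = set0].

(* c bounds the propagation speed of every solution in the cylinder with
   coefficients a, k, tauq, tauT whose data are supported in x_3 <= 0. *)
Definition propagation_bound (R : realType) (B : set 'rV[R]_3) (tauq tauT : R)
    (a : 'rV[R]_3 -> R) (k : 'rV[R]_3 -> 'M[R]_3) (c : R) : Prop :=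
  forall (rho : 'rV[R]_3 -> R) (S1 S2 : set 'rV[R]_3) (d : data R)
    (T : field R) (q : 'I_3 -> field R),
  {within closure B, continuous rho} ->
  boundary_split B S1 S2 ->
  supported_below B S1 S2 d ->
  solution B S1 S2 tauq tauT a rho k d T q ->
  forall x t, closure B x -> 0 < t -> c * t < x ord0 ord_max ->
    T x t = 0 /\ forall i, q i x t = 0.

Definition positive_definite (R : realType) (M : 'M[R]_3) : Prop :=
  forall v : 'rV[R]_3, v != 0 ->
    0 < \sum_i \sum_j M i j * v ord0 i * v ord0 j.

Definition is_min (R : realType) (A : set R) (m : R) : Prop :=
  A m /\ lbound A m.

Definition is_max (R : realType) (A : set R) (m : R) : Prop :=
  A m /\ ubound A m.

Definition greatest_eigenvalue (R : realType) (M : 'M[R]_3) (l : R) : Prop :=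
  is_max [set l' | eigenvalue M l'] l.

Definition speed0 (R : realType) (tauq tauT am kM : R) : R :=
  Num.sqrt (kM / am) *
  Num.sqrt (2 * tauT / tauq ^+ 2 + (tauT + tauq)^-1).

Definition speed1 (R : realType) (tauq tauT am kM : R) : R :=
  tauq^-1 * Num.sqrt (tauT * kM / am) *
  Num.sqrt ((5 * tauq ^+ 2 + 2 * tauT ^+ 2 - 6 * tauq * tauT) /
            (tauT ^+ 2 + 2 * tauq ^+ 2 - 3 * tauT * tauq)).

(* Main.v *)
Require Import Defs.
From HB Require Import structures.
From mathcomp Require Import all_boot all_order all_algebra.
From mathcomp Require Import all_classical all_reals all_analysis.
From mathcomp Require Import ring lra.
Import Order.TTheory GRing.Theory Num.Theory.
Import numFieldNormedType.Exports.
Local Open Scope classical_set_scope.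
Local Open Scope ring_scope.

Set Implicit Arguments.
Unset Strict Implicit.
Unset Printing Implicit Defensive.

(** Ahead of the support of the data, that is for x_3 > 0, the solution starts
    from rest.  Write Th and Q_i for the integrals of T and q_i over [0, t], and
    phi = Th + tauT T.  Integrated once in time, the constitutive law becomes
      Q_i + tauq q_i + tauq^2 / 2 dq_i/dt = - k_ij phi_,j
    there (integrated_law), while the energy law reads a dT/dt = - q_i,i.  With
    kap the inverse of k, the density
      e = tauq^2 / 4 kap q.q + 1/2 kap Q.Q + a / (2 tauT) (phi^2 + Th^2)
    then satisfies de/dt = - div (phi q) + R with R <= (2 / tauT) e
    (energy_der, energy_rate_le): testing the law against kap q yields
    - q.grad phi, and the heat equation yields - phi div q.  Moreover
    phi q_3 <= c e (energy_flux_le) as soon as 2 tauT kM <= c^2 tauq^2 am, since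
    q_3^2 <= kM kap q.q; both speeds of the theorem satisfy this inequality
    (speed0_sqr, speed1_sqr).

    Let w = max (x_3 - d0 - c t, 0)^2.  Formally, the integral of w e over the
    part x_3 > 0 of the cylinder has a time derivative at most 2 / tauT times
    itself: moving the front gains c dw/dx_3 e, which pays for the flux
    dw/dx_3 phi q_3 through it, and no flux crosses the boundary, where T = 0 or
    q.n = 0.  It vanishes at t = 0, hence always, and e = 0 ahead of the front.

    Cutoffs replace integrals over the boundary of the cylinder.  The weight is
    multiplied by functions that vanish near the lateral boundary and near the
    top; the integral over a cube of the divergence of a field that
    vanishes on its boundary is zero by the fundamental theorem of calculus in
    each variable (bint_partial).  The cutoffs cost the integral of
    |phi q.grad chi|, which can be made arbitrarily small (planar_cutoff,
    top_small).  Near a regular boundary point chi is a step of width eps across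
    the boundary: the integral of |grad chi| stays bounded while the component
    of phi q across the boundary tends to 0.  The finitely many corners of the
    cross section are cut off by bumps of radius r, whose gradients have
    integrals of order r.  Gronwall's inequality and the limit of vanishing cost
    conclude (energy_vanishes). *)

(** * One-dimensional integrals depending on a parameter *)

Definition int1 (R : realType) (a b : R) (f : R -> R) : R :=
  \int[lebesgue_measure]_(x in `[a, b]) f x.

Lemma cont_integrable (R : realType) (a b : R) (f : R -> R) :
  continuous f -> lebesgue_measure.-integrable `[a, b] (EFin \o f).
Proof.
move=> cf; apply: continuous_compact_integrable; first exact: segment_compact.
exact: continuous_subspaceT.
Qed.

Lemma int1D (R : realType) (a b : R) (f g : R -> R) :
  continuous f -> continuous g ->
  int1 a b (fun x => f x + g x) = int1 a b f + int1 a b g.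
Proof. by move=> cf cg; apply: RintegralD => //; exact: cont_integrable. Qed.

Lemma int1Z (R : realType) (a b c : R) (f : R -> R) :
  continuous f -> int1 a b (fun x => c * f x) = c * int1 a b f.
Proof. by move=> cf; apply: RintegralZl => //; exact: cont_integrable. Qed.

Lemma le_int1 (R : realType) (a b : R) (f g : R -> R) :
  continuous f -> continuous g ->
  (forall x, a <= x <= b -> f x <= g x) -> int1 a b f <= int1 a b g.
Proof.
move=> cf cg fg; apply: le_Rintegral => //; try exact: cont_integrable.
Qed.

Lemma eq_int1 (R : realType) (a b : R) (f g : R -> R) :
  (forall x, a <= x <= b -> f x = g x) -> int1 a b f = int1 a b g.
Proof.
by move=> fg; apply: eq_Rintegral => x; rewrite inE /= in_itv /= => /fg.
Qed.

Lemma int1_cst (R : realType) (a b c : R) : a <= b ->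
  int1 a b (fun=> c) = (b - a) * c.
Proof.
move=> ab; rewrite /int1 Rintegral_cst//= lebesgue_measure_itv /= lte_fin.
case: ltP => [_|ba]; first by rewrite mulrC.
have -> : b = a by apply/eqP; rewrite eq_le ab ba.
by rewrite subrr mul0r mulr0.
Qed.

Lemma is_derive1_cont (R : realType) (f : R -> R) (x d : R) :
  is_derive x 1 f d -> continuous_at x f.
Proof.
by case=> h _; apply: differentiable_continuous; apply/derivable1_diffP.
Qed.

Lemma int1_ftc (R : realType) (a b : R) (F f : R -> R) : a < b ->
  continuous f -> (forall x : R, a <= x <= b -> is_derive x 1 F (f x)) ->
  int1 a b f = F b - F a.
Proof.
move=> ab cf dF.
have dF' x : x \in `]a, b[ -> is_derive x 1 F (f x).
  by rewrite in_itv /= => xab; apply: dF; lra.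
rewrite /int1 /Rintegral (@continuous_FTC2 _ f F)//.
- exact: continuous_subspaceT.
- split.
  + by move=> x /dF' [].
  + apply: cvg_at_right_filter; apply: is_derive1_cont (dF a _); lra.
  + apply: cvg_at_left_filter; apply: is_derive1_cont (dF b _); lra.
- by move=> x /dF' []; rewrite derive1E.
Qed.

Lemma int1_primitive (R : realType) (f : R -> R) (x0 : R) : continuous f ->
  exists F : R -> R, forall x : R, x0 < x -> is_derive x 1 F (f x).
Proof.
move=> cf; exists (fun x => int1 x0 x f) => x x0x.
have xx1 : x < x + 1 by rewrite ltrDl.
have [d e] := continuous_FTC1_closed xx1 (cont_integrable _ _ cf) x0x (cf x).
by apply: DeriveDef; [exact: d|rewrite -derive1E e].
Qed.

Lemma cont_cst (X Y : topologicalType) (y : Y) (x : X) :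
  continuous_at x (fun=> y).
Proof. exact: cvg_cst. Qed.

Lemma cont_id (X : topologicalType) (x : X) : continuous_at x id.
Proof. exact: cvg_id. Qed.

Lemma cont_fst (X Y : topologicalType) (p : X * Y) : continuous_at p fst.
Proof. by case: p => x y; exact: cvg_fst. Qed.

Lemma cont_snd (X Y : topologicalType) (p : X * Y) : continuous_at p snd.
Proof. by case: p => x y; exact: cvg_snd. Qed.

Lemma cont_comp (X Y Z : topologicalType) (f : X -> Y) (g : Y -> Z) (x : X) :
  continuous_at x f -> continuous_at (f x) g ->
  continuous_at x (fun x => g (f x)).
Proof. exact: continuous_comp. Qed.

Lemma cont_fst1 (X Y Z : topologicalType) (p : X * Y * Z) :
  continuous_at p (fun p => p.1.1).
Proof. by apply: (@cont_comp _ _ _ fst fst); exact: cont_fst. Qed.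

Lemma cont_snd1 (X Y Z : topologicalType) (p : X * Y * Z) :
  continuous_at p (fun p => p.1.2).
Proof.
by apply: (@cont_comp _ _ _ fst snd); [exact: cont_fst|exact: cont_snd].
Qed.

Lemma jcont_comp (X Y Z W : topologicalType) (f : X -> Y -> Z) (g : W -> X)
    (h : W -> Y) (w : W) : continuous_at w g -> continuous_at w h ->
  continuous_at (g w, h w) (fun p => f p.1 p.2) ->
  continuous_at w (fun w => f (g w) (h w)).
Proof. move=> cg ch cf; exact: (cvg_comp2 cg ch cf). Qed.

Lemma jcont_slice (X Y Z : topologicalType) (f : X -> Y -> Z) (x : X) (y : Y) :
  continuous_at (x, y) (fun p => f p.1 p.2) -> continuous_at y (f x).
Proof. by move=> cf; apply: (cvg_comp2 (cvg_cst x) cvg_id cf). Qed.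

Lemma cont_swap (X Y Z : topologicalType) (f : X -> Y -> Z) (x : X) (y : Y) :
  continuous_at (x, y) (fun p => f p.1 p.2) ->
  continuous_at (y, x) (fun p => f p.2 p.1).
Proof.
move=> cf; apply: (@jcont_comp _ _ _ _ f snd fst (y, x)); last exact: cf.
  exact: cont_snd.
exact: cont_fst.
Qed.

(** By compactness the continuity of f at x0 is uniform along K; this is what
    lets limits pass under the integral sign. *)
Lemma tube_unif (R : realType) (X Y : topologicalType) (K : set Y) (f : X -> Y -> R)
    (x0 : X) (e : R) : compact K -> 0 < e ->
  (forall s, K s -> continuous_at (x0, s) (fun p => f p.1 p.2)) ->
  \forall x \near x0, forall s, K s -> `|f x s - f x0 s| < e.
Proof.
move=> cK e0 cf.
have cf' := cf; move/compact_near_coveringP : cK => /(_ X (nbhs x0)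
   (fun x s => `|f x s - f x0 s| < e) _); apply => s /cf {}cf.
have e20 : 0 < e / 2 by rewrite divr_gt0.
have [[A B] /= [Ax0 Bs] AB] :=
   cf _ (nbhsx_ballx (f x0 s) (e/2) e20).
exists (B, A); first by split.
move=> [s' x] /= [Bs' Ax].
have := AB (x, s') (conj Ax Bs').
have := AB (x0, s') (conj (nbhs_singleton Ax0) Bs').
rewrite /= /ball /= => h1 h2.
rewrite (splitr e); apply: le_lt_trans (ltrD h1 h2).
rewrite (_ : f x s' - f x0 s' = (f x0 s - f x0 s') - (f x0 s - f x s')).
  exact: ler_normB.
by ring.
Qed.

Lemma int1_dist (R : realType) (a b e : R) (f g : R -> R) : a <= b ->
  continuous f -> continuous g ->
  (forall x, a <= x <= b -> `|f x - g x| <= e) ->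
  `|int1 a b f - int1 a b g| <= (b - a) * e.
Proof.
move=> ab cf cg fg.
have ce : continuous (fun x : R => e) by move=> x; exact: cvg_cst.
have h1 : int1 a b f <= int1 a b (fun x => g x + e).
  apply: le_int1 => //; first by move=> x; apply: cvgD; [exact: cg|exact: ce].
  by move=> x /fg; rewrite ler_norml => /andP[_]; rewrite lerBlDl.
have h2 : int1 a b g <= int1 a b (fun x => f x + e).
  apply: le_int1 => //; first by move=> x; apply: cvgD; [exact: cf|exact: ce].
  by move=> x /fg; rewrite ler_norml lerBrDl => /andP[+ _]; lra.
move: h1 h2; rewrite !int1D// !int1_cst// ler_norml; lra.
Qed.

Lemma int1_cont (R : realType) (X : topologicalType) (a b : R) (U : set X)
    (f : X -> R -> R) (x0 : X) : a < b -> open U -> U x0 ->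
  (forall x s, U x -> continuous_at (x, s) (fun p => f p.1 p.2)) ->
  continuous_at x0 (fun x => int1 a b (f x)).
Proof.
move=> ab oU Ux0 cf.
have cfx x : U x -> continuous (f x).
  by move=> Ux s; exact: jcont_slice (cf x s Ux).
apply/cvgrPdist_le => e e0; rewrite /=.
have e'0 : 0 < e / (b - a) by rewrite divr_gt0 // subr_gt0.
have := @tube_unif R X R `[a, b] f x0 _ (@segment_compact _ _ _) e'0
  (fun s _ => cf x0 s Ux0).
have := open_nbhs_nbhs (conj oU Ux0).
apply: filterS2 => x Ux hx.
have -> : e = (b - a) * (e / (b - a)) by field; rewrite subr_eq0 gt_eqF.
apply: int1_dist; [exact: ltW|exact: cfx|exact: cfx|].
by move=> s sab; rewrite distrC; apply/ltW/hx; rewrite /= in_itv.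
Qed.

Lemma mvt_abs (R : realType) (f df : R -> R) (t0 h : R) :
  (forall x : R, `|x - t0| <= `|h| -> is_derive x 1 f (df x)) ->
  exists2 xi, `|xi - t0| <= `|h| & f (h + t0) - f t0 = df xi * h.
Proof.
move=> fdf; have [h0|h0] := leP 0 h.
- have th : t0 <= h + t0 by rewrite lerDr.
  have Hin x : t0 <= x <= h + t0 -> `|x - t0| <= `|h|.
    by move=> xin; rewrite !ger0_norm ?subr_ge0//; lra.
  have [||xi xiin E] := @MVT_segment R f df t0 (h + t0) th.
  + by move=> x; rewrite in_itv /= => xin; apply/fdf/Hin; lra.
  + apply: continuous_in_subspaceT => x; rewrite inE /= in_itv /= => xin.
    exact/is_derive1_cont/fdf/Hin.
  exists xi; last by rewrite E addrK.
  by apply: Hin; move: xiin; rewrite in_itv.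
- have th : h + t0 <= t0 by rewrite gerDr ltW.
  have Hin x : h + t0 <= x <= t0 -> `|x - t0| <= `|h|.
    by move=> xin; rewrite !ler0_norm ?subr_le0//; lra.
  have [||xi xiin E] := @MVT_segment R f df (h + t0) t0 th.
  + by move=> x; rewrite in_itv /= => xin; apply/fdf/Hin; lra.
  + apply: continuous_in_subspaceT => x; rewrite inE /= in_itv /= => xin.
    exact/is_derive1_cont/fdf/Hin.
  exists xi; last by rewrite -opprB E; ring.
  by apply: Hin; move: xiin; rewrite in_itv.
Qed.

Lemma is_derive_quot (R : realType) (f : R -> R) (s d : R) :
  h^-1 *: (f (h + s) - f s) @[h --> 0^'] --> d -> is_derive s 1 f d.
Proof.
move=> key; apply: DeriveDef; first by apply: (cvgP d);
  under eq_fun do rewrite /GRing.scale/= mulr1.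
apply/cvg_lim => //; under eq_fun do rewrite /GRing.scale/= mulr1.
exact: key.
Qed.

(** The mean value theorem turns the difference quotient of f into a value of df
    at an intermediate time, uniformly close to df t0 by compactness of [a, b]. *)
Lemma int1_derive (R : realType) (a b : R) (U : set R)
    (f df : R -> R -> R) (t0 : R) : a < b -> open U -> U t0 ->
  (forall t, U t -> continuous (f t)) ->
  (forall t s, U t -> continuous_at (t, s) (fun p => df p.1 p.2)) ->
  (forall t s : R, U t -> is_derive t 1 (f^~ s) (df t s)) ->
  is_derive t0 1 (fun t => int1 a b (f t)) (int1 a b (df t0)).
Proof.
move=> ab oU Ut0 cf cdf fdf.
have cdft0 : continuous (df t0).
  by move=> s; exact: jcont_slice (cdf t0 s Ut0).
apply: is_derive_quot; apply/cvgrPdist_le => e e0.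
have e'0 : 0 < e / (b - a) by rewrite divr_gt0 // subr_gt0.
have := @tube_unif R R R `[a, b] df t0 _ (@segment_compact _ _ _) e'0
  (fun s _ => cdf t0 s Ut0).
have := open_nbhs_nbhs (conj oU Ut0).
move=> /nbhs_ballP[r1 /= r10 UB] /nbhs_ballP[r2 /= r20 hB].
near=> h.
have h0 : h != 0 by near: h; exact: nbhs_dnbhs_neq.
have hr : `|h| < Num.min r1 r2.
  near: h; apply: dnbhs0_lt; by rewrite lt_min r10.
have Uth t : `|t - t0| <= `|h| -> U t /\ (forall s, a <= s <= b ->
    `|df t s - df t0 s| < e / (b - a)).
  move=> th; have := le_lt_trans th hr; rewrite lt_min => /andP[tr1 tr2]; split.
    by apply: UB; rewrite /ball /= distrC.
  by move=> s sab; apply: hB; rewrite /ball /= ?in_itv// distrC.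
have Uh : U (h + t0) by apply: (Uth _ _).1; rewrite addrK.
have -> : e = (b - a) * (e / (b - a)) by field; rewrite subr_eq0 gt_eqF.
rewrite (_ : _ *: _ = int1 a b (fun s => h^-1 * (f (h + t0) s - f t0 s))); last first.
  rewrite int1Z; last by move=> s; apply: cvgB; apply: cf.
  rewrite /GRing.scale /=; congr (_ * _).
  have cN : continuous (fun s => -1 * f t0 s).
    by move=> s; apply: cvgM; [exact: cvg_cst|exact: cf].
  under [in RHS]eq_fun => s do rewrite -mulN1r.
  by rewrite int1D ?int1Z ?mulN1r//; exact: cf.
apply: int1_dist; [exact: ltW|exact: cdft0| |].
  move=> s; apply: cvgM; first exact: cvg_cst.
  by apply: cvgB; apply: cf.
move=> s sab.
have [xi xih E] := @mvt_abs R (f^~ s) (df^~ s) t0 h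
  (fun x xh => fdf x s (Uth x xh).1).
rewrite E mulrCA mulVf ?mulr1//.
by rewrite distrC; apply/ltW/(Uth _ _).2.
Unshelve. all: by end_near. Qed.

(** A primitive of f is nondecreasing on [a, b], and increases strictly on a
    short interval to the right of x0, where f stays above f x0 / 2. *)
Lemma int1_gt0 (R : realType) (a b : R) (f : R -> R) (x0 : R) :
  a < x0 < b -> continuous f -> (forall x, 0 <= f x) -> 0 < f x0 ->
  0 < int1 a b f.
Proof.
move=> /andP[ax xb] cf f0 fx0.
have [F dF] := int1_primitive (a - 1) cf.
have : \forall x \near x0, f x0 / 2 < f x.
  by apply: (cvgr_gt _ (cf x0)); rewrite ltr_pdivrMr// ltr_pMr// ltr1n.
move=> /nbhs_ballP[r /= r0 hr].
pose e := Num.min (r / 2) (b - x0).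
have e0 : 0 < e by rewrite lt_min divr_gt0//= subr_gt0.
have [er eb] : e <= r / 2 /\ e <= b - x0 by rewrite /e !ge_min !lexx orbT.
have rise x y : a - 1 < x -> x <= y ->
    exists2 xi, x <= xi <= y & F y - F x = f xi * (y - x).
  move=> xa xy; have [||xi xixy E] := @MVT_segment R F f x y xy.
  + by move=> z; rewrite in_itv /= => /andP[xz _]; exact/dF/(lt_trans xa).
  + apply: continuous_in_subspaceT => z; rewrite inE /= in_itv /= => /andP[xz _].
    exact/is_derive1_cont/dF/(lt_le_trans xa).
  by exists xi.
have -> : int1 a b f = F b - F a.
  apply: int1_ftc => //; first lra.
  by move=> x /andP[ax' _]; apply: dF; lra.
have [|xi1 _ E1] := rise a x0 _ (ltW ax); first lra.
have [||xi2 /andP[x2 x2'] E2] := rise x0 (x0 + e); [lra|lra|].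
have [||xi3 _ E3] := rise (x0 + e) b; [lra|lra|].
have p1 : 0 <= f xi1 * (x0 - a) by rewrite mulr_ge0 // subr_ge0 ltW.
have p3 : 0 <= f xi3 * (b - (x0 + e)) by rewrite mulr_ge0 //; lra.
have p2 : 0 < f xi2 * (x0 + e - x0).
  rewrite mulr_gt0//; last by lra.
  rewrite (lt_trans _ (hr xi2 _))// ?divr_gt0//.
  by rewrite /ball /= ler0_norm; lra.
lra.
Qed.

(** * Iterated integrals over a cube *)

(** Reduces directional derivatives to derivatives in one real variable. *)
Lemma is_derive_line (R : realType) (V : normedModType R) (f : V -> R)
    (x v : V) (s d : R) :
  is_derive s 1 (fun t : R => f (t *: v + x)) d <->
  is_derive (s *: v + x) v f d.
Proof.
have E : (fun h => h^-1 *: (((fun t : R => f (t *: v + x)) \o shift s) (h *: (1:R)) -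
   (fun t : R => f (t *: v + x)) s)) =
  (fun h => h^-1 *: ((f \o shift (s *: v + x)) (h *: v) - f (s *: v + x))).
  apply/funext => h /=; congr (_ *: (f _ - _)).
  by rewrite scalerDl addrA /GRing.scale /= mulr1.
split => -[h1 h2]; (split; [move: h1|move: h2]);
  by rewrite /derivable /derive E.
Qed.

(** Appends a last coordinate, so that a cube of dimension n.+1 is fibred over
    its last coordinate. *)
Definition rcons_rv (R : realType) (n : nat) (v : 'rV[R]_n) (s : R) : 'rV[R]_n.+1 :=
  \row_i oapp (v ord0) s (unlift ord_max i).

Lemma rcons_rv_max (R : realType) (n : nat) (v : 'rV[R]_n) (s : R) :
  rcons_rv v s ord0 ord_max = s.
Proof. by rewrite mxE unlift_none. Qed.

Lemma rcons_rv_lift (R : realType) (n : nat) (v : 'rV[R]_n) (s : R) (j : 'I_n) :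
  rcons_rv v s ord0 (lift ord_max j) = v ord0 j.
Proof. by rewrite mxE liftK. Qed.

Lemma rv_norm_le (R : realType) (n : nat) (v : 'rV[R]_n) (e : R) :
  0 <= e -> (forall i, `|v ord0 i| <= e) -> `|v| <= e.
Proof.
move=> e0 ve; rewrite /Num.norm /= mx_normrE; apply: bigmax_le => // -[i j] _ /=.
by rewrite ord1.
Qed.

Lemma rv_coord_le (R : realType) (n : nat) (v : 'rV[R]_n) (i : 'I_n) :
  `|v ord0 i| <= `|v|.
Proof.
rewrite {2}/Num.norm /= mx_normrE.
exact: (le_bigmax _ (fun ij => `|v ij.1 ij.2|) (ord0, i)).
Qed.

Lemma rcons_rv_cont (R : realType) (n : nat) :
  continuous (fun p : 'rV[R]_n * R => rcons_rv p.1 p.2).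
Proof.
move=> [v s]; apply/cvgrPdist_le => e e0 /=.
exists (ball v e, ball s e).
  by split; exact: nbhsx_ballx.
move=> [v' s'] [/= hv hs]; apply: rv_norm_le => [|i]; first exact: ltW.
have [j ->|->] := unliftP ord_max i.
  rewrite !mxE liftK /=.
  have -> : v ord0 j - v' ord0 j = (v - v') ord0 j by rewrite !mxE.
  by rewrite (le_trans (rv_coord_le _ _)) ?ltW //; move: hv; rewrite -ball_normE.
by rewrite !mxE unlift_none /=; apply/ltW; move: hs; rewrite -ball_normE.
Qed.

Lemma rcons_cont_comp (R : realType) (n : nat) (W : topologicalType)
    (g : W -> 'rV[R]_n) (h : W -> R) (w : W) :
  continuous_at w g -> continuous_at w h ->
  continuous_at w (fun w => rcons_rv (g w) (h w)).
Proof. by move=> cg ch; apply: jcont_comp => //; exact: rcons_rv_cont. Qed.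

(** The integral over the cube of half-side M centred at 0, as an iterated
    integral with the last coordinate outermost: for continuous integrands every
    property then follows by induction on n from the case of one variable. *)
Fixpoint bint (R : realType) (M : R) (n : nat) : ('rV[R]_n -> R) -> R :=
  match n with
  | 0 => fun f => f 0
  | n'.+1 => fun f =>
      int1 (- M) M (fun s => @bint R M n' (fun v => f (rcons_rv v s)))
  end.

Lemma bintS (R : realType) (M : R) (n : nat) (f : 'rV[R]_n.+1 -> R) :
  bint M f = int1 (- M) M (fun s => bint M (fun v => f (rcons_rv v s))).
Proof. by []. Qed.

(** The parameter space is arbitrary because the induction moves the outermost
    variable into the parameter. *)
Lemma bint_cont (R : realType) (M : R) (n : nat) (X : topologicalType)
    (U : set X) (f : X -> 'rV[R]_n -> R) (x0 : X) : 0 < M -> open U -> U x0 ->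
  (forall x v, U x -> continuous_at (x, v) (fun p => f p.1 p.2)) ->
  continuous_at x0 (fun x => bint M (f x)).
Proof.
move=> M0; elim: n X U f x0 => [|n IH] X U f x0 oU Ux0 cf /=.
  apply: (@jcont_comp _ _ _ _ f id (fun=> 0) x0); last exact: cf.
    exact: cont_id.
  exact: cont_cst.
apply: (@int1_cont R X (- M) M U (fun x s => bint M (fun v => f x (rcons_rv v s)))) => //.
  lra.
move=> x s Ux.
apply: (IH (X * R)%type [set p : X * R | U p.1] (fun p v => f p.1 (rcons_rv v p.2)) (x, s)).
- by apply: open_comp => // p _; exact: cont_fst.
- by [].
- move=> [x' s'] v /= Ux'.
  apply: (@jcont_comp _ _ _ _ f (fun p : (X * R) * 'rV[R]_n => p.1.1)
   (fun p => rcons_rv p.2 p.1.2) (x', s', v)).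
  + exact: cont_fst1.
  + apply: rcons_cont_comp; [exact: cont_snd|exact: cont_snd1].
  + exact: cf.
Qed.

Lemma slice_cont (R : realType) (n : nat) (f : 'rV[R]_n.+1 -> R) :
  continuous f ->
  continuous (fun p : R * 'rV[R]_n => f (rcons_rv p.2 p.1)).
Proof.
move=> cf [s v]; apply: continuous_comp; last exact: cf.
by apply: rcons_cont_comp; [exact: cont_snd|exact: cont_fst].
Qed.

Lemma slice_cont1 (R : realType) (n : nat) (f : 'rV[R]_n.+1 -> R) (s : R) :
  continuous f -> continuous (fun v : 'rV[R]_n => f (rcons_rv v s)).
Proof.
move=> cf v; apply: continuous_comp; last exact: cf.
by apply: rcons_cont_comp; [exact: cont_id|exact: cont_cst].
Qed.

Lemma bint_slice_cont (R : realType) (M : R) (n : nat) (f : 'rV[R]_n.+1 -> R) :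
  0 < M -> continuous f ->
  continuous (fun s => bint M (fun v => f (rcons_rv v s))).
Proof.
move=> M0 cf s; apply: (@bint_cont R M n R setT (fun s v => f (rcons_rv v s))) => //.
  exact: openT.
by move=> s' v _; exact: slice_cont.
Qed.

Lemma bintD (R : realType) (M : R) (n : nat) (f g : 'rV[R]_n -> R) : 0 < M ->
  continuous f -> continuous g ->
  bint M (fun x => f x + g x) = bint M f + bint M g.
Proof.
move=> M0; elim: n f g => [//|n IH] f g cf cg /=.
rewrite -int1D; [|exact: bint_slice_cont|exact: bint_slice_cont].
by apply: eq_int1 => s _; apply: IH; exact: slice_cont1.
Qed.

Lemma bintZ (R : realType) (M : R) (n : nat) (c : R) (f : 'rV[R]_n -> R) :
  0 < M -> continuous f -> bint M (fun x => c * f x) = c * bint M f.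
Proof.
move=> M0; elim: n f => [//|n IH] f cf /=.
rewrite -int1Z; last exact: bint_slice_cont.
by apply: eq_int1 => s _; apply: IH; exact: slice_cont1.
Qed.

Lemma le_bint (R : realType) (M : R) (n : nat) (f g : 'rV[R]_n -> R) : 0 < M ->
  continuous f -> continuous g ->
  (forall x, f x <= g x) -> bint M f <= bint M g.
Proof.
move=> M0; elim: n f g => [|n IH] f g cf cg fg /=; first exact: fg.
apply: le_int1; [exact: bint_slice_cont|exact: bint_slice_cont|].
by move=> s _; apply: IH => //; exact: slice_cont1.
Qed.

Lemma bint_cst (R : realType) (M : R) (n : nat) (c : R) : 0 < M ->
  bint M (fun _ : 'rV[R]_n => c) = (2 * M) ^+ n * c.
Proof.
move=> M0; elim: n => [|n IH] /=; first by rewrite mul1r.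
rewrite IH int1_cst; last by lra.
by rewrite exprS opprK mulrA; congr (_ * _ * _); ring.
Qed.

Lemma bint_gt0 (R : realType) (M : R) (n : nat) (f : 'rV[R]_n -> R)
    (x0 : 'rV[R]_n) : 0 < M -> continuous f -> (forall x, 0 <= f x) ->
  (forall i : 'I_n, `|x0 ord0 i| < M) -> 0 < f x0 -> 0 < bint M f.
Proof.
move=> M0; elim: n f x0 => [|n IH] f x0 cf f0 x0M fx0 /=.
  by rewrite (_ : 0 = x0) //; apply/rowP => -[].
pose v0 := \row_j x0 ord0 (lift ord_max j).
have E : x0 = rcons_rv v0 (x0 ord0 ord_max).
  apply/rowP => i; have [j ->|->] := unliftP ord_max i.
    by rewrite rcons_rv_lift mxE.
  by rewrite rcons_rv_max.
apply: (int1_gt0 (x0 := x0 ord0 ord_max)).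
- by rewrite -ltr_norml.
- exact: bint_slice_cont.
- move=> s; have <- : bint M (fun _ : 'rV[R]_n => 0) = 0 :> R.
    by rewrite bint_cst ?mulr0.
  by apply: le_bint => //; [move=> ?; exact: cont_cst|exact: slice_cont1].
apply: (IH _ v0) => //; first exact: slice_cont1.
  by move=> j; rewrite mxE.
by rewrite -E.
Qed.

Lemma bint_derive (R : realType) (M : R) (n : nat) (U : set R)
    (f df : R -> 'rV[R]_n -> R) (t0 : R) : 0 < M -> open U -> U t0 ->
  (forall t v, U t -> continuous_at (t, v) (fun p => f p.1 p.2)) ->
  (forall t v, U t -> continuous_at (t, v) (fun p => df p.1 p.2)) ->
  (forall (t : R) v, U t -> is_derive t 1 (f^~ v) (df t v)) ->
  is_derive t0 1 (fun t => bint M (f t)) (bint M (df t0)).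
Proof.
move=> M0; elim: n f df t0 => [|n IH] f df t0 oU Ut0 cf cdf fdf /=.
  exact: fdf.
have jc (g : R -> 'rV[R]_n.+1 -> R) :
    (forall t v, U t -> continuous_at (t, v) (fun p => g p.1 p.2)) ->
    forall t s v, U t -> continuous_at (t, s, v) (fun p : R * R * 'rV[R]_n => g p.1.1 (rcons_rv p.2 p.1.2)).
  move=> cg t s v Ut.
  apply: (@jcont_comp _ _ _ _ g (fun p : (R * R) * 'rV[R]_n => p.1.1)
   (fun p => rcons_rv p.2 p.1.2) (t, s, v)).
  - exact: cont_fst1.
  - by apply: rcons_cont_comp; [exact: cont_snd|
      exact: cont_snd1].
  - exact: cg.
have oU2 : open [set p : R * R | U p.1].
  by apply: open_comp => // p _; exact: cont_fst.
have jb (g : R -> 'rV[R]_n.+1 -> R) :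
    (forall t v, U t -> continuous_at (t, v) (fun p => g p.1 p.2)) ->
    forall t s, U t -> continuous_at (t, s) (fun p : R * R =>
       bint M (fun v => g p.1 (rcons_rv v p.2))).
  move=> cg t s Ut.
  apply: (@bint_cont R M n (R * R)%type [set p : R * R | U p.1]
     (fun p v => g p.1 (rcons_rv v p.2))) => //.
  by move=> [t' s'] v /= Ut'; exact: jc.
apply: (@int1_derive R (- M) M U (fun t s => bint M (fun v => f t (rcons_rv v s)))
   (fun t s => bint M (fun v => df t (rcons_rv v s)))) => //.
- lra.
- by move=> t Ut s; exact: (@jcont_slice _ _ _ (fun t s => bint M (fun v => f t (rcons_rv v s))) t s (jb f cf t s Ut)).
- by move=> t s Ut; exact: jb.
move=> t s Ut.
have js (g : R -> 'rV[R]_n.+1 -> R) :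
    (forall t v, U t -> continuous_at (t, v) (fun p => g p.1 p.2)) ->
    forall t v, U t -> continuous_at (t, v) (fun p : R * 'rV[R]_n => g p.1 (rcons_rv p.2 s)).
  move=> cg t' v Ut'.
  apply: (@jcont_comp _ _ _ _ g fst (fun p => rcons_rv p.2 s) (t', v)).
  - exact: cont_fst.
  - by apply: rcons_cont_comp; [exact: cont_snd|exact: cont_cst].
  - exact: cg.
apply: (IH (fun t v => f t (rcons_rv v s)) (fun t v => df t (rcons_rv v s))) => //.
- exact: js.
- exact: js.
Qed.

Lemma rcons_rv_max_line (R : realType) (n : nat) (v : 'rV[R]_n) (s : R) :
  rcons_rv v s = s *: delta_mx ord0 ord_max + rcons_rv v 0.
Proof.
apply/rowP => i; rewrite !mxE eqxx /=.
have [j ->|->] := unliftP ord_max i => /=.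
  by rewrite eq_sym (negPf (neq_lift _ _)) mulr0 add0r.
by rewrite eqxx mulr1 addr0.
Qed.

Lemma rcons_rv_lift_line (R : realType) (n : nat) (v : 'rV[R]_n) (s t : R) j :
  rcons_rv (t *: delta_mx ord0 j + v) s =
  t *: delta_mx ord0 (lift ord_max j) + rcons_rv v s.
Proof.
apply/rowP => i; rewrite !mxE eqxx /=.
have [k ->|->] := unliftP ord_max i => /=.
  by rewrite !mxE eqxx /= (inj_eq lift_inj).
by rewrite (negPf (neq_lift _ _)) mulr0 add0r.
Qed.

Lemma is_derive_rcons_max (R : realType) (n : nat) (f : 'rV[R]_n.+1 -> R)
    (v : 'rV[R]_n) (s d : R) :
  is_derive (rcons_rv v s) (delta_mx ord0 ord_max) f d <->
  is_derive s 1 (fun s => f (rcons_rv v s)) d.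
Proof.
rewrite rcons_rv_max_line -is_derive_line.
by under [in X in _ <-> X]eq_fun => t do rewrite rcons_rv_max_line.
Qed.

Lemma is_derive_rcons_lift (R : realType) (n : nat) (f : 'rV[R]_n.+1 -> R)
    (v : 'rV[R]_n) (s d : R) (j : 'I_n) :
  is_derive (rcons_rv v s) (delta_mx ord0 (lift ord_max j)) f d <->
  is_derive v (delta_mx ord0 j) (fun v => f (rcons_rv v s)) d.
Proof.
have := @is_derive_line R _ f (rcons_rv v s) (delta_mx ord0 (lift ord_max j)) 0 d.
have := @is_derive_line R _ (fun v => f (rcons_rv v s)) v (delta_mx ord0 j) 0 d.
rewrite !scale0r !add0r => <- <-.
by under [in X in _ <-> X]eq_fun => t do rewrite rcons_rv_lift_line.
Qed.

(** The form of the divergence theorem used below.  It is the fundamental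
    theorem of calculus in the i-th variable; when that variable is the outermost
    one, the derivative is first taken under the inner integrals. *)
Lemma bint_partial (R : realType) (M : R) (n : nat) (i : 'I_n)
    (f f' : 'rV[R]_n -> R) : 0 < M -> continuous f -> continuous f' ->
  (forall x : 'rV[R]_n, is_derive x (delta_mx ord0 i) f (f' x)) ->
  (forall x : 'rV[R]_n, `|x ord0 i| = M -> f x = 0) -> bint M f' = 0.
Proof.
move=> M0; elim: n i f f' => [[]//|n IH] i f f' cf cf' ff' fM /=.
move: ff' fM; have [j ->|->] := unliftP ord_max i => ff' fM.
  rewrite (_ : (fun s => _) = fun=> 0); first by rewrite int1_cst ?mulr0//; lra.
  apply/funext => s; apply: (IH j (fun v => f (rcons_rv v s))).
  - exact: slice_cont1.
  - exact: slice_cont1.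
  - by move=> v; apply/is_derive_rcons_lift.
  - by move=> v vM; apply: fM; rewrite rcons_rv_lift.
have b0 s : `|s| = M -> bint M (fun v => f (rcons_rv v s)) = 0.
  move=> sM; rewrite (_ : (fun v => _) = fun=> 0); first by rewrite bint_cst ?mulr0.
  by apply/funext => v; apply: fM; rewrite rcons_rv_max.
have -> : int1 (- M) M (fun s => bint M (fun v => f' (rcons_rv v s))) =
    bint M (fun v => f (rcons_rv v M)) - bint M (fun v => f (rcons_rv v (- M))).
  apply: (@int1_ftc R (- M) M (fun s => bint M (fun v => f (rcons_rv v s)))).
  - lra.
  - exact: bint_slice_cont.
  move=> s _.
  apply: (@bint_derive R M n setT (fun s v => f (rcons_rv v s))
    (fun s v => f' (rcons_rv v s))) => //.
  - exact: openT.
  - by move=> t v _; exact: slice_cont.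
  - by move=> t v _; exact: slice_cont.
  - by move=> t v _; apply/is_derive_rcons_max.
by rewrite !b0 ?normrN ?subrr// gtr0_norm.
Qed.

(** * Directional derivatives and a smooth step *)

(** A synonym that is not a type class: derivative statements are passed
    explicitly and never searched for. *)
Definition der (R : realType) (V : normedModType R) (x v : V) (f : V -> R)
  (d : R) : Prop := is_derive x v f d.

Lemma der_id (R : realType) (x v : R) : der x v id v.
Proof. exact: is_derive_id. Qed.

Lemma derD (R : realType) (V : normedModType R) (f g : V -> R)
    (x v : V) (df dg : R) : der x v f df -> der x v g dg ->
  der x v (fun y => f y + g y) (df + dg).
Proof. by rewrite /der => hf hg; exact: is_deriveD. Qed.

Lemma derB (R : realType) (V : normedModType R) (f g : V -> R)
    (x v : V) (df dg : R) : der x v f df -> der x v g dg ->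
  der x v (fun y => f y - g y) (df - dg).
Proof. by rewrite /der => hf hg; exact: is_deriveB. Qed.

Lemma derM (R : realType) (V : normedModType R) (f g : V -> R)
    (x v : V) (df dg : R) : der x v f df -> der x v g dg ->
  der x v (fun y => f y * g y) (f x * dg + g x * df).
Proof. by rewrite /der => hf hg; exact: is_deriveM. Qed.

Lemma derZ (R : realType) (V : normedModType R) (f : V -> R)
    (x v : V) (c df : R) : der x v f df ->
  der x v (fun y => c * f y) (c * df).
Proof. by rewrite /der => hf; exact: is_deriveZ. Qed.

Lemma der_cst (R : realType) (V : normedModType R) (x v : V) (c : R) :
  der x v (fun _ : V => c) 0.
Proof. exact: is_derive_cst. Qed.

Lemma der_sum (R : realType) (V : normedModType R) (n : nat)
    (f : 'I_n -> V -> R) (x v : V) (df : 'I_n -> R) :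
  (forall i, der x v (f i) (df i)) ->
  der x v (fun y => \sum_i f i y) (\sum_i df i).
Proof.
rewrite /der => hf; have -> : (fun y => \sum_i f i y) = \sum_i f i.
  by apply/funext => y; rewrite fct_sumE.
exact: is_derive_sum.
Qed.

Lemma der_comp (R : realType) (V : normedModType R) (h : R -> R)
    (f : V -> R) (x v : V) (a b : R) : der (f x) 1 h a ->
  der x v f b -> der x v (fun y => h (f y)) (a * b).
Proof.
rewrite /der => dh df; rewrite -[x]add0r -(scale0r v).
apply/(is_derive_line (fun y => h (f y))).
apply: (@is_derive1_comp R h (fun t => f (t *: v + x))).
  by rewrite scale0r add0r.
by apply/is_derive_line; rewrite scale0r add0r.
Qed.

Lemma der_coord (R : realType) (n : nat) (x v : 'rV[R]_n) (i : 'I_n) :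
  der x v (fun y : 'rV[R]_n => y ord0 i) (v ord0 i).
Proof.
rewrite -[x]add0r -(scale0r v); apply/is_derive_line.
have -> : (fun t : R => (t *: v + x) ord0 i) =
    (fun t => v ord0 i * id t + x ord0 i).
  by apply/funext => t; rewrite !mxE mulrC.
rewrite -[X in is_derive _ _ _ X]addr0 -[X in X + 0]mulr1.
by apply: (derD (derZ _ (der_id _ _)) (der_cst _ _ _)).
Qed.

Definition pos2 (R : realType) (s : R) : R := (Num.max s 0) ^+ 2.
Definition dpos2 (R : realType) (s : R) : R := 2 * Num.max s 0.

(** A quadratic error bound gives the derivative of a piecewise quadratic
    function at its breakpoints without one-sided limits. *)
Lemma der_quad (R : realType) (f : R -> R) (s d C : R) :
  (forall h, `|f (h + s) - f s - d * h| <= C * h ^+ 2) -> der s 1 f d.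
Proof.
move=> hf.
apply: is_derive_quot; apply/cvgrPdist_le => e e0.
have C0 : 0 <= C.
  by have := le_trans (normr_ge0 _) (hf 1); rewrite expr1n mulr1.
have C1 : 0 < C + 1 by lra.
near=> h.
have h0 : h != 0 by near: h; exact: nbhs_dnbhs_neq.
have hr : `|h| < e / (C + 1).
  near: h; apply: dnbhs0_lt; exact: divr_gt0.
rewrite /GRing.scale /= distrC.
have -> : h^-1 * (f (h + s) - f s) - d = h^-1 * (f (h + s) - f s - d * h).
  by field.
rewrite normrM normfV ler_pdivrMl ?normr_gt0//.
apply: (le_trans (hf h)).
rewrite -real_normK ?num_real// expr2 mulrCA ler_wpM2l//.
apply: (@le_trans _ _ ((C + 1) * `|h|)).
  by rewrite ler_wpM2r//; lra.
by rewrite -ler_pdivlMl// mulrC ltW.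
Unshelve. all: by end_near. Qed.

Lemma der_pos2 (R : realType) (s : R) : der s 1 (@pos2 R) (dpos2 s).
Proof.
apply: (@der_quad _ _ _ _ 1) => h; rewrite /pos2 /dpos2 mul1r.
have [a|a] := leP (h + s) 0; have [b|b] := leP s 0; rewrite ler_norml; nra.
Qed.

Lemma dpos2_cont (R : realType) : continuous (@dpos2 R).
Proof.
move=> s; apply: cvgM; first exact: cvg_cst.
by apply: (@continuous_max _ _ id (fun=> 0)); [exact: cvg_id|exact: cvg_cst].
Qed.

(** A piecewise quadratic C^1 step from 0 to 1: its derivative is the tent of
    height 2 over [0, 1]. *)
Definition smoothstep (R : realType) (s : R) : R :=
  2 * (pos2 s - 2 * pos2 (s - 2^-1) + pos2 (s - 1)).
Definition dsmoothstep (R : realType) (s : R) : R :=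
  2 * (dpos2 s - 2 * dpos2 (s - 2^-1) + dpos2 (s - 1)).

Lemma der_smoothstep (R : realType) (s : R) :
  der s 1 (@smoothstep R) (dsmoothstep s).
Proof.
have sh (c : R) : der s 1 (fun s : R => pos2 (s - c)) (dpos2 (s - c)).
  have -> : dpos2 (s - c) = dpos2 (s - c) * (1 - 0) by rewrite subr0 mulr1.
  apply: (@der_comp R R (@pos2 R) (fun s => s - c)).
    exact: der_pos2.
  by apply: derB; [exact: der_id|exact: der_cst].
apply: derZ; apply: derD => //.
apply: derB; first exact: der_pos2.
exact: derZ.
Qed.

Lemma dsmoothstep_cont (R : realType) : continuous (@dsmoothstep R).
Proof.
have sh c : continuous (fun s : R => dpos2 (s - c)).
  move=> s; apply: (@cont_comp _ _ _ (fun s => s - c)); last exact: dpos2_cont.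
  by apply: cvgB; [exact: cvg_id|exact: cvg_cst].
move=> s; apply: cvgM; first exact: cvg_cst.
apply: cvgD; last exact: sh.
apply: cvgB; first exact: dpos2_cont.
by apply: cvgM; [exact: cvg_cst|exact: sh].
Qed.

Ltac smoothstep_cases s :=
  rewrite /smoothstep /dsmoothstep /pos2 /dpos2;
  have [?|?] := leP s 0; have [?|?] := leP (s - 2^-1) 0;
  have [?|?] := leP (s - 1) 0; try lra.

Lemma smoothstep_le0 (R : realType) (s : R) : s <= 0 -> smoothstep s = 0.
Proof. by move=> s0; smoothstep_cases s; nra. Qed.

Lemma smoothstep_ge1 (R : realType) (s : R) : 1 <= s -> smoothstep s = 1.
Proof. by move=> s0; smoothstep_cases s; nra. Qed.

Lemma smoothstep_itv (R : realType) (s : R) : 0 <= smoothstep s <= 1.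
Proof. by smoothstep_cases s; nra. Qed.

Lemma dsmoothstep_itv (R : realType) (s : R) : 0 <= dsmoothstep s <= 2.
Proof. by smoothstep_cases s; nra. Qed.

Lemma dsmoothstep_le0 (R : realType) (s : R) : s <= 0 -> dsmoothstep s = 0.
Proof. by move=> s0; smoothstep_cases s; nra. Qed.

Lemma dsmoothstep_ge1 (R : realType) (s : R) : 1 <= s -> dsmoothstep s = 0.
Proof. by move=> s0; smoothstep_cases s; nra. Qed.

(** Lets the derivative of a bounded function dominate the indicator of an
    interval; measures of thin sets are estimated in this way. *)
Lemma dsmoothstep_mid (R : realType) (s : R) : 1 / 4 <= s <= 3 / 4 -> 1 <= dsmoothstep s.
Proof. by move=> s0; smoothstep_cases s; nra. Qed.

(** * Functions of class C^1 and gluing *)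

(** The partial derivatives are carried as data because cutoffs are combined
    through explicit formulas. *)
Definition C1 (R : realType) (n : nat) (f : 'rV[R]_n -> R)
    (df : 'I_n -> 'rV[R]_n -> R) : Prop :=
  [/\ continuous f, forall i, continuous (df i)
    & forall i x, der x (delta_mx ord0 i) f (df i x)].

Lemma der_val (R : realType) (V : normedModType R) (x v : V) (f : V -> R)
  (d : R) : der x v f d -> 'D_v f x = d.
Proof. by case. Qed.

Lemma der_uniq (R : realType) (V : normedModType R) (x v : V) (f : V -> R)
  (d d' : R) : der x v f d -> der x v f d' -> d = d'.
Proof. by move=> /der_val <- /der_val <-. Qed.

Lemma der_near (R : realType) (V : normedModType R) (x v : V) (f g : V -> R)
  (d : R) : (\forall y \near x, f y = g y) -> der x v f d -> der x v g d.
Proof. exact: near_eq_is_derive. Qed.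

Lemma cont_near (X Y : topologicalType) (x : X) (f g : X -> Y) :
  (\forall y \near x, f y = g y) -> continuous_at x f ->
  continuous_at x g.
Proof.
move=> fg cf; have E := nbhs_singleton fg; rewrite /continuous_at -E.
apply: cvg_trans cf; apply: near_eq_cvg.
by apply: filterS fg => y ->.
Qed.

Lemma contD (X : topologicalType) (R : realType) (f g : X -> R) (x : X) :
  continuous_at x f -> continuous_at x g ->
  continuous_at x (fun y => f y + g y).
Proof. exact: cvgD. Qed.

Lemma contB (X : topologicalType) (R : realType) (f g : X -> R) (x : X) :
  continuous_at x f -> continuous_at x g ->
  continuous_at x (fun y => f y - g y).
Proof. exact: cvgB. Qed.

Lemma contM (X : topologicalType) (R : realType) (f g : X -> R) (x : X) :
  continuous_at x f -> continuous_at x g ->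
  continuous_at x (fun y => f y * g y).
Proof. exact: cvgM. Qed.

Lemma contN (X : topologicalType) (R : realType) (f : X -> R) (x : X) :
  continuous_at x f -> continuous_at x (fun y => - f y).
Proof. exact: cvgN. Qed.

Lemma contZ (X : topologicalType) (R : realType) (c : R) (f : X -> R) (x : X) :
  continuous_at x f -> continuous_at x (fun y => c * f y).
Proof. by move=> cf; apply: contM => //; exact: cont_cst. Qed.

Lemma cont_sum (X : topologicalType) (R : realType) (n : nat)
    (f : 'I_n -> X -> R) (x : X) : (forall i, continuous_at x (f i)) ->
  continuous_at x (fun y => \sum_i f i y).
Proof.
move=> cf; have -> : (fun y => \sum_i f i y) = \sum_i f i.
  by apply/funext => y; rewrite fct_sumE.
apply: (big_ind (fun g : X -> R => continuous_at x g)); last by move=> i _; exact: cf.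
- exact: cont_cst.
- by move=> g h cg ch; exact: contD.
Qed.

Lemma cont_glue (R : realType) (X : topologicalType) (O : set X) (a u : X -> R) :
  (forall x, O x -> continuous_at x a) ->
  (forall x, O x -> continuous_at x u) ->
  (forall x, ~ O x -> \forall y \near x, a y = 0) ->
  continuous (fun x => a x * u x).
Proof.
move=> ca cu a0 x; have [Ox|nOx] := pselect (O x).
  by apply: contM; [exact: ca|exact: cu].
apply: (@cont_near _ _ _ (fun=> 0)); last exact: cont_cst.
by apply: filterS (a0 _ nOx) => y ->; rewrite mul0r.
Qed.

Lemma der_glue0 (R : realType) (V : normedModType R) (x v : V) (a u : V -> R) :
  (\forall y \near x, a y = 0) -> der x v (fun x => a x * u x) 0.
Proof.
move=> a0; apply: (@der_near _ _ _ _ (fun=> 0)); last exact: der_cst.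
by apply: filterS a0 => y ->; rewrite mul0r.
Qed.

Lemma C1_near0 (R : realType) (n : nat) (f : 'rV[R]_n -> R)
    (df : 'I_n -> 'rV[R]_n -> R) (x : 'rV[R]_n) (i : 'I_n) : C1 f df ->
  (\forall y \near x, f y = 0) -> \forall y \near x, df i y = 0.
Proof.
move=> [_ _ ff] f0; have := nbhs_interior f0; apply: filterS => y yf.
apply: (der_uniq (ff i y)).
apply: (@der_near _ _ _ _ (fun=> 0)); last exact: der_cst.
by apply: filterS yf => z ->.
Qed.

(** The fields are regular only inside the cylinder; a weight that vanishes near
    every outside point turns them into functions that are C^1 everywhere. *)
Lemma C1_glue (R : realType) (n : nat) (O : set 'rV[R]_n)
    (a u : 'rV[R]_n -> R) (da du : 'I_n -> 'rV[R]_n -> R) : C1 a da ->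
  (forall x, O x -> continuous_at x u) ->
  (forall i x, O x -> continuous_at x (du i)) ->
  (forall i x, O x -> der x (delta_mx ord0 i) u (du i x)) ->
  (forall x, ~ O x -> \forall y \near x, a y = 0) ->
  C1 (fun x => a x * u x) (fun i x => a x * du i x + da i x * u x).
Proof.
move=> Ca cu cdu uu a0; have [ca cda aa] := Ca; split.
- exact: (cont_glue (fun x _ => ca x) cu a0).
- move=> i x; apply: contD.
    exact: (cont_glue (fun x _ => ca x) (cdu i) a0).
  apply: (cont_glue (fun x _ => cda i x) cu) => y nOy.
  exact: (C1_near0 _ Ca (a0 y nOy)).
- move=> i x; have [Ox|nOx] := pselect (O x).
    by rewrite [X in _ + X]mulrC; apply: derM; [exact: aa|exact: uu].
  have -> : a x * du i x + da i x * u x = 0.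
    rewrite (nbhs_singleton (a0 _ nOx)).
    by rewrite (nbhs_singleton (C1_near0 i Ca (a0 _ nOx))) !mul0r addr0.
  exact/der_glue0/a0.
Qed.

Lemma C1M (R : realType) (n : nat)
    (a u : 'rV[R]_n -> R) (da du : 'I_n -> 'rV[R]_n -> R) : C1 a da -> C1 u du ->
  C1 (fun x => a x * u x) (fun i x => a x * du i x + da i x * u x).
Proof.
move=> Ca [cu cdu uu].
apply: (@C1_glue _ _ setT) => //.
by move=> x nT; exfalso; exact: nT.
Qed.

Lemma C1_onem (R : realType) (n : nat)
    (a : 'rV[R]_n -> R) (da : 'I_n -> 'rV[R]_n -> R) : C1 a da ->
  C1 (fun x => 1 - a x) (fun i x => - da i x).
Proof.
move=> [ca cda aa]; split.
- by move=> x; apply: contB; [exact: cont_cst|exact: ca].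
- by move=> i x; apply: contN; exact: cda.
- by move=> i x; rewrite -sub0r; apply: derB; [exact: der_cst|exact: aa].
Qed.

Lemma C1_comp (R : realType) (n : nat) (h dh : R -> R)
    (a : 'rV[R]_n -> R) (da : 'I_n -> 'rV[R]_n -> R) :
  (forall s : R, der s 1 h (dh s)) -> continuous dh -> C1 a da ->
  C1 (fun x => h (a x)) (fun i x => dh (a x) * da i x).
Proof.
move=> hh cdh [ca cda aa]; split.
- by move=> x; apply: cont_comp; [exact: ca|exact: is_derive1_cont (hh _)].
- move=> i x; apply: contM; last exact: cda.
  by apply: cont_comp; [exact: ca|exact: cdh].
- by move=> i x; apply: der_comp.
Qed.

(** The norm of row vectors is the sup norm, which is not differentiable, so
    that bumps are built on the Euclidean distance. *)
Definition sqdist (R : realType) (n : nat) (p x : 'rV[R]_n) : R :=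
  \sum_i (x ord0 i - p ord0 i) ^+ 2.

Lemma cont_coord (R : realType) (n : nat) (i : 'I_n) :
  continuous (fun x : 'rV[R]_n => x ord0 i).
Proof. exact: coord_continuous. Qed.

Lemma C1_sqdist (R : realType) (n : nat) (p : 'rV[R]_n) :
  C1 (sqdist p) (fun i x => 2 * (x ord0 i - p ord0 i)).
Proof.
have cc i : continuous (fun x : 'rV[R]_n => x ord0 i - p ord0 i).
  by move=> x; apply: contB; [exact: cont_coord|exact: cont_cst].
split.
- move=> x; apply: (@cont_sum _ _ _ (fun i (x : 'rV[R]_n) => (x ord0 i - p ord0 i) ^+ 2)) => i.
  by apply: contM; exact: cc.
- by move=> i x; apply: contM; [exact: cont_cst|exact: cc].
- move=> i x.
  have -> : 2 * (x ord0 i - p ord0 i) = \sum_j ((x ord0 j - p ord0 j) *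
    (delta_mx ord0 i : 'rV[R]_n) ord0 j + (x ord0 j - p ord0 j) *
    (delta_mx ord0 i : 'rV[R]_n) ord0 j).
    rewrite (bigD1 i)//= big1 => [|j ji].
      by rewrite !mxE !eqxx /= addr0; ring.
    by rewrite !mxE (negPf ji) andbF /= !mulr0 addr0.
  apply: der_sum => j.
  have h : der x (delta_mx ord0 i) (fun x : 'rV[R]_n => x ord0 j - p ord0 j)
     ((delta_mx ord0 i : 'rV[R]_n) ord0 j).
    rewrite -[X in der _ _ _ X]subr0; apply: derB; last exact: der_cst.
    exact: der_coord.
  exact: derM.
Qed.

(** Equal to 1 on the Euclidean ball of radius r, and to 0 outside that of
    radius sqrt 2 * r. *)
Definition ball_bump (R : realType) (n : nat) (p : 'rV[R]_n) (r : R) (x : 'rV[R]_n) : R :=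
  smoothstep (2 - r ^- 2 * sqdist p x).
Definition dball_bump (R : realType) (n : nat) (p : 'rV[R]_n) (r : R) (i : 'I_n)
    (x : 'rV[R]_n) : R :=
  dsmoothstep (2 - r ^- 2 * sqdist p x) * (- (r ^- 2 * (2 * (x ord0 i - p ord0 i)))).

Lemma C1_ball_bump (R : realType) (n : nat) (p : 'rV[R]_n) (r : R) :
  C1 (ball_bump p r) (dball_bump p r).
Proof.
apply: (@C1_comp _ _ (@smoothstep R) (@dsmoothstep R)
  (fun x => 2 - r ^- 2 * sqdist p x)
  (fun i x => - (r ^- 2 * (2 * (x ord0 i - p ord0 i))))).
- exact: der_smoothstep.
- exact: dsmoothstep_cont.
have [c1 c2 c3] := C1_sqdist p; split.
- by move=> x; apply: contB; [exact: cont_cst|apply: contZ; exact: c1].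
- by move=> i x; apply: contN; apply: contZ; exact: c2.
- move=> i x; rewrite -sub0r; apply: derB; first exact: der_cst.
  exact/derZ/c3.
Qed.

Lemma sqdist_coord (R : realType) (n : nat) (p x : 'rV[R]_n) (i : 'I_n) :
  (x ord0 i - p ord0 i) ^+ 2 <= sqdist p x.
Proof.
by rewrite /sqdist (bigD1 i) //= lerDl sumr_ge0 // => j _; exact: sqr_ge0.
Qed.

Lemma ball_bump_itv (R : realType) (n : nat) (p : 'rV[R]_n) (r : R) (x : 'rV[R]_n) :
  0 <= ball_bump p r x <= 1.
Proof. exact: smoothstep_itv. Qed.

Lemma ball_bump_out (R : realType) (n : nat) (p : 'rV[R]_n) (r : R) (x : 'rV[R]_n) :
  0 < r -> 2 * r ^+ 2 <= sqdist p x -> ball_bump p r x = 0.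
Proof.
move=> r0 h; apply: smoothstep_le0; rewrite subr_le0 mulrC ler_pdivlMr//.
exact: exprn_gt0.
Qed.

Lemma ball_bump_in (R : realType) (n : nat) (p : 'rV[R]_n) (r : R) (x : 'rV[R]_n) :
  0 < r -> sqdist p x <= r ^+ 2 -> ball_bump p r x = 1.
Proof.
move=> r0 h; apply: smoothstep_ge1.
have : r ^- 2 * sqdist p x <= 1.
  by rewrite mulrC ler_pdivrMr ?exprn_gt0// mul1r.
lra.
Qed.

Lemma dball_bump_out (R : realType) (n : nat) (p : 'rV[R]_n) (r : R) (i : 'I_n)
    (x : 'rV[R]_n) : 0 < r -> 2 * r ^+ 2 <= sqdist p x -> dball_bump p r i x = 0.
Proof.
move=> r0 h; rewrite /dball_bump dsmoothstep_le0 ?mul0r// subr_le0 mulrC ler_pdivlMr//.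
exact: exprn_gt0.
Qed.

Lemma dball_bump_le (R : realType) (n : nat) (p : 'rV[R]_n) (r : R) (i : 'I_n)
    (x : 'rV[R]_n) : 0 < r -> `|dball_bump p r i x| <= 8 / r.
Proof.
move=> r0; have [h|h] := leP (2 * r ^+ 2) (sqdist p x).
  by rewrite dball_bump_out// normr0 divr_ge0// ltW.
have hi := le_lt_trans (sqdist_coord p x i) h.
have hi2 : `|x ord0 i - p ord0 i| <= 2 * r.
  rewrite ler_norml; apply/andP; split; nra.
have /andP[d0 d2] := dsmoothstep_itv (2 - r ^- 2 * sqdist p x).
rewrite /dball_bump normrM (ger0_norm d0) normrN normrM normrM normfV.
rewrite (ger0_norm (ler0n _ 2)) (ger0_norm (ltW (exprn_gt0 2 r0))).
have -> : 8 / r = 2 * (r ^- 2 * (2 * (2 * r))).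
  by field; rewrite gt_eqF.
apply: ler_pM => //.
  by rewrite mulr_ge0// ?invr_ge0 ?exprn_ge0 ?mulr_ge0// ltW.
apply: ler_wpM2l; first by rewrite invr_ge0 exprn_ge0// ltW.
exact: ler_wpM2l.
Qed.

Lemma mvt_line (R : realType) (V : normedModType R) (f : V -> R) (x v : V)
    (h : R) (df : R -> R) :
  (forall s : R, 0 <= s <= 1 -> der ((s * h) *: v + x) v f (df s)) ->
  exists2 s, 0 <= s <= 1 & f (h *: v + x) - f x = df s * h.
Proof.
move=> fdf; pose G (t : R) := f (t *: v + x); pose g (s : R) := G (s * h).
have gdg (s : R) : 0 <= s <= 1 -> der s 1 g (df s * h).
  move=> s01; apply: (@der_comp R R G (fun s => s * h)).
    exact/is_derive_line/fdf.
  rewrite -[X in der _ _ _ X](_ : s * 0 + h * 1 = h); last by rewrite mulr0 mulr1 add0r.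
  by apply: (@derM _ _ id); [exact: der_id|exact: der_cst].
have [||s s01 E] := @MVT_segment R g (fun s => df s * h) 0 1 ler01.
- by move=> s; rewrite in_itv /= => s01; apply: gdg; lra.
- apply: continuous_in_subspaceT => s; rewrite inE /= in_itv /= => s01.
  exact/is_derive1_cont/gdg.
exists s; first by move: s01; rewrite in_itv.
by move: E; rewrite /g /G mul1r mul0r scale0r add0r subr0 mulr1.
Qed.

(** The coordinates of x are changed into those of y one at a time; the
    intermediate points stay in the ball because a ball of the sup norm is a
    product of intervals. *)
Lemma partial_lip (R : realType) (n : nat) (f : 'rV[R]_n -> R) (p : 'rV[R]_n)
    (rho C : R) :
  (forall x i, `|x - p| < rho -> derivable f x (delta_mx ord0 i) /\
     `|'D_(delta_mx ord0 i) f x| <= C) ->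
  forall x y, `|x - p| < rho -> `|y - p| < rho ->
    `|f y - f x| <= n%:R * C * `|y - x|.
Proof.
move=> fC x y xp yp.
pose mix k : 'rV[R]_n := \row_(i < n) if (i < k)%N then y ord0 i else x ord0 i.
have key k : (k <= n)%N -> `|f (mix k) - f x| <= k%:R * C * `|y - x|.
  elim: k => [_|k IH kn].
    rewrite (_ : mix 0 = x) ?subrr ?normr0 ?mul0r//.
    by apply/rowP => i; rewrite mxE ltn0.
  pose K := Ordinal kn; pose h := y ord0 K - x ord0 K.
  have mixS : mix k.+1 = h *: delta_mx ord0 K + mix k.
    apply/rowP => i; rewrite !mxE eqxx /= ltnS.
    have [->|iK] := eqVneq i K.
      by rewrite leqnn ltnn mulr1 /h subrK.
    rewrite mulr0 add0r; congr (if _ then _ else _).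
    by rewrite leq_eqVlt (negPf (_ : nat_of_ord i != k)).
  have inb s : 0 <= s <= 1 -> `|s *: (h *: delta_mx ord0 K) + mix k - p| < rho.
    move=> s01; apply: (@le_lt_trans _ _ (Num.max `|x - p| `|y - p|)).
      apply: rv_norm_le => [|i]; first by rewrite le_max normr_ge0.
      have xi := rv_coord_le (x - p) i; have yi := rv_coord_le (y - p) i.
      have xm : `|x - p| <= Num.max `|x - p| `|y - p| by rewrite le_max lexx.
      have ym : `|y - p| <= Num.max `|x - p| `|y - p| by rewrite le_max lexx orbT.
      move: (le_trans xi xm) (le_trans yi ym); rewrite !mxE eqxx /=.
      set m := Num.max _ _; move=> xi' yi'.
      have [iK|iK] := eqVneq i K.
        rewrite iK in xi' yi' *; rewrite ltnn mulr1 /h; move: xi' yi' s01.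
        rewrite !ler_norml => /andP[x1 x2] /andP[y1 y2] /andP[s0 s1].
        by apply/andP; split; nra.
      by rewrite !mulr0 add0r; case: ifP.
    by rewrite gt_max xp yp.
  have [|s s01 E] := @mvt_line R _ f (mix k) (delta_mx ord0 K) h
      (fun s => 'D_(delta_mx ord0 K) f ((s * h) *: delta_mx ord0 K + mix k)).
    move=> s s01; have [dfs _] := fC _ K (inb s s01).
    by rewrite -scalerA; exact: derivableP dfs.
  have [_ dC] := fC _ K (inb s s01).
  rewrite mixS (_ : f _ - f x = (f (h *: delta_mx ord0 K + mix k) - f (mix k)) +
     (f (mix k) - f x)); last by ring.
  rewrite E -scalerA -natr1 mulrDl mulrDl mul1r addrC.
  apply: (le_trans (ler_normD _ _)); apply: lerD; first exact/IH/ltnW.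
  rewrite normrM; apply: ler_pM => //.
  by have := rv_coord_le (y - x) K; rewrite !mxE.
have := key n (leqnn n); rewrite (_ : mix n = y)//.
by apply/rowP => i; rewrite mxE ltn_ord.
Qed.

(** * Cutoffs near a regular boundary point *)

(** Integration by parts moves the derivative to the factor a, so that the
    bound does not see the size of du, which is of order 1 / eps in the
    applications. *)
Lemma bint_parts_le (R : realType) (M : R) (n : nat) (O : set 'rV[R]_n)
    (a u : 'rV[R]_n -> R) (da du : 'I_n -> 'rV[R]_n -> R) (i : 'I_n) (U C : R) :
  0 < M -> C1 a da ->
  (forall x, O x -> continuous_at x u) ->
  (forall i x, O x -> continuous_at x (du i)) ->
  (forall i x, O x -> der x (delta_mx ord0 i) u (du i x)) ->
  (forall x, ~ O x -> \forall y \near x, a y = 0) ->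
  (forall x : 'rV[R]_n, `|x ord0 i| = M -> a x = 0) ->
  (forall x, 0 <= u x <= U) -> (forall x, `|da i x| <= C) ->
  continuous (fun x => a x * du i x) /\
  `|bint M (fun x => a x * du i x)| <= (2 * M) ^+ n * (U * C).
Proof.
move=> M0 Ca cu cdu uu a0 aM uU daC; have [ca cda _] := Ca.
have c1 : continuous (fun x => a x * du i x).
  exact: (cont_glue (fun x _ => ca x) (cdu i) a0).
have c2 : continuous (fun x => da i x * u x).
  apply: (cont_glue (fun x _ => cda i x) cu) => y nOy.
  exact: (C1_near0 _ Ca (a0 y nOy)).
split => //.
have [cau _ auau] := C1_glue Ca cu cdu uu a0.
have : bint M (fun x => a x * du i x + da i x * u x) = 0.
  apply: (@bint_partial _ _ _ i (fun x => a x * u x)) => //.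
  - by move=> x; apply: contD; [exact: c1|exact: c2].
  - by move=> x; exact: auau.
  - by move=> x xM; rewrite aM // mul0r.
rewrite bintD // => /eqP; rewrite addr_eq0 => /eqP ->; rewrite normrN.
have UC x : `|da i x * u x| <= U * C.
  by have /andP[? ?] := uU x; rewrite mulrC normrM (ger0_norm (_ : 0 <= u x))// ler_pM.
have cc (c : R) : continuous (fun _ : 'rV[R]_n => c) by move=> ?; exact: cont_cst.
rewrite -(bint_cst n _ M0) ler_norml -mulN1r -bintZ //.
by apply/andP; split; apply: le_bint => // x;
  have := UC x; rewrite ler_norml => /andP[]; rewrite ?mulN1r.
Qed.

Lemma near_forall_ord (X : topologicalType) (n : nat) (P : 'I_n -> X -> Prop)
    (x : X) : (forall i, \forall y \near x, P i y) ->
  \forall y \near x, forall i, P i y.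
Proof. by move=> h; apply: filter_forall. Qed.

Lemma near_and (X : topologicalType) (P Q : X -> Prop) (x : X) :
  (\forall y \near x, P y) -> (\forall y \near x, Q y) ->
  \forall y \near x, P y /\ Q y.
Proof. exact: filterI. Qed.

Lemma near_imp (X : topologicalType) (P Q : X -> Prop) (x : X) :
  (\forall y \near x, P y) -> (forall y, P y -> Q y) -> \forall y \near x, Q y.
Proof. by move=> h PQ; exact: filterS h. Qed.

Lemma near_dist (R : realType) (V : normedModType R) (P : V -> Prop) (x : V) :
  (\forall y \near x, P y) <->
  exists2 r : R, 0 < r & forall y, `|y - x| < r -> P y.
Proof.
split => [/nbhs_ballP[r /= r0 hr]|[r r0 hr]].
  by exists r => // y yx; apply: hr; rewrite -ball_normE /= distrC.
by apply/nbhs_ballP; exists r => // y; rewrite -ball_normE /= distrC => /hr.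
Qed.

Lemma cont_distP (R : realType) (X : topologicalType) (f : X -> R) (x : X) :
  continuous_at x f <->
  forall e : R, 0 < e -> \forall y \near x, `|f y - f x| < e.
Proof.
split=> [cf e e0|h]; first exact: (@cvgr_distC_lt R R X _ _ f (f x) cf e e0).
apply/cvgrPdist_lt => e e0; apply: filterS (h e e0) => y.
by rewrite distrC.
Qed.

Lemma near_dist_lt (R : realType) (V : normedModType R) (p x : V) (r : R) :
  `|x - p| < r -> \forall y \near x, `|y - p| < r.
Proof.
move=> xp.
have cx : continuous_at x (fun y => `|y - p|).
  apply: (@cont_comp _ _ _ (fun y => y - p)); last exact: norm_continuous.
  by apply: cvgB; [exact: cvg_id|exact: cvg_cst].
exact: (cvgr_lt _ cx).
Qed.

Lemma near_dist_gt (R : realType) (V : normedModType R) (p x : V) (r : R) :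
  r < `|x - p| -> \forall y \near x, r < `|y - p|.
Proof.
move=> xp.
have cx : continuous_at x (fun y => `|y - p|).
  apply: (@cont_comp _ _ _ (fun y => y - p)); last exact: norm_continuous.
  by apply: cvgB; [exact: cvg_id|exact: cvg_cst].
exact: (cvgr_gt _ cx).
Qed.

(** Near a regular boundary point one partial derivative of psi keeps the sign
    sg and stays away from 0.  Continuity of psi comes from the boundedness of its
    partial derivatives, by partial_lip. *)
Lemma chart_of_C1 (R : realType) (n : nat) (A : set 'rV[R]_n.+1)
    (p : 'rV[R]_n.+1) (psi : 'rV[R]_n.+1 -> R) : C1_defining A p psi ->
  exists k c sg r, [/\ 0 < c, 0 < r, `|sg| = 1 :> R &
    forall x, `|x - p| < r ->
    [/\ continuous_at x psi,
        forall i, der x (delta_mx ord0 i) psi ('D_(delta_mx ord0 i) psi x),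
        forall i, continuous_at x (fun y => 'D_(delta_mx ord0 i) psi y),
        c <= sg * 'D_(delta_mx ord0 k) psi x
      & (A x <-> psi x < 0) /\ C1_defining A x psi]].
Proof.
move=> [near1 [k kp] near2].
pose D i y := 'D_(delta_mx ord0 i) psi y.
have cp i : continuous_at p (D i) := (nbhs_singleton near1 i).2.
pose sg := Num.sg (D k p); pose c := `|D k p| / 2.
have c0 : 0 < c by rewrite divr_gt0// normr_gt0.
have near3 : \forall x \near p, c <= sg * D k x.
  have : continuous_at p (fun x => sg * D k x) by apply: contZ; exact: cp.
  have E : sg * D k p = `|D k p| by rewrite normrEsg.
  move=> /cvgr_ge; rewrite E; apply.
  by rewrite /c ltr_pdivrMr // ltr_pMr ?normr_gt0// ltr1n.
have near4 : \forall x \near p, forall i, `|D i x| <= \sum_j `|D j p| + 1.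
  apply: near_forall_ord => i.
  have : continuous_at p (fun x => `|D i x|).
    by apply: (@cont_comp _ _ _ (D i)); [exact: cp|exact: norm_continuous].
  move=> /cvgr_le; apply.
  rewrite (bigD1 i)//= -addrA ltrDl ltr_pwDr// sumr_ge0 // => j _.
have := near_and (near_and near1 near2) (near_and near3 near4).
move=> /near_dist[r r0 hr].
exists k, c, sg, r; split => //.
  by rewrite normr_sg kp.
move=> x xp; have [[h1 h2] [h3 h4]] := hr x xp.
have nx := near_dist_lt xp.
split => //.
- pose C := n.+1%:R * (\sum_j `|D j p| + 1).
  have C0 : 0 < C by rewrite mulr_gt0 ?ltr0n// ltr_wpDl// sumr_ge0.
  have lip y : `|y - p| < r -> `|psi y - psi x| <= C * `|y - x|.
    move=> yp; apply: (@partial_lip R n.+1 psi p r) => // z i zp.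
    by have [[z1 _] [_ z2]] := hr z zp; split; [exact: (z1 i).1|exact: z2].
  apply/cont_distP => e e0.
  have xx : `|x - x| < e / C by rewrite subrr normr0 divr_gt0.
  apply: (near_imp (near_and nx (near_dist_lt xx))) => y [yp yx].
  apply: (le_lt_trans (lip y yp)).
  by rewrite -ltr_pdivlMl// mulrC.
- by move=> i; exact: derivableP (h1 i).1.
- by move=> i; exact: (h1 i).2.
- split => //; split.
  + by apply: (near_imp nx) => y /hr [[]].
  + exists k; apply: contraTneq h3; rewrite /D => ->; rewrite mulr0 -ltNge; exact: c0.
  + by apply: (near_imp nx) => y /hr [[]].
Qed.

(** W is a family of vector fields on D, in the application the horizontal flux
    at all heights and times.  The continuous majorant m of all |W . grad chi| is
    what has to have a small integral. *)
Definition cutoff (R : realType) (n : nat) (I : Type) (D : set 'rV[R]_n)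
    (W : I -> 'I_n -> 'rV[R]_n -> R) (chi : 'rV[R]_n -> R)
    (dchi : 'I_n -> 'rV[R]_n -> R) (m : 'rV[R]_n -> R) : Prop :=
  [/\ C1 chi dchi, forall x, 0 <= chi x <= 1, continuous m, forall x, 0 <= m x
    & forall k x, D x -> `|\sum_i W k i x * dchi i x| <= m x].

Lemma sqdist_ball (R : realType) (n : nat) (p x : 'rV[R]_n) (r : R) : 0 <= r ->
  sqdist p x < r ^+ 2 -> `|x - p| <= r.
Proof.
move=> r0 h; apply: rv_norm_le => // i.
have hi := le_lt_trans (sqdist_coord p x i) h.
by rewrite !mxE ler_norml; apply/andP; split; nra.
Qed.

Lemma sqdist_far (R : realType) (n : nat) (p x : 'rV[R]_n) (r : R) : 0 <= r ->
  r < `|x - p| -> r ^+ 2 <= sqdist p x.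
Proof. by move=> r0 h; rewrite leNgt; apply: contraTN h => /(sqdist_ball r0); rewrite leNgt. Qed.

Lemma smoothstep_affine (R : realType) (n : nat) (psi : 'rV[R]_n -> R)
    (dpsi : 'I_n -> 'rV[R]_n -> R) (a b : R) (O : set 'rV[R]_n) :
  (forall x, O x -> continuous_at x psi) ->
  (forall i x, O x -> continuous_at x (dpsi i)) ->
  (forall i x, O x -> der x (delta_mx ord0 i) psi (dpsi i x)) ->
  [/\ forall x, O x -> continuous_at x (fun x => smoothstep (a * psi x + b)),
     forall i x, O x -> continuous_at x
       (fun x => dsmoothstep (a * psi x + b) * (a * dpsi i x))
   & forall i x, O x -> der x (delta_mx ord0 i)
       (fun x => smoothstep (a * psi x + b)) (dsmoothstep (a * psi x + b) * (a * dpsi i x))].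
Proof.
move=> h1 h2 h3.
have h4 x : O x -> continuous_at x (fun x => a * psi x + b).
  by move=> Ox; apply: contD; [apply: contZ; exact: h1|exact: cont_cst].
split.
- move=> x Ox; apply: (@cont_comp _ _ _ (fun x => a * psi x + b)); first exact: h4.
  exact: is_derive1_cont (der_smoothstep _).
- move=> i x Ox; apply: contM; last by apply: contZ; exact: h2.
  apply: (@cont_comp _ _ _ (fun x => a * psi x + b)); first exact: h4.
  exact: dsmoothstep_cont.
- move=> i x Ox; apply: (@der_comp _ _ (@smoothstep R) (fun x => a * psi x + b)).
    exact: der_smoothstep.
  rewrite -[X in der _ _ _ X]addr0; apply: derD; last exact: der_cst.
  exact/derZ/h3.
Qed.

Lemma cube_compact (R : realType) (n : nat) (a b : 'I_n -> R) :
  compact [set v : 'rV[R]_n | forall i, a i <= v ord0 i <= b i].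
Proof.
have := @rV_compact R n (fun i => `[a i, b i]%classic)
  (fun i => @segment_compact _ _ _).
congr compact; apply/seteqP; split => v h i; have := h i; rewrite /= in_itv //.
Qed.

Lemma near2_left (X : topologicalType) (T : Type) (F : set_system T)
    (P : T -> X -> Prop) (Q : X -> Prop) (x : X) : Filter F ->
  (\forall y \near x, Q y) -> (forall y e, Q y -> P e y) ->
  \forall y \near x & e \near F, P e y.
Proof.
move=> FF h QP; exists (Q, setT); first by split; [exact: h|exact: filterT].
by move=> [y e] /= [Qy _]; exact: QP.
Qed.

(** With eta a bump at p, chi = 1 - eta * smoothstep (psi / eps + 2) is 0 close
    to p where psi > - eps, and 1 where psi < - 2 eps.  Two terms make up its
    gradient.  The first is along grad psi and of order 1 / eps, but W is almost
    orthogonal to grad psi near the boundary, and the integral of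
    |grad (smoothstep (psi / eps + 2))| is bounded independently of eps: up to a
    constant it is that of a partial derivative of constant sign, which is
    integrated by parts.  The second is along grad eta: it is bounded and lives on
    the strip - 2 eps < psi < 0, whose measure is O(eps).  Domination by the
    derivative of another step, of width 4 eps, proves the latter. *)
Lemma regular_cutoff (R : realType) (n : nat) (I : Type) (D : set 'rV[R]_n.+1)
    (W : I -> 'I_n.+1 -> 'rV[R]_n.+1 -> R) (M C rho : R) (p : 'rV[R]_n.+1) 
    (psi : 'rV[R]_n.+1 -> R) :
  open D -> 0 < rho -> `|p| + 1 <= M -> C1_defining D p psi ->
  (forall k i x, D x -> `|W k i x| <= C) ->
  (forall y psi, boundary D y -> C1_defining D y psi -> forall w, 0 < w ->
     \forall x \near y, D x -> forall k,
       `|\sum_i W k i x * 'D_(delta_mx ord0 i) psi x| <= w) ->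
  exists U, [/\ open U, U p & forall del, 0 < del -> exists chi dchi m,
    [/\ cutoff D W chi dchi m, bint M m <= del,
      forall x, rho <= `|x - p| -> chi x = 1
    & forall x, U x -> ~ D x -> \forall y \near x, chi y = 0]].
Proof.
move=> oD rho0 pM Cpsi WC Wpsi.
have [k [c [sg [r0 [c0 r00 sg1 chart]]]]] := chart_of_C1 Cpsi.
pose r := Num.min r0 (Num.min rho 1) / 4.
have r4 : 0 < 4 * r by rewrite /r mulrC divfK// !lt_min r00 rho0 ltr01.
have r_gt0 : 0 < r by lra.
have [r4r0 r4rho r41] : [/\ 4 * r <= r0, 4 * r <= rho & 4 * r <= 1].
  by rewrite /r mulrC divfK// !ge_min !lexx !orbT.
have M0 : 0 < M by apply: lt_le_trans pM; rewrite ltr_wpDl.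
pose O := [set x : 'rV[R]_n.+1 | `|x - p| < 4 * r].
have chO x : O x -> _ := fun Ox => chart x (lt_le_trans Ox r4r0).
have far x : 3 * r < `|x - p| -> 9 * r ^+ 2 <= sqdist p x.
  move=> h; have -> : 9 * r ^+ 2 = (3 * r) ^+ 2 by ring.
  by apply: sqdist_far => //; rewrite mulr_ge0 // ltW.
have nO x : ~ O x -> \forall y \near x, 9 * r ^+ 2 <= sqdist p y.
  move=> /negP; rewrite -leNgt => h.
  have h3 : 3 * r < `|x - p| by apply: lt_le_trans h; lra.
  by apply: near_imp (near_dist_gt h3) _ => y; exact: far.
pose eta := ball_bump p r; pose eta2 := ball_bump p (2 * r).
have rr : 0 < 2 * r by rewrite mulr_gt0.
have sq0 : 0 <= r ^+ 2 by exact: sqr_ge0.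
have eta_far x : 9 * r ^+ 2 <= sqdist p x -> eta x = 0.
  by move=> h; apply: ball_bump_out => //; lra.
have eta2_far x : 9 * r ^+ 2 <= sqdist p x -> eta2 x = 0.
  by move=> h; apply: ball_bump_out => //; rewrite exprMn; lra.
have eta_nO x : ~ O x -> \forall y \near x, eta y = 0.
  by move=> /nO h; apply: near_imp h _; exact: eta_far.
have eta2_nO x : ~ O x -> \forall y \near x, eta2 y = 0.
  by move=> /nO h; apply: near_imp h _; exact: eta2_far.
have xM (x : 'rV[R]_n.+1) : `|x ord0 k| = M -> 9 * r ^+ 2 <= sqdist p x.
  move=> xkM; apply: far; have h1 := rv_coord_le x k.
  have h2 : `|x| <= `|x - p| + `|p| by rewrite -{1}(subrK p x) ler_normD.
  have : `|x - p| >= 1 by rewrite xkM in h1; lra.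
  by apply: lt_le_trans; lra.
pose dpsi i x := 'D_(delta_mx ord0 i) psi x.
have p1 x : O x -> continuous_at x psi by move=> /chO [].
have p2 i x : O x -> continuous_at x (dpsi i) by move=> /chO[_ _ h _ _]; exact: h.
have p3 i x : O x -> der x (delta_mx ord0 i) psi (dpsi i x).
  by move=> /chO[_ h _ _ _]; exact: h.
have pk x : O x -> c <= sg * dpsi k x by move=> /chO[].
have pD x : O x -> (D x <-> psi x < 0) by move=> /chO[_ _ _ _ []].
pose B := 8 / r * (2 * M) ^+ n.+1.
have B0 : 0 < B.
  by apply: mulr_gt0; [exact: divr_gt0|apply: exprn_gt0; exact: mulr_gt0].
exists [set x | sqdist p x < r ^+ 2]; split.
- apply: open_comp (_ : open [set s : R | s < r ^+ 2]); last exact: open_lt.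
  by move=> x _; have [c1 _ _] := C1_sqdist p; exact: c1.
- rewrite /= /sqdist big1 ?exprn_gt0// => i _; by rewrite subrr expr0n.
move=> del del0.
(* w and emax are such that each of the two terms of m has integral at most
   del / 2. *)
pose w := del / 2 * c / B.
have w0 : 0 < w by rewrite divr_gt0// mulr_gt0// divr_gt0.
pose A := n.+1%:R * (`|C| * (8 / r)).
have A0 : 0 <= A by do 2 (apply: mulr_ge0 => //); apply: divr_ge0 => //; exact: ltW.
pose emax := (del / 2) * c / (4 * (A + 1) * B).
have emax0 : 0 < emax.
  apply: divr_gt0; first by rewrite mulr_gt0// divr_gt0.
  by rewrite mulr_gt0// mulr_gt0//; lra.
(* By compactness, W is almost orthogonal to grad psi on a whole strip along the
   boundary. *)
have [eps eps0 [epsm strip]] : exists2 eps, 0 < eps & eps <= emax /\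
   (forall x, sqdist p x < 2 * r ^+ 2 -> D x -> - 2 * eps < psi x -> forall j,
      `|\sum_i W j i x * dpsi i x| <= w).
  pose K0 := [set v : 'rV[R]_n.+1 | forall i, p ord0 i - 2 * r <= v ord0 i <= p ord0 i + 2 * r].
  have cK0 : compact K0 by exact: cube_compact.
  have K0O x : K0 x -> O x.
    move=> Kx; rewrite /O /=; apply: (@le_lt_trans _ _ (2 * r)); last lra.
    apply: rv_norm_le => [|i]; first by rewrite mulr_ge0// ltW.
    by have := Kx i; rewrite !mxE ler_norml; lra.
  pose P (eps : R) x := D x -> - 2 * eps < psi x -> forall j,
      `|\sum_i W j i x * dpsi i x| <= w.
  have : \forall eps \near 0^'+, K0 `<=` P eps.
    move/compact_near_coveringP : cK0; apply => x Kx.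
    have Ox := K0O x Kx.
    have [Dx|nDx] := pselect (D x).
      have px : psi x < 0 by apply/(pD _ Ox).
      have n1 : \forall y \near x, psi y < psi x / 2.
        by apply: (cvgr_lt _ (p1 _ Ox)); lra.
      have n2 : \forall e \near 0^'+, e < - psi x / 4.
        by apply: nbhs_right_lt; lra.
      exists ([set y | psi y < psi x / 2], [set e | e < - psi x / 4]) => //.
      by move=> [y e] /= [h1 h2] _ h3; lra.
    have [clx|nclx] := pselect (closure D x).
      have bx : boundary D x.
        by split => // ix; apply: nDx; exact: interior_subset ix.
      have [_ _ _ _ [_ Cx]] := chart x (lt_le_trans Ox r4r0).
      have n1 := Wpsi x psi bx Cx w w0.
      by apply: (near2_left _ n1) => y e h1 Dy _; exact: h1.
    have n1 : \forall y \near x, ~ closure D y.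
      exact: (open_nbhs_nbhs (conj (closed_openC (@closed_closure _ D)) nclx)).
    apply: (near2_left _ n1) => y e h1 Dy.
    by exfalso; apply: h1; exact: subset_closure.
  move=> hP.
  have : \forall e \near 0^'+, 0 < e /\ e <= emax /\ K0 `<=` P e.
    have g0 : \forall e \near (0 : R)^'+, 0 < e by exact: nbhs_right_gt.
    have g1 : \forall e \near 0^'+, e <= emax by exact: nbhs_right_le.
    by apply: filterS3 g0 g1 hP.
  move=> /filter_ex [e [e0 [em he]]]; exists e => //; split => // x xr.
  apply: he => i /=.
  have := le_lt_trans (sqdist_coord p x i) xr => h.
  by apply/andP; split; nra.
have epsi : 0 < eps^-1 by rewrite invr_gt0.
have [k1 k2 k3] := @smoothstep_affine R n.+1 psi dpsi eps^-1 2 O p1 p2 p3.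
have [g1 g2 g3] := @smoothstep_affine R n.+1 psi dpsi (4 * eps)^-1 (3 / 4) O p1 p2 p3.
set K := (fun x => smoothstep (eps^-1 * psi x + 2)) in k1 k3.
set dK := (fun i x => dsmoothstep (eps^-1 * psi x + 2) * (eps^-1 * dpsi i x)) in k2 k3.
set G := (fun x => smoothstep ((4 * eps)^-1 * psi x + 3 / 4)) in g1 g3.
set dG := (fun i x => dsmoothstep ((4 * eps)^-1 * psi x + 3 / 4) * ((4 * eps)^-1 * dpsi i x)) in g2 g3.
(* K has slope 1 / eps on the strip; G is four times wider, so that its derivative
   is bounded below on the whole strip. *)
have [|||cm1 bm1] := @bint_parts_le R M n.+1 O eta K (dball_bump p r) dK k 1 (8 / r) M0
   (C1_ball_bump p r) k1 k2 k3 eta_nO.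
- by move=> x /xM /eta_far.
- by move=> x; exact: smoothstep_itv.
- by move=> x; exact: dball_bump_le.
have [|||cm2 bm2] := @bint_parts_le R M n.+1 O eta2 G (dball_bump p (2 * r)) dG k 1
   (8 / (2 * r)) M0 (C1_ball_bump p (2 * r)) g1 g2 g3 eta2_nO.
- by move=> x /xM /eta2_far.
- by move=> x; exact: smoothstep_itv.
- by move=> x; exact: dball_bump_le.
pose m x := w / c * sg * (eta x * dK k x) + 4 * eps * A / c * sg * (eta2 x * dG k x).
have sw : `|w / c * sg| = w / c by rewrite normrM sg1 mulr1 gtr0_norm// divr_gt0.
have eA : 0 <= 4 * eps * A / c.
  by apply: divr_ge0; [apply: mulr_ge0 => //; apply: mulr_ge0 => //|]; exact: ltW.
have se : `|4 * eps * A / c * sg| = 4 * eps * A / c.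
  by rewrite normrM sg1 mulr1 ger0_norm.
have eta0 x : 0 <= eta x <= 1 by exact: ball_bump_itv.
have eta20 x : 0 <= eta2 x <= 1 by exact: ball_bump_itv.
have eps4 : 0 < (4 * eps)^-1 by rewrite invr_gt0 mulr_gt0.
have nOeta x : ~ O x -> eta x = 0 by move=> nOx; exact: nbhs_singleton (eta_nO x nOx).
have nOeta2 x : ~ O x -> eta2 x = 0 by move=> nOx; exact: nbhs_singleton (eta2_nO x nOx).
have m1_ge0 x : 0 <= w / c * sg * (eta x * dK k x).
  have [Ox|nOx] := pselect (O x); last by rewrite nOeta// mul0r mulr0.
  have -> : w / c * sg * (eta x * dK k x) =
    w / c * (eta x * (dsmoothstep (eps^-1 * psi x + 2) * (eps^-1 * (sg * dpsi k x)))).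
    by rewrite /dK; ring.
  have /andP[e0 _] := eta0 x; have /andP[d0 _] := dsmoothstep_itv (eps^-1 * psi x + 2).
  apply: mulr_ge0; first by rewrite divr_ge0 // ltW.
  apply: mulr_ge0 => //; apply: mulr_ge0 => //; apply: mulr_ge0; first exact: ltW.
  by apply: le_trans (pk x Ox); exact: ltW.
have m2_ge0 x : 0 <= 4 * eps * A / c * sg * (eta2 x * dG k x).
  have [Ox|nOx] := pselect (O x); last by rewrite nOeta2// mul0r mulr0.
  have -> : 4 * eps * A / c * sg * (eta2 x * dG k x) = 4 * eps * A / c *
    (eta2 x * (dsmoothstep ((4 * eps)^-1 * psi x + 3 / 4) * ((4 * eps)^-1 * (sg * dpsi k x)))).
    by rewrite /dG; ring.
  have /andP[e0 _] := eta20 x; have /andP[d0 _] := dsmoothstep_itv ((4 * eps)^-1 * psi x + 3 / 4).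
  apply: mulr_ge0 => //.
  apply: mulr_ge0 => //; apply: mulr_ge0 => //; apply: mulr_ge0; first exact: ltW.
  by apply: le_trans (pk x Ox); exact: ltW.
exists (fun x => 1 - eta x * K x), (fun i x => - (eta x * dK i x + dball_bump p r i x * K x)), m.
split; first split.
- exact: C1_onem (C1_glue (C1_ball_bump p r) k1 k2 k3 eta_nO).
- move=> x; have /andP[e0 e1] := eta0 x.
  have /andP[K0 K1] := smoothstep_itv (eps^-1 * psi x + 2).
  rewrite subr_ge0 gerBl mulr_ile1 //=; exact: mulr_ge0.
- by move=> x; apply: contD; apply: contZ; [exact: cm1|exact: cm2].
- by move=> x; apply: addr_ge0.
- move=> j x Dx.
  have [xr|xr] := leP (2 * r ^+ 2) (sqdist p x).
    rewrite big1 ?normr0; first by apply: addr_ge0.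
    by move=> i _; rewrite /eta ball_bump_out// dball_bump_out// !mul0r addr0 oppr0 mulr0.
  have Ox : O x.
    rewrite /O /=; apply: (@le_lt_trans _ _ (2 * r)); last lra.
    by apply: sqdist_ball; [exact: ltW|rewrite exprMn; lra].
  have [xe|xe] := leP (psi x) (- 2 * eps).
    have xe' : eps^-1 * psi x + 2 <= 0.
      have : eps^-1 * psi x <= - 2 by rewrite mulrC ler_pdivrMr.
      by lra.
    rewrite big1 ?normr0; first by apply: addr_ge0.
    move=> i _; rewrite /dK /K smoothstep_le0// dsmoothstep_le0//.
    by rewrite !(mul0r, mulr0) addr0 oppr0 mulr0.
  have tang := strip x xr Dx xe j.
  have psi0 : psi x < 0 by apply/(pD x Ox).
  have -> : \sum_i W j i x * - (eta x * dK i x + dball_bump p r i x * K x) =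
    - (eta x * (dsmoothstep (eps^-1 * psi x + 2) * eps^-1) * (\sum_i W j i x * dpsi i x)
       + K x * (\sum_i W j i x * dball_bump p r i x)).
    rewrite !mulr_sumr -big_split -sumrN /=; apply: eq_bigr => i _.
    by rewrite /dK; ring.
  rewrite normrN; apply: (le_trans (ler_normD _ _)); apply: lerD.
    have -> : w / c * sg * (eta x * dK k x) =
      eta x * (dsmoothstep (eps^-1 * psi x + 2) * eps^-1) * (w / c * (sg * dpsi k x)).
      by rewrite /dK; ring.
    have /andP[e0 _] := eta0 x; have /andP[d0 _] := dsmoothstep_itv (eps^-1 * psi x + 2).
    have ed : 0 <= eta x * (dsmoothstep (eps^-1 * psi x + 2) * eps^-1).
      by apply: mulr_ge0 => //; apply: mulr_ge0 => //; exact: ltW.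
    rewrite normrM ger0_norm//; apply: ler_wpM2l => //; apply: (le_trans tang).
    rewrite mulrAC ler_pdivlMr// ler_wpM2l//; [exact: ltW|exact: pk].
  have /andP[K0 K1] := smoothstep_itv (eps^-1 * psi x + 2).
  apply: (@le_trans _ _ A).
    rewrite normrM (ger0_norm K0) -[X in _ <= X]mul1r; apply: ler_pM => //.
    apply: (le_trans (ler_norm_sum _ _ _)).
    apply: (@le_trans _ _ (\sum_(i < n.+1) `|C| * (8 / r))).
      apply: ler_sum => i _; rewrite normrM; apply: ler_pM => //; last exact: dball_bump_le.
      by apply: (le_trans (WC j i x Dx)); exact: ler_norm.
    by rewrite sumr_const card_ord /A [in leRHS]mulr_natl.
  have -> : 4 * eps * A / c * sg * (eta2 x * dG k x) = A * (eta2 x *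
    (dsmoothstep ((4 * eps)^-1 * psi x + 3 / 4) * ((sg * dpsi k x) / c))).
    by rewrite /dG; field; rewrite !gt_eqF.
  rewrite -[X in X <= _]mulr1; apply: ler_wpM2l => //.
  rewrite /eta2 ball_bump_in//; last by rewrite exprMn; lra.
  rewrite mul1r -[X in X <= _]mul1r; apply: ler_pM => //.
    apply: dsmoothstep_mid.
    have -> : (4 * eps)^-1 * psi x + 3 / 4 = (psi x + 3 * eps) / (4 * eps).
      by field; rewrite gt_eqF.
    rewrite ler_pdivlMr ?ler_pdivrMr ?mulr_gt0//; lra.
  by rewrite ler_pdivlMr// mul1r; exact: pk.
- have cz (c' : R) (f : 'rV[R]_n.+1 -> R) : continuous f -> continuous (fun x : 'rV[R]_n.+1 => c' * f x).
    by move=> cf x; apply: contZ; exact: cf.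
  rewrite bintD//; [|exact: cz|exact: cz]; rewrite !bintZ//.
  apply: (@le_trans _ _ (w / c * B + 4 * eps * A / c * B)).
    apply: lerD.
      apply: (le_trans (ler_norm _)); rewrite normrM sw.
      apply: ler_wpM2l; first by rewrite divr_ge0// ltW.
      by move: bm1; rewrite mul1r mulrC.
    apply: (le_trans (ler_norm _)); rewrite normrM se.
    apply: ler_wpM2l => //; apply: (le_trans bm2).
    rewrite mul1r mulrC /B; apply: ler_wpM2r; first by rewrite exprn_ge0// mulr_ge0// ltW.
    apply: ler_wpM2l => //; rewrite lef_pV2 ?posrE//; lra.
  have -> : w / c * B = del / 2 by rewrite /w; field; rewrite !gt_eqF.
  have : 4 * eps * A / c * B <= del / 2; last lra.
  apply: (@le_trans _ _ (4 * emax * (A + 1) / c * B)).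
    apply: ler_wpM2r; first exact: ltW.
    apply: ler_wpM2r; first by rewrite invr_ge0 ltW.
    by apply: ler_pM; [lra|exact: A0|lra|lra].
  rewrite le_eqVlt; apply/orP; left; apply/eqP; rewrite /emax; field.
  by rewrite !gt_eqF//; lra.
- move=> x rx; rewrite nOeta ?mul0r ?subr0//.
  by apply/negP; rewrite -leNgt; apply: le_trans rx.
- move=> x /= Ux nDx.
  have Ox : O x.
    rewrite /O /=; apply: (@le_lt_trans _ _ r); last lra.
    by apply: sqdist_ball; [exact: ltW|].
  have px : - eps < psi x.
    by rewrite (lt_le_trans (_ : - eps < 0)) ?oppr_lt0// leNgt; apply/negP => /(pD x Ox).
  have n1 : \forall y \near x, - eps < psi y by exact: (cvgr_gt _ (p1 x Ox)).
  have n2 : \forall y \near x, sqdist p y < r ^+ 2.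
    by have [c1 _ _] := C1_sqdist p; exact: (cvgr_lt _ (c1 x)).
  apply: (near_imp (near_and n1 n2)) => y [y1 y2].
  rewrite /eta ball_bump_in// ?ltW// /K smoothstep_ge1 ?mulr1 ?subrr//.
  have : - 1 <= eps^-1 * psi y by rewrite mulrC ler_pdivlMr// mulN1r ltW.
  by lra.
Qed.

(** * Cutoffs of a plane domain *)

Lemma int1_bump_le (R : realType) (M p r : R) : 0 < M -> 0 < r ->
  0 <= int1 (- M) M (fun s => dsmoothstep (1 / 2 + (s - p) / (8 * r))) <= 8 * r.
Proof.
move=> M0 r0; have r8 : 0 < 8 * r by rewrite mulr_gt0.
have cl : continuous (fun s : R => 1 / 2 + (s - p) / (8 * r)).
  move=> s; apply: contD; first exact: cont_cst.
  by apply: contM; [apply: contB; [exact: cont_id|exact: cont_cst]|exact: cont_cst].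
have cd : continuous (fun s : R => dsmoothstep (1 / 2 + (s - p) / (8 * r))).
  move=> s; apply: (@cont_comp _ _ _ (fun s => 1 / 2 + (s - p) / (8 * r))).
    exact: cl.
  exact: dsmoothstep_cont.
apply/andP; split.
  have c0 : continuous (fun _ : R => 0 : R) by move=> ?; exact: cont_cst.
  have -> : 0 = int1 (- M) M (fun=> 0) by rewrite int1_cst ?mulr0//; lra.
  apply: le_int1; [exact: c0|exact: cd|].
  by move=> s _; have /andP[] := dsmoothstep_itv (1 / 2 + (s - p) / (8 * r)).
have -> : int1 (- M) M (fun s => dsmoothstep (1 / 2 + (s - p) / (8 * r))) =
  8 * r * smoothstep (1 / 2 + (M - p) / (8 * r)) - 8 * r * smoothstep (1 / 2 + (- M - p) / (8 * r)).
  suff dF (s : R) : der s 1 (fun s => 8 * r * smoothstep (1 / 2 + (s - p) / (8 * r)))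
      (dsmoothstep (1 / 2 + (s - p) / (8 * r))).
    by rewrite (int1_ftc _ cd (fun s _ => dF s))//; lra.
  have -> : dsmoothstep (1 / 2 + (s - p) / (8 * r)) =
      8 * r * (dsmoothstep (1 / 2 + (s - p) / (8 * r)) * (0 + ((s - p) * 0 + (8 * r)^-1 * (1 - 0)))).
    by field; rewrite gt_eqF.
  apply: derZ; apply: (@der_comp _ _ (@smoothstep R) (fun s => 1 / 2 + (s - p) / (8 * r))).
    exact: der_smoothstep.
  apply: derD; first exact: der_cst.
  apply: derM; last exact: der_cst.
  by apply: derB; [exact: der_id|exact: der_cst].
have h1 := smoothstep_itv (1 / 2 + (M - p) / (8 * r)).
have h2 := smoothstep_itv (1 / 2 + (- M - p) / (8 * r)).
rewrite -mulrBr -[X in _ <= X]mulr1; apply: ler_wpM2l; first exact: ltW.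
lra.
Qed.

(** Points have zero capacity in the plane: the gradient of a bump of radius r
    is O(1 / r) on a set of area O(r^2). *)
Lemma point_cutoff (R : realType) (I : Type) (D : set 'rV[R]_2)
    (W : I -> 'I_2 -> 'rV[R]_2 -> R) (M C rho del : R) (p : 'rV[R]_2) :
  0 < rho -> 0 < M -> 0 < del ->
  (forall k i x, D x -> `|W k i x| <= C) ->
  exists U, [/\ open U, U p & exists chi dchi m,
    [/\ cutoff D W chi dchi m, bint M m <= del,
      forall x, rho <= `|x - p| -> chi x = 1
    & forall x, U x -> \forall y \near x, chi y = 0]].
Proof.
move=> rho0 M0 del0 WC.
have C1p : 0 < `|C| + 1 by rewrite ltr_wpDl.
have [K K0 KE] : exists2 K : R, 0 < K & K = 16 * (8 * 8).
  by exists (16 * (8 * 8)) => //; apply: mulr_gt0 => //; apply: mulr_gt0.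
pose r := Num.min (rho / 4) (del / (K * (`|C| + 1))).
have r0 : 0 < r.
  rewrite lt_min; apply/andP; split; first by apply: divr_gt0.
  by apply: divr_gt0 => //; apply: mulr_gt0.
have [rrho rdel] : r <= rho / 4 /\ r <= del / (K * (`|C| + 1)).
  by rewrite /r !ge_min !lexx orbT.
have rn0 : r != 0 by rewrite gt_eqF.
pose tau (a s : R) := dsmoothstep (1 / 2 + (s - a) / (8 * r)).
have ctau a : continuous (tau a).
  move=> s; apply: (@cont_comp _ _ _ (fun s => 1 / 2 + (s - a) / (8 * r))).
    apply: contD; first exact: cont_cst.
    by apply: contM; [apply: contB; [exact: cont_id|exact: cont_cst]|exact: cont_cst].
  exact: dsmoothstep_cont.
have tau0 a s : 0 <= tau a s by have /andP[] := dsmoothstep_itv (1 / 2 + (s - a) / (8 * r)).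
have tau1 a s : `|s - a| <= 2 * r -> 1 <= tau a s.
  rewrite ler_norml => h; apply: dsmoothstep_mid.
  have -> : 1 / 2 + (s - a) / (8 * r) = (4 * r + (s - a)) / (8 * r) by field.
  rewrite ler_pdivlMr ?ler_pdivrMr ?mulr_gt0//; lra.
pose c := 2 * (`|C| * (8 / r)).
have c0 : 0 <= c by do 2 apply: mulr_ge0 => //; apply: divr_ge0 => //; exact: ltW.
pose m (x : 'rV[R]_2) :=
  c * (tau (p ord0 ord0) (x ord0 ord0) * tau (p ord0 ord_max) (x ord0 ord_max)).
exists [set x | sqdist p x < r ^+ 2]; split.
- apply: open_comp (_ : open [set s : R | s < r ^+ 2]); last exact: open_lt.
  by move=> x _; have [c1 _ _] := C1_sqdist p; exact: c1.
- rewrite /= /sqdist big1 ?exprn_gt0// => i _; by rewrite subrr expr0n.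
exists (fun x => 1 - ball_bump p r x), (fun i x => - dball_bump p r i x), m; split; first split.
- exact/C1_onem/C1_ball_bump.
- by move=> x; have := ball_bump_itv p r x; lra.
- move=> x; apply: contZ; apply: contM.
    by apply: (@cont_comp _ _ _ (fun x : 'rV[R]_2 => x ord0 ord0)); [exact: cont_coord|exact: ctau].
  by apply: (@cont_comp _ _ _ (fun x : 'rV[R]_2 => x ord0 ord_max)); [exact: cont_coord|exact: ctau].
- by move=> x; apply: mulr_ge0 => //; apply: mulr_ge0.
- move=> k x Dx.
  have [xr|xr] := leP (2 * r ^+ 2) (sqdist p x).
    rewrite big1 ?normr0; first by apply: mulr_ge0 => //; apply: mulr_ge0.
    by move=> i _; rewrite dball_bump_out// oppr0 mulr0.
  have coord i : `|x ord0 i - p ord0 i| <= 2 * r.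
    have hi := le_lt_trans (sqdist_coord p x i) xr.
    by rewrite ler_norml; apply/andP; split; nra.
  apply: (@le_trans _ _ c).
    apply: (le_trans (ler_norm_sum _ _ _)).
    apply: (@le_trans _ _ (\sum_(i < 2) `|C| * (8 / r))).
      apply: ler_sum => i _; rewrite mulrN normrN normrM; apply: ler_pM => //; last exact: dball_bump_le.
      by apply: (le_trans (WC k i x Dx)); exact: ler_norm.
    by rewrite sumr_const card_ord /c [in leRHS]mulr_natl.
  rewrite -[X in X <= _]mulr1; apply: ler_wpM2l => //.
  rewrite -[X in X <= _]mulr1; apply: ler_pM => //; exact: tau1.
- have -> : bint M m = c * (int1 (- M) M (tau (p ord0 ord0)) * int1 (- M) M (tau (p ord0 ord_max))).
    set I0 := int1 _ _ _; set I1 := int1 _ _ _.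
    transitivity (int1 (- M) M (fun s => (c * I0) * tau (p ord0 ord_max) s)).
      rewrite /=; apply: eq_int1 => s _.
      transitivity (int1 (- M) M (fun s' => (c * tau (p ord0 ord_max) s) * tau (p ord0 ord0) s')).
        apply: eq_int1 => s' _; rewrite /m rcons_rv_max.
        have -> : (ord0 : 'I_2) = lift ord_max (ord_max : 'I_1) by apply: val_inj.
        by rewrite rcons_rv_lift rcons_rv_max; ring.
      by rewrite int1Z; [rewrite -/I0; ring|exact: ctau].
    by rewrite int1Z; [rewrite -/I1; ring|exact: ctau].
  have /andP[i0 i1] := int1_bump_le (p ord0 ord0) M0 r0.
  have /andP[j0 j1] := int1_bump_le (p ord0 ord_max) M0 r0.
  apply: (@le_trans _ _ (c * ((8 * r) * (8 * r)))).
    by apply: ler_wpM2l => //; apply: ler_pM.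
  have -> : c * (8 * r * (8 * r)) = K * `|C| * r by rewrite /c KE; field.
  move: rdel; rewrite ler_pdivlMr ?mulr_gt0// => rdel.
  apply: le_trans rdel; rewrite [leRHS]mulrC; apply: ler_wpM2r; first exact: ltW.
  by rewrite ler_pM2l//; lra.
- move=> x rx; rewrite ball_bump_out ?subr0//.
  have h3 : 3 * r < `|x - p| by apply: lt_le_trans rx; lra.
  have r3 : 0 <= 3 * r by apply: mulr_ge0 => //; exact: ltW.
  apply: le_trans (sqdist_far r3 h3); have := sqr_ge0 r; rewrite exprMn; lra.
- move=> x /= xr.
  have n2 : \forall y \near x, sqdist p y < r ^+ 2.
    by have [c1 _ _] := C1_sqdist p; exact: (cvgr_lt _ (c1 x)).
  by apply: (near_imp n2) => y yr; rewrite ball_bump_in ?subrr// ltW.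
Qed.

(** A cutoff of cost at most del exists that vanishes near the points of U
    outside D, and leaves N untouched. *)
Definition cuttable (R : realType) (n : nat) (I : Type) (D : set 'rV[R]_n)
    (W : I -> 'I_n -> 'rV[R]_n -> R) (M del : R) (N U : set 'rV[R]_n) : Prop :=
  exists chi dchi m,
    [/\ cutoff D W chi dchi m, bint M m <= del,
      forall x, N x -> chi x = 1
    & forall x, U x -> ~ D x -> \forall y \near x, chi y = 0].

(** The majorants add because both factors are at most 1. *)
Lemma cutoffM (R : realType) (n : nat) (I : Type) (D : set 'rV[R]_n)
    (W : I -> 'I_n -> 'rV[R]_n -> R) (c1 c2 : 'rV[R]_n -> R) dc1 dc2
    (m1 m2 : 'rV[R]_n -> R) :
  cutoff D W c1 dc1 m1 -> cutoff D W c2 dc2 m2 ->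
  cutoff D W (fun x => c1 x * c2 x) (fun i x => c1 x * dc2 i x + dc1 i x * c2 x)
    (fun x => m1 x + m2 x).
Proof.
move=> [h1 i1 cm1 p1 w1] [h2 i2 cm2 p2 w2]; split.
- exact: C1M.
- move=> x; have /andP[a0 a1] := i1 x; have /andP[b0 b1] := i2 x.
  by rewrite mulr_ge0 ?mulr_ile1.
- by move=> x; apply: contD; [exact: cm1|exact: cm2].
- by move=> x; apply: addr_ge0.
move=> k x Dx; have /andP[a0 a1] := i1 x; have /andP[b0 b1] := i2 x.
have -> : \sum_i W k i x * (c1 x * dc2 i x + dc1 i x * c2 x) =
   c2 x * (\sum_i W k i x * dc1 i x) + c1 x * (\sum_i W k i x * dc2 i x).
  by rewrite !mulr_sumr -big_split /=; apply: eq_bigr => i _; ring.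
apply: (le_trans (ler_normD _ _)); apply: lerD; rewrite normrM ger0_norm//.
  by rewrite -[leRHS]mul1r; apply: ler_pM => //; exact: w1.
by rewrite -[leRHS]mul1r; apply: ler_pM => //; exact: w2.
Qed.

Lemma cuttableU (R : realType) (n : nat) (I : Type) (D : set 'rV[R]_n)
    (W : I -> 'I_n -> 'rV[R]_n -> R) (M del1 del2 : R) (N U V : set 'rV[R]_n) :
  0 < M -> cuttable D W M del1 N U -> cuttable D W M del2 N V ->
  cuttable D W M (del1 + del2) N (U `|` V).
Proof.
move=> M0 [c1 [dc1 [m1 [h1 b1 n1 z1]]]] [c2 [dc2 [m2 [h2 b2 n2 z2]]]].
exists (fun x => c1 x * c2 x), (fun i x => c1 x * dc2 i x + dc1 i x * c2 x),
  (fun x => m1 x + m2 x); split.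
- exact: cutoffM.
- have [_ _ cm1 _ _] := h1; have [_ _ cm2 _ _] := h2.
  by rewrite bintD//; apply: lerD.
- by move=> x Nx; rewrite n1// n2// mulr1.
- move=> x [Ux|Vx] nDx.
    by apply: (near_imp (z1 x Ux nDx)) => y ->; rewrite mul0r.
  by apply: (near_imp (z2 x Vx nDx)) => y ->; rewrite mulr0.
Qed.

Lemma cuttable0 (R : realType) (n : nat) (I : Type) (D : set 'rV[R]_n)
    (W : I -> 'I_n -> 'rV[R]_n -> R) (M del : R) (N : set 'rV[R]_n) :
  0 < M -> 0 <= del -> cuttable D W M del N set0.
Proof.
move=> M0 del0; exists (fun=> 1), (fun _ _ => 0), (fun=> 0); split => //.
- split.
  + split.
    * by move=> x; exact: cont_cst.
    * by move=> i x; exact: cont_cst.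
    * by move=> i x; exact: der_cst.
  + by move=> x; rewrite ler01 lexx.
  + by move=> x; exact: cont_cst.
  + by [].
  + by move=> k x _; rewrite big1 ?normr0// => i _; rewrite mulr0.
- by rewrite bint_cst ?mulr0.
Qed.

Lemma cuttable_sub (R : realType) (n : nat) (I : Type) (D : set 'rV[R]_n)
    (W : I -> 'I_n -> 'rV[R]_n -> R) (M del1 del2 : R) (N N' U U' : set 'rV[R]_n) :
  del1 <= del2 -> N' `<=` N -> U' `<=` U ->
  cuttable D W M del1 N U -> cuttable D W M del2 N' U'.
Proof.
move=> d12 NN UU [c1 [dc1 [m1 [h1 b1 n1 z1]]]]; exists c1, dc1, m1; split => //.
- exact: le_trans d12.
- by move=> x /NN /n1.
- by move=> x /UU; exact: z1.
Qed.

Lemma cuttable_seq (R : realType) (n : nat) (I : Type) (J : eqType) (D : set 'rV[R]_n)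
    (W : I -> 'I_n -> 'rV[R]_n -> R) (M : R) (N : set 'rV[R]_n)
    (V : J -> set 'rV[R]_n) (s : seq J) : 0 < M ->
  (forall j, j \in s -> forall del, 0 < del -> cuttable D W M del N (V j)) ->
  forall del, 0 < del ->
    cuttable D W M del N [set x | exists2 j, j \in s & V j x].
Proof.
move=> M0; elim: s => [|j s IH] hs del del0.
  apply: (cuttable_sub (lexx _) (@subset_refl _ _) _ (cuttable0 D W N M0 (ltW del0))).
  by move=> x [j].
have d2 : 0 < del / 2 by rewrite divr_gt0.
have h1 := hs j (mem_head _ _) _ d2.
have hs' i : i \in s -> forall del, 0 < del -> cuttable D W M del N (V i).
  by move=> si; apply: hs; rewrite inE si orbT.
have h2 := IH hs' _ d2.
apply: (cuttable_sub _ (@subset_refl _ _) _ (cuttableU M0 h1 h2)); first lra.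
move=> x [i]; rewrite inE => /orP[/eqP -> |si] Vx; [by left|right].
by exists i.
Qed.

Lemma boundary_open (T : topologicalType) (D : set T) (x : T) : open D ->
  ~ D x -> closure D x -> boundary D x.
Proof. by move=> oD nDx clx; split => // ix; apply: nDx; exact: interior_subset ix. Qed.

(** What remains of the boundary after the corners are cut off is compact and
    made of regular points, so that finitely many local cutoffs suffice; their
    costs add. *)
Lemma planar_cutoff (R : realType) (I : Type) (D : set 'rV[R]_2)
    (W : I -> 'I_2 -> 'rV[R]_2 -> R) (M C rho del : R) (y0 : 'rV[R]_2) :
  bounded_regular_domain D -> 0 < rho -> 0 < del ->
  (forall x, closure D x -> `|x| + 1 <= M) ->
  (forall x, `|x - y0| < 2 * rho -> D x) ->
  (forall k i x, D x -> `|W k i x| <= C) ->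
  (forall y psi, boundary D y -> C1_defining D y psi -> forall w, 0 < w ->
     \forall x \near y, D x -> forall k,
       `|\sum_i W k i x * 'D_(delta_mx ord0 i) psi x| <= w) ->
  exists chi dchi m, [/\ cutoff D W chi dchi m, bint M m <= del,
      forall x, `|x - y0| < rho -> chi x = 1
    & forall x, ~ D x -> \forall y \near x, chi y = 0].
Proof.
move=> [oD cnD D0 bD [E [fE regE]]] rho0 del0 DM y0D WC Wpsi.
have M0 : 0 < M.
  have [z Dz] := D0; apply: lt_le_trans (DM z (subset_closure Dz)).
  by rewrite ltr_wpDl.
pose N := [set x : 'rV[R]_2 | `|x - y0| < rho].
have Nfar p x : ~ D p -> N x -> rho <= `|x - p|.
  move=> nDp /= xy; rewrite leNgt; apply/negP => xp; apply: nDp; apply: y0D.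
  rewrite (_ : p - y0 = (p - x) + (x - y0)); last by rewrite addrA subrK.
  apply: (le_lt_trans (ler_normD _ _)).
  by rewrite (distrC p x); move: xy xp; rewrite /N /=; lra.
have [sE sEE] := (finite_seqP E).1 fE.
have d2 : 0 < del / 2 by rewrite divr_gt0.
(* V contains the corners; they share the cost del / 2. *)
have [V [oV EV cV]] : exists V, [/\ open V, (forall p, E p -> ~ D p -> V p)
    & cuttable D W M (del / 2) N V].
  rewrite sEE; elim: sE (del / 2) d2 {sEE} => [|p s IH] e e0.
    exists set0; split; [exact: open0|by []|].
    exact: cuttable0 (ltW e0).
  have e2 : 0 < e / 2 by rewrite divr_gt0.
  have [V [oV sV cV]] := IH _ e2.
  have [Dp|nDp] := pselect (D p).
    exists V; split => //.
      by move=> q; rewrite /= inE => /orP[/eqP -> //|]; exact: sV.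
    by apply: (cuttable_sub _ (@subset_refl _ _) (@subset_refl _ _) cV); lra.
  have [U [oU Up [chi [dchi [m [h1 h2 h3 h4]]]]]] := point_cutoff p rho0 M0 e2 WC.
  exists (U `|` V); split; first exact: openU.
    move=> q; rewrite /= inE => /orP[/eqP -> //|sq nq]; first by left.
    by right; exact: sV.
  have -> : e = e / 2 + e / 2 by lra.
  apply: cuttableU cV => //.
  exists chi, dchi, m; split => //.
  - by move=> x Nx; apply: h3; exact: Nfar.
  - by move=> x Ux _; exact: h4.
pose K := boundary D `\` V.
have regU p : exists U, K p -> [/\ open U, U p &
    forall e, 0 < e -> cuttable D W M e N U].
  have [Kp|nKp] := pselect (K p); last by exists setT.
  have [[clp nip] nVp] := Kp.
  have nDp : ~ D p by move=> Dp; apply: nip; exact: (open_nbhs_nbhs (conj oD Dp)).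
  have nEp : ~ E p by move=> Ep; apply: nVp; exact: EV.
  have [psi Cpsi] := regE p (conj clp nip) nEp.
  have [U [oU Up hU]] := regular_cutoff oD rho0 (DM p clp) Cpsi WC Wpsi.
  exists U => _; split => // e e0.
  have [chi [dchi [m [h1 h2 h3 h4]]]] := hU e e0.
  exists chi, dchi, m; split => //.
  by move=> x Nx; apply: h3; exact: Nfar.
have [f hf] := choice regU.
have cK : compact K.
  apply: bounded_closed_compact.
  - exists M; split; first exact: num_real.
    by move=> M' MM' x [[clx _] _] /=; have := DM x clx; lra.
  - apply: closedI; last exact: open_closedC.
    apply: closedI; first exact: closed_closure.
    apply: open_closedC; exact: open_interior.
have [s sK cov] : exists2 s : seq 'rV[R]_2, (forall p, p \in s -> K p) &
    K `<=` [set x | exists2 j, j \in s & f j x].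
  move: cK; rewrite compact_cover => /(_ _ K f)[||D' D'K covD'].
  - by move=> p Kp; have [] := hf p Kp.
  - by move=> p Kp; exists p => //; have [] := hf p Kp.
  exists (finmap.enum_fset D').
    by move=> p pD'; have := D'K p pD'; rewrite inE.
  by move=> x Kx; have [j jD' fx] := covD' x Kx; exists j.
have cs : cuttable D W M (del / 2) N [set x | exists2 j, j \in s & f j x].
  apply: cuttable_seq => // j js; have [_ _ h] := hf j (sK j js); exact: h.
have [chi [dchi [m [h1 h2 h3 h4]]]] := cuttableU M0 cV cs.
have bd0 x : boundary D x -> \forall y \near x, chi y = 0.
  move=> bx; apply: h4.
    have [Vx|nVx] := pselect (V x); first by left.
    by right; apply: cov.
  by move=> Dx; case: bx => _ nix; apply: nix; exact: (open_nbhs_nbhs (conj oD Dx)).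
have [C1chi chi01 cm m0 mW] := h1.
(* chi vanishes near the boundary, so that cutting it to D keeps it C^1. *)
pose chi' x := if x \in D then chi x else 0.
pose dchi' i x := if x \in D then dchi i x else 0.
have nearD x : D x -> \forall y \near x, D y.
  by move=> Dx; exact: (open_nbhs_nbhs (conj oD Dx)).
have z' x : ~ D x -> \forall y \near x, chi' y = 0 /\ forall i, dchi' i y = 0.
  move=> nDx; have [clx|nclx] := pselect (closure D x).
    have bx := bd0 x (boundary_open oD nDx clx).
    have bdx : \forall y \near x, forall i, dchi i y = 0.
      by apply: near_forall_ord => i; exact: C1_near0 bx.
    apply: (near_imp (near_and bx bdx)) => y [y1 y2].
    by rewrite /chi' /dchi'; case: ifP => // _; split.
  have n1 : \forall y \near x, ~ closure D y.
    exact: (open_nbhs_nbhs (conj (closed_openC (@closed_closure _ D)) nclx)).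
  apply: (near_imp n1) => y ny; rewrite /chi' /dchi' memNset//.
  by move=> Dy; apply: ny; exact: subset_closure.
exists chi', dchi', m; split => //; last 2 first.
- move=> x xy; rewrite /chi' mem_set; first exact: h3.
  by apply: y0D; lra.
- by move=> x nDx; apply: (near_imp (z' x nDx)) => y [].
- split => //.
  + have [cchi cdchi dd] := C1chi; split.
    * move=> x; have [Dx|nDx] := pselect (D x).
        apply: cont_near (cchi x); apply: (near_imp (nearD x Dx)) => y Dy.
        by rewrite /chi' mem_set.
      apply: (@cont_near _ _ x (fun=> 0)); last exact: cont_cst.
      by apply: (near_imp (z' x nDx)) => y [-> _].
    * move=> i x; have [Dx|nDx] := pselect (D x).
        apply: cont_near (cdchi i x); apply: (near_imp (nearD x Dx)) => y Dy.
        by rewrite /dchi' mem_set.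
      apply: (@cont_near _ _ x (fun=> 0)); last exact: cont_cst.
      by apply: (near_imp (z' x nDx)) => y [_ h]; rewrite h.
    * move=> i x; have [Dx|nDx] := pselect (D x).
        rewrite /dchi' mem_set//.
        apply: der_near (dd i x); apply: (near_imp (nearD x Dx)) => y Dy.
        by rewrite /chi' mem_set.
      rewrite (nbhs_singleton (z' x nDx)).2.
      apply: (@der_near _ _ _ _ (fun=> 0)); last exact: der_cst.
      by apply: (near_imp (z' x nDx)) => y [-> _].
  + by move=> x; rewrite /chi'; case: ifP => // _; rewrite lexx ler01.
  + move=> k x Dx; rewrite /dchi' mem_set//; exact: mW.
- by apply: le_trans h2 _; lra.
Qed.

(** * Quadratic forms of symmetric matrices *)

Definition bil (R : realType) (n : nat) (A : 'M[R]_n) (u v : 'I_n -> R) : R :=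
  \sum_i \sum_j A i j * u i * v j.

Lemma bil_sym (R : realType) (n : nat) (A : 'M[R]_n) (u v : 'I_n -> R) :
  A^T = A -> bil A u v = bil A v u.
Proof.
move=> sA; rewrite /bil exchange_big /=; apply: eq_bigr => i _.
apply: eq_bigr => j _; rewrite -{1}sA mxE; ring.
Qed.

Lemma bilD (R : realType) (n : nat) (A : 'M[R]_n) (u v w : 'I_n -> R) (t : R) :
  bil A w (fun i => u i + t * v i) = bil A w u + t * bil A w v.
Proof.
rewrite /bil mulr_sumr -big_split /=; apply: eq_bigr => i _.
rewrite mulr_sumr -big_split /=; apply: eq_bigr => j _; ring.
Qed.

Lemma bilDl (R : realType) (n : nat) (A : 'M[R]_n) (u v w : 'I_n -> R) (t : R) :
  bil A (fun i => u i + t * v i) w = bil A u w + t * bil A v w.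
Proof.
rewrite /bil mulr_sumr -big_split /=; apply: eq_bigr => i _.
rewrite mulr_sumr -big_split /=; apply: eq_bigr => j _; ring.
Qed.

Lemma bil_quad (R : realType) (n : nat) (A : 'M[R]_n) (u v : 'I_n -> R) (t : R) :
  A^T = A -> bil A (fun i => u i + t * v i) (fun i => u i + t * v i) =
    bil A u u + 2 * t * bil A u v + t ^+ 2 * bil A v v.
Proof. by move=> sA; rewrite bilD !bilDl (bil_sym v u sA); ring. Qed.

Lemma bil_cauchy (R : realType) (n : nat) (A : 'M[R]_n) (u v : 'I_n -> R) :
  A^T = A -> (forall w, 0 <= bil A w w) ->
  bil A u v ^+ 2 <= bil A u u * bil A v v.
Proof.
move=> sA A0.
have disc t : 0 <= bil A u u + 2 * t * bil A u v + t ^+ 2 * bil A v v.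
  by rewrite -bil_quad.
have := A0 v; rewrite le_eqVlt => /orP[/eqP v0|v0].
  rewrite -v0 mulr0; have [->|b0] := eqVneq (bil A u v) 0; first by rewrite expr0n.
  have := disc (- (bil A u u + 1) / (2 * bil A u v)); rewrite -v0 mulr0 addr0.
  have -> : bil A u u + 2 * (- (bil A u u + 1) / (2 * bil A u v)) * bil A u v = - 1.
    by field.
  by rewrite oppr_ge0 ler10.
have := disc (- bil A u v / bil A v v).
have -> : bil A u u + 2 * (- bil A u v / bil A v v) * bil A u v +
   (- bil A u v / bil A v v) ^+ 2 * bil A v v =
   (bil A u u * bil A v v - bil A u v ^+ 2) / bil A v v.
  by field; rewrite gt_eqF.
by rewrite pmulr_lge0 ?invr_gt0// subr_ge0.
Qed.

Lemma bil_delta (R : realType) (n : nat) (A : 'M[R]_n) (u : 'I_n -> R) (i : 'I_n) :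
  bil A (fun j => (j == i)%:R) u = \sum_j A i j * u j.
Proof.
rewrite /bil (bigD1 i)//= [X in _ + X]big1 => [|k ki].
  by rewrite addr0; apply: eq_bigr => j _; rewrite eqxx mulr1.
by apply: big1 => j _; rewrite (negPf ki) mulr0 mul0r.
Qed.

Lemma bil_delta2 (R : realType) (n : nat) (A : 'M[R]_n) (i : 'I_n) :
  bil A (fun j => (j == i)%:R) (fun j => (j == i)%:R) = A i i.
Proof.
rewrite bil_delta (bigD1 i)//= big1 => [|k ki]; first by rewrite eqxx mulr1 addr0.
by rewrite (negPf ki) mulr0.
Qed.

Lemma cont_entry (R : realType) (m n : nat) (i : 'I_m) (j : 'I_n) :
  continuous (fun A : 'M[R]_(m, n) => A i j).
Proof. exact: coord_continuous. Qed.

Lemma within_contP (R : realType) (X : topologicalType) (K : set X) (f : X -> R) :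
  {within K, continuous f} <-> forall x, K x -> forall e : R, 0 < e ->
    \forall y \near x, K y -> `|f y - f x| < e.
Proof.
split=> [/subspace_continuousP cf x Kx e e0|h].
  exact: (@cvgr_distC_lt R R X _ _ f (f x) (cf x Kx) e e0).
apply/subspace_continuousP => x Kx; apply/cvgrPdist_lt => e e0.
have := h x Kx e e0; rewrite /within /=; apply: filterS => y Hy Ky.
by rewrite distrC; exact: Hy.
Qed.

Lemma within_entry (R : realType) (X : topologicalType) (m n : nat) (K : set X)
    (k : X -> 'M[R]_(m, n)) i j : {within K, continuous k} ->
  {within K, continuous (fun x => k x i j)}.
Proof.
move=> /subspace_continuousP ck; apply/subspace_continuousP => x Kx.
apply: (@cvg_comp _ _ _ k (fun A : 'M[R]_(m, n) => A i j)).
  exact: (ck x Kx).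
exact: cont_entry.
Qed.

Lemma cvg_sum_ord (R : realType) (T : Type) (F : set_system T) (n : nat)
    (f : 'I_n -> T -> R) (l : 'I_n -> R) : Filter F ->
  (forall i, f i x @[x --> F] --> l i) ->
  (\sum_i f i x) @[x --> F] --> \sum_i l i.
Proof.
move=> FF fl; have -> : (fun x => \sum_i f i x) = \sum_i f i.
  by apply/funext => y; rewrite fct_sumE.
apply: (big_ind2 (fun (g : T -> R) (y : R) => g x @[x --> F] --> y)).
- exact: cvg_cst.
- by move=> g a h b ga hb; exact: cvgD.
- by move=> i _; exact: fl.
Qed.

Lemma within_fst (X Y Z : topologicalType) (K : set X) (S : set Y) (f : X -> Z) :
  {within K, continuous f} -> {within K `*` S, continuous (fun p : X * Y => f p.1)}.
Proof.
move=> /subspace_continuousP cf; apply/subspace_continuousP => -[x y] [/= Kx Sy] A fA.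
have := cf x Kx A fA; rewrite /within /= => h.
exists ([set x' | K x' -> A (f x')], setT); first by split; [exact: h|exact: filterT].
by move=> [x' y'] /= [h' _] [Kx' _]; exact: h'.
Qed.

(** The quadratic form attains its maximum kM over K times the unit sphere at
    some (xm, vm).  There kM%:M - k xm is positive semidefinite and its form
    vanishes at vm, so that vm lies in its kernel by the Cauchy-Schwarz
    inequality. *)
Lemma max_eigenvalue (R : realType) (n : nat) (X : topologicalType) (K : set X)
    (k : X -> 'M[R]_n.+1) :
  compact K -> K !=set0 -> {within K, continuous k} ->
  (forall x, K x -> (k x)^T = k x) ->
  exists kM : R, (exists2 x, K x & eigenvalue (k x) kM) /\
    (forall x v, K x -> bil (k x) v v <= kM * \sum_i v i ^+ 2).
Proof.
move=> cK [x0 Kx0] ck sk.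
pose nrm (v : 'rV[R]_n.+1) := \sum_i v ord0 i ^+ 2.
pose S := [set v : 'rV[R]_n.+1 | nrm v = 1].
have csq : continuous nrm.
  move=> v; apply: (@cont_sum _ _ _ (fun i (v : 'rV[R]_n.+1) => v ord0 i ^+ 2)) => i.
  by apply: contM; exact: cont_coord.
have cS : compact S.
  apply: (subclosed_compact _ (@cube_compact R n.+1 (fun=> -1) (fun=> 1))).
    have -> : S = nrm @^-1` [set t | t <= 1] `&` nrm @^-1` [set t | 1 <= t].
      apply/seteqP; split => v; rewrite /S /=; first by move=> ->.
      by move=> [h1 h2]; apply/eqP; rewrite eq_le h1.
    apply: closedI.
      by apply: preimage_closed; [move=> v _; exact: csq|exact: closed_le].
    by apply: preimage_closed; [move=> v _; exact: csq|exact: closed_ge].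
  move=> v Sv i; have : v ord0 i ^+ 2 <= 1.
    by rewrite -Sv /nrm (bigD1 i)//= lerDl sumr_ge0// => j _; exact: sqr_ge0.
  by move=> h; apply/andP; split; nra.
pose F (p : X * 'rV[R]_n.+1) := bil (k p.1) (p.2 ord0) (p.2 ord0).
have cF : {within K `*` S, continuous F}.
  apply/subspace_continuousP => p Kp.
  have ck1 := within_fst (S := S) ck.
  apply: cvg_sum_ord => i; apply: cvg_sum_ord => j.
  have cv l : (fun p : X * 'rV[R]_n.+1 => p.2 ord0 l) @ within (K `*` S) (nbhs p) --> p.2 ord0 l.
    apply: cvg_within_filter.
    by apply: (@cont_comp _ _ _ snd (fun v : 'rV[R]_n.+1 => v ord0 l)); [exact: cont_snd|exact: cont_coord].
  apply: cvgM; last exact: cv.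
  apply: cvgM; last exact: cv.
  by have /subspace_continuousP := @within_entry _ _ _ _ _ _ i j ck1; apply.
have S0 : S (delta_mx ord0 ord0).
  rewrite /S /nrm /= (bigD1 ord0)//= big1 => [|i i0]; last first.
    by rewrite mxE (negPf i0) andbF expr0n.
  by rewrite mxE eqxx expr1n addr0.
have KS0 : K `*` S !=set0 by exists (x0, delta_mx ord0 ord0).
have [[xm vm] /set_mem [/= Kxm Svm] hmax] :=
  compact_EVT_max KS0 (compact_setX cK cS) cF.
pose kM := bil (k xm) (vm ord0) (vm ord0).
have bound x v : K x -> bil (k x) v v <= kM * \sum_i v i ^+ 2.
  move=> Kx; set N := \sum_i v i ^+ 2.
  have N0 : 0 <= N by apply: sumr_ge0 => i _; exact: sqr_ge0.
  move: N0; rewrite le_eqVlt => /orP[/eqP N0|N0].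
    have v0 i : v i = 0.
      apply/eqP; rewrite -sqrf_eq0 eq_le sqr_ge0 andbT.
      by rewrite [leRHS]N0 /N (bigD1 i)//= lerDl sumr_ge0// => j _; exact: sqr_ge0.
    rewrite -N0 mulr0 /bil big1// => i _; apply: big1 => j _.
    by rewrite v0 mulr0 mul0r.
  have [sq sN s0] : exists2 sq : R, sq ^+ 2 = N & sq != 0.
    by exists (Num.sqrt N); [rewrite sqr_sqrtr// ltW|rewrite gt_eqF// sqrtr_gt0].
  pose w : 'rV[R]_n.+1 := \row_i (v i / sq).
  have Sw : S w.
    rewrite /S /nrm /=; under eq_bigr => i _ do rewrite mxE expr_div_n sN.
    by rewrite -mulr_suml -/N divff// gt_eqF.
  have := hmax (x, w); rewrite mem_set//= => /(_ isT); rewrite /F /= -/kM => h.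
  have -> : bil (k x) v v = bil (k x) (w ord0) (w ord0) * N.
    rewrite /bil mulr_suml; apply: eq_bigr => i _; rewrite mulr_suml.
    by apply: eq_bigr => j _; rewrite !mxE -sN; field.
  by rewrite ler_wpM2r// ltW.
exists kM; split => //; exists xm => //.
apply/eigenvalueP; exists vm; last first.
  apply/eqP => v0; move: Svm; rewrite /S /nrm /= v0 big1.
    by move/eqP; rewrite eq_sym oner_eq0.
  by move=> i _; rewrite mxE expr0n.
pose A := kM%:M - k xm.
have sA : A^T = A by rewrite /A linearB /= tr_scalar_mx sk.
have AE u v : bil A u v = kM * \sum_i u i * v i - bil (k xm) u v.
  rewrite /bil mulr_sumr -sumrB; apply: eq_bigr => i _.
  transitivity (\sum_j (kM * ((i == j)%:R * (u i * v j)) - k xm i j * u i * v j)).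
    by apply: eq_bigr => j _; rewrite !mxE -mulr_natr; ring.
  rewrite sumrB; congr (_ - _); rewrite (bigD1 i)//= big1 => [|j ji].
    by rewrite eqxx mul1r addr0.
  by rewrite eq_sym (negPf ji) mul0r mulr0.
have A0 u : 0 <= bil A u u.
  by rewrite AE subr_ge0; have := bound xm u Kxm; under [X in _ -> _ <= _ * X]eq_bigr do rewrite -expr2.
have vA0 : bil A (vm ord0) (vm ord0) = 0.
  by rewrite AE -/kM (_ : \sum_i _ = 1) ?mulr1 ?subrr.
apply/rowP => j.
have : bil A (fun i => (i == j)%:R) (vm ord0) ^+ 2 <= 0.
  by apply: le_trans (bil_cauchy _ _ sA A0) _; rewrite vA0 mulr0.
rewrite le_eqVlt ltNge sqr_ge0 orbF sqrf_eq0 bil_delta => /eqP.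
rewrite !mxE => h.
have -> : \sum_j0 vm ord0 j0 * k xm j0 j = \sum_j0 k xm j j0 * vm ord0 j0.
  by apply: eq_bigr => i _; rewrite -{1}(sk xm Kxm) mxE mulrC.
have E : \sum_i A j i * vm ord0 i = kM * vm ord0 j - \sum_i k xm j i * vm ord0 i.
  under eq_bigr => i _ do rewrite !mxE mulrBl.
  rewrite sumrB; congr (_ - _); rewrite (bigD1 j)//= big1 => [|i ij].
    by rewrite eqxx addr0.
  by rewrite eq_sym (negPf ij) mulr0n mul0r.
by apply/esym/eqP; rewrite -subr_eq0 -E h.
Qed.

Lemma posdef_unit (R : realType) (n : nat) (M : 'M[R]_n) :
  (forall v : 'rV[R]_n, v != 0 -> 0 < bil M (v ord0) (v ord0)) -> M \in unitmx.
Proof.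
move=> pM; rewrite -row_free_unit -kermx_eq0; apply/negPn/negP => k0.
pose v := nz_row (kermx M); have v0 : v != 0 by rewrite nz_row_eq0.
have vM : v *m M = 0 by apply/sub_kermxP/nz_row_sub.
have := pM v v0; rewrite /bil exchange_big /= big1 ?ltxx// => j _.
have := congr1 (fun A : 'rV[R]_n => A ord0 j) vM; rewrite !mxE => h.
rewrite -mulr_suml; under eq_bigr => i _ do rewrite mulrC.
by rewrite h mul0r.
Qed.

(** The form of the inverse at u is the form of M at w = M^-1 u.  As u_i is the
    i-th entry of M w, the last bound is the Cauchy-Schwarz inequality for M, with
    M_ii <= kM. *)
Lemma inv_posdef (R : realType) (n : nat) (M : 'M[R]_n) (kM : R) :
  M^T = M -> (forall v : 'rV[R]_n, v != 0 -> 0 < bil M (v ord0) (v ord0)) ->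
  (forall v, bil M v v <= kM * \sum_i v i ^+ 2) ->
  [/\ (invmx M)^T = invmx M,
    forall v i, \sum_j invmx M i j * (\sum_l M j l * v l) = v i,
    forall u, 0 <= bil (invmx M) u u,
    forall u, bil (invmx M) u u = 0 -> forall i, u i = 0
  & forall u i, u i ^+ 2 <= kM * bil (invmx M) u u].
Proof.
move=> sM pM bM; have uM := posdef_unit pM.
have sI : (invmx M)^T = invmx M by rewrite trmx_inv sM.
have inv1 (v : 'I_n -> R) i : \sum_j invmx M i j * (\sum_l M j l * v l) = v i.
  have := congr1 (fun A : 'cV[R]_n => A i ord0) (mulKmx uM (\col_l v l)).
  rewrite !mxE => <-; apply: eq_bigr => j _; rewrite !mxE; congr (_ * _).
  by apply: eq_bigr => l _; rewrite mxE.
have inv2 (u : 'I_n -> R) i : \sum_l M i l * (\sum_j invmx M l j * u j) = u i.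
  have := congr1 (fun A : 'cV[R]_n => A i ord0) (mulKVmx uM (\col_l u l)).
  rewrite !mxE => <-; apply: eq_bigr => j _; rewrite !mxE; congr (_ * _).
  by apply: eq_bigr => l _; rewrite mxE.
pose w u i := \sum_j invmx M i j * u j.
have bE u : bil (invmx M) u u = bil M (w u) (w u).
  transitivity (\sum_i u i * w u i).
    rewrite /bil; apply: eq_bigr => i _; rewrite mulr_sumr.
    by apply: eq_bigr => j _; ring.
  rewrite /bil; apply: eq_bigr => i _.
  transitivity (w u i * \sum_j M i j * w u j); first by rewrite inv2 mulrC.
  by rewrite mulr_sumr; apply: eq_bigr => j _; ring.
have M0 v : 0 <= bil M v v.
  have [v0|v0] := eqVneq (\row_i v i) 0.
    rewrite /bil big1// => i _; apply: big1 => j _.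
    have := congr1 (fun A : 'rV[R]_n => A ord0 i) v0; rewrite !mxE => ->.
    by rewrite mulr0 mul0r.
  have := pM _ v0; rewrite /bil => /ltW.
  congr (_ <= _); apply: eq_bigr => i _; apply: eq_bigr => j _; by rewrite !mxE.
split => //.
- by move=> u; rewrite bE.
- move=> u; rewrite bE => h i.
  have [v0|v0] := eqVneq (\row_i w u i) 0.
    have wi j : w u j = 0.
      by have := congr1 (fun A : 'rV[R]_n => A ord0 j) v0; rewrite !mxE.
    by rewrite -(inv2 u i) big1// => l _; rewrite -/(w u l) wi mulr0.
  have := pM _ v0; have -> : bil M ((\row_i w u i) ord0) ((\row_i w u i) ord0) = bil M (w u) (w u).
    by rewrite /bil; apply: eq_bigr => j _; apply: eq_bigr => l _; rewrite !mxE.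
  by rewrite h ltxx.
- move=> u i; rewrite bE -{1}(inv2 u i) -/(w u _).
  have -> : \sum_l M i l * (\sum_j invmx M l j * u j) =
    bil M (fun j => (j == i)%:R) (w u) by rewrite bil_delta.
  apply: (le_trans (bil_cauchy _ _ sM M0)); rewrite ler_wpM2r// bil_delta2.
  have := bM (fun j => (j == i)%:R); rewrite bil_delta2.
  rewrite (bigD1 i)//= big1 => [|j ji]; last by rewrite (negPf ji) expr0n.
  by rewrite eqxx expr1n addr0 mulr1.
Qed.

Lemma cont_det (X : topologicalType) (R : realType) (n : nat)
    (A : X -> 'M[R]_n) (x : X) : (forall i j, continuous_at x (fun y => A y i j)) ->
  continuous_at x (fun y => \det (A y)).
Proof.
elim: n A => [|n IH] A cA.
  apply: (@cont_near X R x (fun=> 1)); last exact: cont_cst.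
  by apply: nearW => y; rewrite det_mx00.
apply: (@cont_near _ _ x (fun y => \sum_j A y ord0 j * cofactor (A y) ord0 j)).
  by apply: nearW => y; rewrite (expand_det_row _ ord0).
apply: cont_sum => j; apply: contM; first exact: cA.
rewrite /cofactor; apply: contZ; apply: IH => i l.
apply: (@cont_near _ _ x (fun y => A y (lift ord0 i) (lift j l))); last exact: cA.
by apply: nearW => y; rewrite !mxE.
Qed.

Lemma cont_invmx (X : topologicalType) (R : realType) (n : nat)
    (A : X -> 'M[R]_n) (x : X) (i j : 'I_n) :
  (forall i j, continuous_at x (fun y => A y i j)) ->
  (\forall y \near x, A y \in unitmx) ->
  continuous_at x (fun y => invmx (A y) i j).
Proof.
move=> cA uA.
apply: (@cont_near _ _ x (fun y => (\det (A y))^-1 * cofactor (A y) j i)).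
  by apply: (near_imp uA) => y uy; rewrite /invmx uy !mxE.
apply: contM.
  apply: cvgV; last exact: cont_det.
  by have := nbhs_singleton uA; rewrite unitmxE unitfE.
case: n i j A cA uA => [[]//|n] i j A cA uA.
rewrite /cofactor; apply: contZ; apply: cont_det => k l.
apply: (@cont_near _ _ x (fun y => A y (lift j k) (lift i l))); last exact: cA.
by apply: nearW => y; rewrite !mxE.
Qed.

(** * Integration in time *)

(** The integral of f over [0, t], rescaled to [0, 1] so that t enters as a
    parameter of the integrand. *)
Definition prim (R : realType) (f : R -> R) (t : R) : R :=
  t * int1 0 1 (fun s => f (t * s)).

Lemma prim0 (R : realType) (f : R -> R) : prim f 0 = 0.
Proof. by rewrite /prim mul0r. Qed.

Lemma cont_scale (R : realType) (t : R) : continuous (fun s : R => t * s).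
Proof. by move=> s; apply: contZ; exact: cont_id. Qed.

Lemma cont_dilate (R : realType) (f : R -> R) (t : R) :
  continuous f -> continuous (fun s => f (t * s)).
Proof. by move=> cf s; apply: cont_comp; [exact: cont_scale|exact: cf]. Qed.

Lemma der_prim (R : realType) (f : R -> R) (t : R) : continuous f ->
  der t 1 (prim f) (f t).
Proof.
move=> cf; have [F dF] := int1_primitive (- (`|t| + 1)) cf.
have key s : `|s| < `|t| + 1 -> F s - F 0 = prim f s.
  move=> st; rewrite /prim -int1Z; last exact: cont_dilate.
  have dFs (u : R) : 0 <= u <= 1 -> is_derive u 1 (fun u => F (s * u)) (s * f (s * u)).
    move=> u01; rewrite mulrC; apply: (@der_comp R R F (fun u => s * u)).
      apply: dF; have : `|s * u| < `|t| + 1.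
        rewrite normrM (ger0_norm (_ : 0 <= u)); last by case/andP: u01.
        apply: le_lt_trans st; rewrite -[leRHS]mulr1 ler_wpM2l//; lra.
      by rewrite ltr_norml => /andP[].
    rewrite -[X in der _ _ _ X]mulr1; apply: derZ; exact: der_id.
  rewrite (int1_ftc ltr01 _ dFs) ?mulr1 ?mulr0//.
  by move=> u; apply: contZ; exact: cont_dilate.
apply: (@der_near _ _ _ _ (fun s => F s - F 0)).
  have t1 : `|t - 0| < `|t| + 1 by rewrite subr0 ltrDl.
  by apply: (near_imp (near_dist_lt t1)) => s; rewrite subr0; exact: key.
rewrite -[f t]subr0; apply: derB; last exact: der_cst.
apply: dF; have := ler_norm (- t); rewrite normrN; lra.
Qed.

Lemma prim_cont (R : realType) (X : topologicalType) (U : set X)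
    (f : X -> R -> R) (x : X) (t : R) : open U -> U x ->
  (forall x s, U x -> continuous_at (x, s) (fun p => f p.1 p.2)) ->
  continuous_at (x, t) (fun p => prim (f p.1) p.2).
Proof.
move=> oU Ux cf; apply: contM; first exact: cont_snd.
apply: (@int1_cont R (X * R)%type 0 1 [set p | U p.1]
  (fun p s => f p.1 (p.2 * s))) => //.
  by apply: open_comp => // p _; exact: cont_fst.
move=> [y r] s /= Uy.
apply: (@jcont_comp _ _ _ _ f (fun p : (X * R) * R => p.1.1)
   (fun p => p.1.2 * p.2) (y, r, s)).
- exact: cont_fst1.
- by apply: contM; [exact: cont_snd1|exact: cont_snd].
- exact: cf.
Qed.

Lemma prim_der (R : realType) (V : normedModType R) (U : set V) (v : V)
    (f df : V -> R -> R) (x : V) (t : R) : open U -> U x ->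
  (forall x s, U x -> continuous_at (x, s) (fun p => f p.1 p.2)) ->
  (forall x s, U x -> continuous_at (x, s) (fun p => df p.1 p.2)) ->
  (forall x s, U x -> der x v (f^~ s) (df x s)) ->
  der x v (fun x => prim (f x) t) (prim (df x) t).
Proof.
move=> oU Ux cf cdf dd; apply: derZ.
rewrite -[x]add0r -(scale0r v); apply/is_derive_line.
pose l (s : R) := s *: v + x.
have cl : continuous l.
  move=> s; apply: cvgD; last exact: cvg_cst.
  by apply: cvgZr_tmp; exact: cvg_id.
have oJ : open (l @^-1` U) by apply: open_comp => // s _; exact: cl.
have J0 : (l @^-1` U) 0 by rewrite /= /l scale0r add0r.
have jc (g : V -> R -> R) : (forall x s, U x -> continuous_at (x, s) (fun p => g p.1 p.2)) ->
    forall r s, (l @^-1` U) r ->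
      continuous_at (r, s) (fun p : R * R => g (l p.1) (t * p.2)).
  move=> cg r s Ur.
  apply: (@jcont_comp _ _ _ _ g (fun p : R * R => l p.1) (fun p => t * p.2) (r, s)).
  - by apply: cont_comp; [exact: cont_fst|exact: cl].
  - by apply: contZ; exact: cont_snd.
  - exact: cg.
apply: (@int1_derive R 0 1 (l @^-1` U) (fun r s => f (l r) (t * s))
  (fun r s => df (l r) (t * s))) => //.
- move=> r Ur s.
  exact: (@jcont_slice _ _ _ (fun r s => f (l r) (t * s)) r s (jc f cf r s Ur)).
- by move=> r s Ur; exact: jc.
- move=> r s Ur; have h := dd (l r) (t * s) Ur.
  exact: ((is_derive_line (f^~ (t * s)) x v r _).2 h).
Qed.

Lemma prim_le (R : realType) (f : R -> R) (t C : R) : continuous f -> 0 <= t ->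
  (forall s, 0 <= s <= t -> `|f s| <= C) -> `|prim f t| <= t * C.
Proof.
move=> cf t0 fC; rewrite /prim normrM ger0_norm// ler_wpM2l//.
have c0 (c : R) : continuous (fun _ : R => c) by move=> ?; exact: cont_cst.
have := @int1_dist R 0 1 C (fun s => f (t * s)) (fun=> 0) ler01 (cont_dilate (t := t) cf) (c0 0).
rewrite (@int1_cst R 0 1 0)// mulr0 !subr0 mul1r; apply => s s01; rewrite subr0; apply: fC.
have /andP[s0 s1] := s01; rewrite mulr_ge0//=.
by rewrite -[leRHS]mulr1 ler_wpM2l.
Qed.

(** * The equations ahead of the data *)

(** Fields are meaningful only for t >= 0; freezing them at earlier times makes
    them continuous across t = 0, and avoids one-sided derivatives. *)
Definition ext (R : realType) (X : Type) (f : X -> R -> R) : X -> R -> R :=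
  fun x t => f x (Num.max t 0).

Lemma ext_ge0 (R : realType) (X : Type) (f : X -> R -> R) (x : X) (t : R) :
  0 <= t -> ext f x t = f x t.
Proof. by move=> t0; rewrite /ext max_l. Qed.

Lemma ext_le0 (R : realType) (X : Type) (f : X -> R -> R) (x : X) (t : R) :
  t <= 0 -> ext f x t = f x 0.
Proof. by move=> t0; rewrite /ext max_r. Qed.

Lemma ext_near (R : realType) (X : Type) (f : X -> R -> R) (x : X) (t : R) :
  0 < t -> \forall s \near t, f x s = ext f x s.
Proof.
move=> t0; have : \forall s \near t, 0 < s by exact: (cvgr_gt t (@cvg_id _ (nbhs t))).
by apply: filterS => s s0; rewrite ext_ge0// ltW.
Qed.

Lemma cont_pair (X Y Z : topologicalType) (f : X -> Y) (g : X -> Z) (x : X) :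
  continuous_at x f -> continuous_at x g -> continuous_at x (fun y => (f y, g y)).
Proof. by move=> cf cg; exact: (cvg_pair cf cg). Qed.

Lemma near_open (X : topologicalType) (B : set X) (x : X) : open B -> B x ->
  \forall y \near x, B y.
Proof. by move=> oB Bx; exact: (open_nbhs_nbhs (conj oB Bx)). Qed.

Lemma near_fst (X Y : topologicalType) (B : set X) (p : X * Y) : open B -> B p.1 ->
  \forall y \near p, B y.1.
Proof. by move=> oB Bx; exact: (cont_fst (open_nbhs_nbhs (conj oB Bx))). Qed.

Lemma cont_max0 (R : realType) : continuous (fun s : R => Num.max s 0).
Proof.
by move=> s; apply: (@continuous_max _ _ id (fun=> 0)); [exact: cvg_id|exact: cvg_cst].
Qed.

Lemma ext_cont (R : realType) (B : set 'rV[R]_3) (f : 'rV[R]_3 -> R -> R)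
    (x : 'rV[R]_3) (t : R) : open B -> cont_closed B f -> B x ->
  continuous_at (x, t) (fun p => ext f p.1 p.2).
Proof.
move=> oB /within_contP cf Bx; apply/cont_distP => e e0.
have h := cf (x, Num.max t 0) _ e e0.
have Kx : (closure B `*` [set t | 0 <= t]) (x, Num.max t 0).
  by split; [exact: subset_closure|rewrite /= le_max lexx orbT].
have {}h := h Kx.
have cm : continuous_at (x, t) (fun p : 'rV[R]_3 * R => (p.1, Num.max p.2 0)).
  apply: cont_pair; first exact: cont_fst.
  apply: (@cont_comp _ _ _ snd (fun s : R => Num.max s 0)); first exact: cont_snd.
  exact: cont_max0.
have {}h : \forall p \near (x, t), (closure B `*` [set t | 0 <= t]) (p.1, Num.max p.2 0) ->
   `|ext f p.1 p.2 - ext f x t| < e := cm _ h.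
have nB : \forall p \near (x, t), B p.1.
  exact: near_fst.
apply: (near_imp (near_and h nB)) => p [hp Bp]; apply: hp; split.
  exact: subset_closure.
by rewrite /= le_max lexx orbT.
Qed.

Lemma der_dt (R : realType) (f : 'rV[R]_3 -> R -> R) (x : 'rV[R]_3) (t : R) :
  has_dt f x t -> der t 1 (f x) (dt f x t).
Proof. by move=> h; rewrite /dt derive1E; exact: derivableP h. Qed.

Lemma der_ext (R : realType) (f : 'rV[R]_3 -> R -> R) (x : 'rV[R]_3) (t : R) :
  0 < t -> has_dt f x t -> der t 1 (ext f x) (dt f x t).
Proof. by move=> t0 /der_dt; apply: der_near; exact: ext_near. Qed.

Lemma jcont_slice2 (X Y Z : topologicalType) (f : X -> Y -> Z) (x : X) (y : Y) :
  continuous_at (x, y) (fun p => f p.1 p.2) -> continuous_at x (f^~ y).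
Proof.
move=> cf; apply: (@jcont_comp _ _ _ _ f id (fun=> y) x); last exact: cf.
  exact: cont_id.
exact: cont_cst.
Qed.

Lemma near_dist2 (R : realType) (V : normedModType R) (P : V -> R -> Prop)
    (x : V) (t : R) : (\forall p \near (x, t), P p.1 p.2) ->
  exists2 r, 0 < r & forall y s, `|y - x| < r -> `|s - t| < r -> P y s.
Proof.
move=> [[A C] /= [/near_dist[r1 r10 h1] /near_dist[r2 r20 h2]] AC].
exists (Num.min r1 r2); first by rewrite lt_min r10.
move=> y s; rewrite !lt_min => /andP[y1 _] /andP[_ s2].
by apply: (AC (y, s)); split; [exact: h1|exact: h2].
Qed.

Lemma nbhs_right_ex (R : realType) (P : R -> Prop) :
  (\forall s \near 0^'+, P s) -> exists2 s : R, 0 < s & P s.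
Proof.
move=> h; have g0 : \forall e \near (0 : R)^'+, 0 < e by exact: nbhs_right_gt.
by have [s [s0 Ps]] := @filter_ex _ (0 : R)^'+ _ _ (filterI g0 h); exists s.
Qed.

Lemma right_and (R : realType) (P Q : R -> Prop) :
  (\forall s \near 0^'+, P s) -> (\forall s \near 0^'+, Q s) ->
  \forall s \near 0^'+, P s /\ Q s.
Proof. exact: filterI. Qed.

Lemma near_right (R : realType) (P : R -> Prop) :
  (\forall s \near (0 : R), P s) -> \forall s \near 0^'+, P s.
Proof. exact: cvg_at_right_filter (@cvg_id _ (nbhs 0)) P. Qed.

Section solution_facts.
Context (R : realType) (B S1 S2 : set 'rV[R]_3) (tauq tauT : R)
  (a rho : 'rV[R]_3 -> R) (k : 'rV[R]_3 -> 'M[R]_3) (d : data R)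
  (T : 'rV[R]_3 -> R -> R) (q : 'I_3 -> 'rV[R]_3 -> R -> R).
Hypothesis oB : open B.
Hypothesis supp : supported_below B S1 S2 d.
Hypothesis sol : solution B S1 S2 tauq tauT a rho k d T q.

Definition upper (B : set 'rV[R]_3) := [set x | B x /\ 0 < x ord0 ord_max].
Let Om := upper B.

Lemma open_upper : open Om.
Proof.
apply: openI => //; apply: (@open_comp _ _ (fun x : 'rV[R]_3 => x ord0 ord_max) [set t | 0 < t]).
  by move=> x _; exact: cont_coord.
exact: open_gt.
Qed.

Lemma T_at0 x : Om x -> T x 0 = 0.
Proof.
move=> [Bx x0]; have [_ h _ _] := supp.
rewrite (sol_T_init sol) ?(h x _ x0).1//; exact: subset_closure.
Qed.

Lemma q_at0 i x : Om x -> q i x 0 = 0.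
Proof.
move=> [Bx x0]; have [_ h _ _] := supp.
rewrite (sol_q_init sol); first by have := ((h x (subset_closure Bx) x0).2 i).1.
exact: subset_closure.
Qed.

Lemma extT_cont x t : B x -> continuous_at (x, t) (fun p => ext T p.1 p.2).
Proof. by move=> Bx; have [cT _ _] := sol_T_closed sol; exact: (ext_cont oB cT Bx). Qed.

Lemma extq_cont i x t : B x -> continuous_at (x, t) (fun p => ext (q i) p.1 p.2).
Proof. by move=> Bx; have [/(_ i)[cq _ _] _] := sol_q_closed sol; exact: (ext_cont oB cq Bx). Qed.

(** By the mean value theorem the difference quotients of q at t = 0, which tend
    to the prescribed initial rate, are values of dq/dt at times tending to 0. *)
Lemma dtq_ext i : exists Q1 : 'rV[R]_3 -> R -> R,
  [/\ forall x t, B x -> continuous_at (x, t) (fun p => Q1 p.1 p.2),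
      forall x t, B x -> 0 < t -> Q1 x t = dt (q i) x t &
      forall x, Om x -> Q1 x 0 = 0].
Proof.
have [/(_ i)[_ [g [cg gE]] _] _] := sol_q_closed sol.
exists (ext g); split.
- by move=> x t Bx; exact: (ext_cont oB cg Bx).
- by move=> x t Bx t0; rewrite ext_ge0 ?gE// ltW.
move=> x [Bx x0].
have [_ hd _ _] := supp.
have d0 : dq_init d i x = 0 by have := ((hd x (subset_closure Bx) x0).2 i).2.
have := sol_dq_init sol (i := i) (subset_closure Bx); rewrite d0 => lim0.
have cgx : continuous_at 0 (ext g x) by exact: jcont_slice (ext_cont (t := 0) oB cg Bx).
have cq : continuous (ext (q i) x) by move=> s; exact: jcont_slice (extq_cont (i := i) (t := s) Bx).
apply/eqP; rewrite -normr_le0; apply/ler_addgt0Pl => e e0; rewrite addr0.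
have e2 : 0 < e / 2 by rewrite divr_gt0.
have n1 : \forall s \near 0^'+, `|0 - s^-1 * (q i x s - q i x 0)| < e / 2.
  exact: (@cvgr_dist_lt _ _ _ _ _ (fun s : R => s^-1 * (q i x s - q i x 0)) 0 lim0 _ e2).
have /near_dist[r r0 n2] := (cont_distP _ _).1 cgx (e / 2) e2.
have n3 : \forall s \near 0^'+, s < r by exact: nbhs_right_lt.
have [s s0 [h1 h3]] := nbhs_right_ex (right_and n1 n3).
have [||xi xi0s E] := @MVT R (ext (q i) x) (dt (q i) x) 0 s s0.
- move=> t; rewrite in_itv /= => /andP[t0 _]; apply: der_ext => //.
  by have [h _ _ _ _] := sol_q_C12 sol i; have [] := h x t Bx t0.
- exact: continuous_subspaceT.
move: xi0s; rewrite in_itv /= => /andP[xi0 xis].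
rewrite subr0 (ext_ge0 (q i) x (ltW s0)) (ext_ge0 (q i) x (lexx 0)) in E.
have := h1; rewrite E mulrC mulfK ?gt_eqF// sub0r normrN => {}h1.
have := n2 xi; rewrite subr0 gtr0_norm// (ext_ge0 g x (ltW xi0)) gE// => /(_ (lt_trans xis h3)) {}n2.
rewrite -(subrK (dt (q i) x xi) (ext g x 0)).
apply: (le_trans (ler_normD _ _)); rewrite distrC; lra.
Qed.

(** The extension of a space derivative of T vanishes at t = 0 because T does so
    on a neighbourhood of the point: were it equal to G, then T would differ by
    about h * G at the ends of a segment of length h at small times. *)
Lemma dxT_ext : exists P : 'I_3 -> 'rV[R]_3 -> R -> R,
  [/\ forall j x t, B x -> continuous_at (x, t) (fun p => P j p.1 p.2),
      forall j x t, B x -> 0 < t -> P j x t = dx j T x t,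
      forall j x, Om x -> P j x 0 = 0
    & forall j x t, Om x -> der x (delta_mx ord0 j) ((ext T)^~ t) (P j x t)].
Proof.
have [_ _ hx] := sol_T_closed sol.
have /choice[g hg] j : exists g, cont_closed B g /\
    forall x t, B x -> 0 < t -> g x t = dx j T x t by have [] := hx j.
have [hT _ _ _] := sol_T_C11 sol.
have gc j x t : B x -> continuous_at (x, t) (fun p => ext (g j) p.1 p.2).
  by move=> Bx; have [cg _] := hg j; exact: (ext_cont oB cg Bx).
have gE j x t : B x -> 0 < t -> ext (g j) x t = dx j T x t.
  by move=> Bx t0; rewrite ext_ge0 ?ltW//; have [_ h] := hg j; exact: h.
have dpos j x t : B x -> 0 < t -> der x (delta_mx ord0 j) ((ext T)^~ t) (dx j T x t).
  move=> Bx t0; have -> : (ext T)^~ t = T^~ t.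
    by apply/funext => y; rewrite ext_ge0 // ltW.
  have [_ /(_ j)[h _]] := hT x t Bx t0; exact: derivableP h.
have g0 j x : Om x -> ext (g j) x 0 = 0.
  move=> Omx; have [Bx x0] := Omx.
  apply/eqP; rewrite -normr_le0; apply/ler_addgt0Pl => e e0; rewrite addr0.
  have [r r0 hr] := (near_dist _ _).1 (near_open open_upper Omx).
  have e3 : 0 < e / 3 by rewrite divr_gt0.
  have n1 := (cont_distP _ _).1 (gc j x 0 Bx) _ e3.
  have [r' r'0 hr'] := @near_dist2 R _
    (fun y s => `|ext (g j) y s - ext (g j) x 0| < e / 3) x 0 n1.
  pose h := Num.min r r' / 2.
  have m0 : 0 < Num.min r r' by rewrite lt_min r0.
  have h0 : 0 < h by rewrite divr_gt0.
  have [hlr hlr'] : h < r /\ h < r'.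
    have hm : h < Num.min r r' by rewrite /h; lra.
    by move: hm; rewrite lt_min => /andP[].
  pose y := h *: delta_mx ord0 j + x.
  have line s : 0 <= s <= 1 -> `|(s * h) *: (delta_mx ord0 j : 'rV[R]_3) + x - x| <= h.
    move=> s01; rewrite addrK; apply: rv_norm_le => [|i]; first exact: ltW.
    rewrite !mxE eqxx /=; case: (i == j); rewrite ?mulr0 ?normr0 ?mulr1; last exact: ltW.
    have /andP[s0 s1] := s01; have hh := ltW h0.
    by rewrite (ger0_norm (mulr_ge0 s0 hh)); exact: ler_piMl.
  have inOm s : 0 <= s <= 1 -> Om ((s * h) *: (delta_mx ord0 j : 'rV[R]_3) + x).
    by move=> s01; apply: hr; exact: le_lt_trans (line s s01) hlr.
  have Omy : Om y by have := inOm 1; rewrite mul1r; apply; rewrite ler01 lexx.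
  have small t : 0 < t -> t < r' ->
     `|ext T y t - ext T x t - h * ext (g j) x 0| <= h * (e / 3).
    move=> t0 tr'.
    have [|s s01 ->] := @mvt_line R _ ((ext T)^~ t) x (delta_mx ord0 j) h
       (fun s => dx j T ((s * h) *: delta_mx ord0 j + x) t).
      by move=> s s01; apply: dpos => //; exact: (inOm s s01).1.
    rewrite mulrC -mulrBr normrM gtr0_norm// ler_pM2l//.
    rewrite -gE//; last exact: (inOm s s01).1.
    apply/ltW/hr'; first exact: le_lt_trans (line s s01) hlr'.
    by rewrite subr0 gtr0_norm.
  have Ty : continuous_at 0 (ext T y) by exact: jcont_slice (extT_cont (t := 0) Omy.1).
  have Tx : continuous_at 0 (ext T x) by exact: jcont_slice (extT_cont (t := 0) Bx).
  have he0 : 0 < h * (e / 3) by rewrite mulr_gt0.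
  have m1 := near_right ((cont_distP _ _).1 Ty _ he0).
  have m2 := near_right ((cont_distP _ _).1 Tx _ he0).
  have m3 : \forall s \near 0^'+, s < r' by exact: nbhs_right_lt.
  have [t t0 [t1 [t2 t3]]] := nbhs_right_ex (right_and m1 (right_and m2 m3)).
  move: (small t t0 t3) t1 t2; rewrite (ext_le0 T y (lexx 0)) (ext_le0 T x (lexx 0)).
  rewrite (T_at0 Omy) (T_at0 Omx) !subr0.
  set A := ext T y t; set C := ext T x t; set G := ext (g j) x 0 => a1 a2 a3.
  have : `|h * G| <= h * e.
    have -> : h * G = A - C - (A - C - h * G) by ring.
    apply: (le_trans (ler_normB _ _)).
    have := ler_normB A C; have -> : h * e = h * (e / 3) + h * (e / 3) + h * (e / 3) by field.
    by move: a1 a2 a3; lra.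
  by rewrite normrM gtr0_norm// ler_pM2l.
exists (fun j => ext (g j)); split => //.
move=> j x t Omx; have [t0|t0] := ltP 0 t.
    rewrite gE//; last exact: Omx.1.
    by apply: dpos => //; exact: Omx.1.
  have -> : ext (g j) x t = 0 by rewrite (ext_le0 _ _ t0) -[RHS](g0 j x Omx) (ext_le0 _ _ (lexx 0)).
  apply: (@der_near _ _ _ _ (fun=> 0)); last exact: der_cst.
  apply: (near_imp (near_open open_upper Omx)) => y Omy.
  by rewrite ext_le0// T_at0.
Qed.

(** The difference Z of the two sides is constant in time by the constitutive
    law, and it vanishes at t = 0 because q, dq/dt and grad T do. *)
Lemma integrated_law : exists P : 'I_3 -> 'rV[R]_3 -> R -> R,
  [/\ forall j x t, B x -> continuous_at (x, t) (fun p => P j p.1 p.2),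
      forall j x t, Om x -> der x (delta_mx ord0 j) ((ext T)^~ t) (P j x t)
    & forall i x t, Om x -> 0 < t ->
       prim (ext (q i) x) t + tauq * q i x t + 2^-1 * tauq ^+ 2 * dt (q i) x t =
       - (\sum_j k x i j * (prim (P j x) t + tauT * P j x t))].
Proof.
have [P [cP PE P0 dP]] := dxT_ext; exists P; split => // i x t Omx t0.
have [Q1 [cQ1 Q1E Q10]] := dtq_ext i.
have [Bx x0] := Omx.
pose Z s := prim (ext (q i) x) s + tauq * ext (q i) x s + 2^-1 * tauq ^+ 2 * Q1 x s
  + \sum_j k x i j * (prim (P j x) s + tauT * P j x s).
have cq : continuous (ext (q i) x) by move=> s; exact: jcont_slice (extq_cont (i := i) (t := s) Bx).
have cQ : continuous (Q1 x) by move=> s; exact: jcont_slice (cQ1 x s Bx).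
have cPx j : continuous (P j x) by move=> s; exact: jcont_slice (cP j x s Bx).
have cprim (f : R -> R) : continuous f -> continuous (prim f).
  by move=> cf s; exact: is_derive1_cont (der_prim s cf).
have cZ : continuous Z.
  move=> s; apply: contD.
    apply: contD; last by apply: contZ; exact: cQ.
    by apply: contD; [exact: cprim|apply: contZ; exact: cq].
  apply: cont_sum => j; apply: contZ; apply: contD; first exact: cprim.
  by apply: contZ; exact: cPx.
have [hT _ _ _] := sol_T_C11 sol.
have [hq _ _ _ _] := sol_q_C12 sol i.
have dZ (s : R) : 0 < s -> der s 1 Z 0.
  move=> s0; have [_ hTj] := hT x s Bx s0; have [h1 h2 _] := hq x s Bx s0.
  have := sol_constitutive sol i Bx s0 => E.
  have -> : (0 : R) = ext (q i) x s + tauq * dt (q i) x s +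
      2^-1 * tauq ^+ 2 * dt (dt (q i)) x s +
      \sum_j k x i j * (P j x s + tauT * dt (dx j T) x s).
    rewrite ext_ge0 ?ltW// E.
    have -> : \sum_j k x i j * (P j x s + tauT * dt (dx j T) x s) =
        \sum_j k x i j * dx j T x s + tauT * \sum_j k x i j * dt (dx j T) x s.
      by rewrite mulr_sumr -big_split /=; apply: eq_bigr => j _; rewrite PE//; ring.
    by ring.
  apply: derD.
    apply: derD.
      apply: derD; first exact: der_prim.
      exact/derZ/der_ext.
    apply: derZ; apply: (@der_near _ _ _ _ (dt (q i) x)); last exact: der_dt.
    have : \forall r \near s, 0 < r by exact: (cvgr_gt s (@cvg_id _ (nbhs s))).
    by apply: filterS => r r0; rewrite Q1E.
  apply: der_sum => j; apply: derZ; apply: derD; first exact: der_prim.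
  apply: derZ; apply: (@der_near _ _ _ _ (dx j T x)); last first.
    by apply: der_dt; have [_] := hTj j.
  have : \forall r \near s, 0 < r by exact: (cvgr_gt s (@cvg_id _ (nbhs s))).
  by apply: filterS => r r0; rewrite PE.
have [||xi xi0t E] := @MVT R Z (fun=> 0) 0 t t0.
- by move=> s; rewrite in_itv /= => /andP[s0 _]; exact: dZ.
- exact: continuous_subspaceT.
have Z0 : Z 0 = 0.
  rewrite /Z !prim0 ext_ge0// q_at0// Q10// !mulr0 !addr0 add0r.
  by apply: big1 => j _; rewrite prim0 P0// mulr0 addr0 mulr0.
move: E; rewrite Z0 mul0r subr0 /Z => /eqP; rewrite addr_eq0 => /eqP <-.
by rewrite Q1E// ext_ge0 ?ltW.
Qed.

Lemma energy_law x t : Om x -> 0 < t ->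
  a x * dt T x t = - \sum_i dx i (q i) x t.
Proof.
move=> [Bx x0] t0; have [h _ _ _] := supp.
by rewrite -(sol_energy sol Bx t0) h ?ltW// mulr0 addr0.
Qed.

End solution_facts.

(** * Geometry of the cylinder *)

Lemma closure_distP (R : realType) (V : normedModType R) (A : set V) (x : V) :
  closure A x <-> forall e : R, 0 < e -> exists2 y, A y & `|y - x| < e.
Proof.
split=> [clx e e0|h U /near_dist[r r0 hr]].
  have xx : `|x - x| < e by rewrite subrr normr0.
  by have [y [Ay ye]] := clx _ (near_dist_lt xx); exists y.
by have [y Ay yx] := h r r0; exists y; split => //; exact: hr.
Qed.

(** Boundary and interior values are compared at the same time. *)
Lemma unif_cont (R : realType) (K : set 'rV[R]_3) (f : 'rV[R]_3 -> R -> R) (t1 w : R) :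
  compact K -> {within K `*` [set t | 0 <= t], continuous (fun p => f p.1 p.2)} ->
  0 < w -> exists2 rho : R, 0 < rho & forall x x' t, K x -> K x' -> 0 <= t <= t1 ->
    `|x' - x| < rho -> `|f x' t - f x t| < w.
Proof.
move=> cK /within_contP cf w0.
pose P (rho : R) (p : 'rV[R]_3 * R) := (K `*` `[0, t1]) p -> forall x', K x' ->
   `|x' - p.1| < rho -> `|f x' p.2 - f p.1 p.2| < w.
have cKt : compact (K `*` `[0, t1]) by apply: compact_setX => //; exact: segment_compact.
have : \forall rho \near 0^'+, (K `*` `[0, t1]) `<=` P rho.
  move/compact_near_coveringP : cKt; apply => -[x t] [/= Kx]; rewrite in_itv /= => /andP[t0 t1'].
  have w2 : 0 < w / 2 by rewrite divr_gt0.
  have [r r0 hr] := @near_dist2 R _ (fun y s => (K `*` [set t | 0 <= t]) (y, s) ->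
     `|f y s - f x t| < w / 2) x t (cf (x, t) (conj Kx t0) _ w2).
  have r2 : 0 < r / 2 by rewrite divr_gt0.
  have n1 : \forall p \near (x, t), `|p.1 - x| < r / 2 /\ `|p.2 - t| < r.
    exists ([set y | `|y - x| < r / 2], [set s | `|s - t| < r]) => //.
    split; first by apply: (@near_dist_lt R _ x x); rewrite subrr normr0.
    exact: ((@cont_distP R R id t).1 (@cont_id R t) r r0).
  have n2 : \forall rho \near 0^'+, rho < r / 2 by exact: nbhs_right_lt.
  exists ([set p | `|p.1 - x| < r / 2 /\ `|p.2 - t| < r], [set rho | rho < r / 2]) => //.
  move=> [[y s] rho] /= [[yx st] rr] [/= Ky]; rewrite in_itv /= => /andP[s0 s1] x' Kx' x'y.
  have h1 : `|f y s - f x t| < w / 2 by apply: hr => //; lra.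
  have h2 : `|f x' s - f x t| < w / 2.
    apply: hr => //; rewrite -(subrK y x') -addrA.
    by apply: (le_lt_trans (ler_normD _ _)); lra.
  rewrite (_ : f x' s - f y s = (f x' s - f x t) - (f y s - f x t)); last by ring.
  by apply: (le_lt_trans (ler_normB _ _)); lra.
move=> h; have [rho rho0 hrho] := nbhs_right_ex h.
exists rho => // x x' t Kx Kx' t01 x'x.
have Kp : (K `*` `[0, t1]) (x, t) by split => //=; rewrite in_itv.
exact: (hrho (x, t) Kp Kp).
Qed.

Lemma unif_bound (R : realType) (K : set 'rV[R]_3) (f : 'rV[R]_3 -> R -> R) (t1 : R) :
  compact K -> {within K `*` [set t | 0 <= t], continuous (fun p => f p.1 p.2)} ->
  exists C : R, forall x t, K x -> 0 <= t <= t1 -> `|f x t| <= C.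
Proof.
move=> cK cf.
have cKt : compact (K `*` `[0, t1]) by apply: compact_setX => //; exact: segment_compact.
have sub : K `*` `[0, t1] `<=` K `*` [set t : R | 0 <= t].
  by move=> [x t] [/= Kx]; rewrite in_itv /= => /andP[t0 _].
have /compact_bounded[C [_ hC]] := continuous_compact (continuous_subspaceW sub cf) cKt.
exists (C + 1) => x t Kx t01; apply: (hC (C + 1)); first by rewrite ltrDl.
by exists (x, t) => //; split => //=; rewrite in_itv.
Qed.

Definition base (R : realType) (x : 'rV[R]_3) : 'rV[R]_2 := lsubmx (x : 'rV[R]_(2 + 1)).

Lemma baseE (R : realType) (x : 'rV[R]_3) (j : 'I_2) :
  base x ord0 j = x ord0 (lift ord_max j).
Proof.
rewrite mxE; congr (x ord0 _); apply: val_inj => /=.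
by rewrite /fintype.bump leqNgt ltn_ord add0n.
Qed.

Lemma base_rcons (R : realType) (y : 'rV[R]_2) (z : R) : base (rcons_rv y z) = y.
Proof. by apply/rowP => j; rewrite baseE rcons_rv_lift. Qed.

Lemma rcons_base (R : realType) (x : 'rV[R]_3) : rcons_rv (base x) (x ord0 ord_max) = x.
Proof.
apply/rowP => i; have [j ->|->] := unliftP ord_max i.
  by rewrite rcons_rv_lift baseE.
by rewrite rcons_rv_max.
Qed.

Lemma base_cont (R : realType) : continuous (@base R).
Proof.
move=> x A /near_dist[r r0 hr].
apply: (near_dist (fun y => A (base y)) x).2; exists r => // x' x'x.
apply: hr; apply: le_lt_trans x'x; apply: rv_norm_le => // i.
rewrite mxE [X in _ + X]mxE !baseE.
by have := rv_coord_le (x' - x) (lift ord_max i); rewrite mxE [X in _ + X]mxE.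
Qed.

Lemma rcons_dist (R : realType) (y y' : 'rV[R]_2) (z z' e : R) : 0 <= e ->
  `|y - y'| <= e -> `|z - z'| <= e -> `|rcons_rv y z - rcons_rv y' z'| <= e.
Proof.
move=> e0 ye ze; apply: rv_norm_le => // i; rewrite mxE [X in _ + X]mxE.
have [j ->|->] := unliftP ord_max i.
  rewrite !rcons_rv_lift; apply: le_trans ye.
  by have := rv_coord_le (y - y') j; rewrite mxE [X in _ + X]mxE.
by rewrite !rcons_rv_max.
Qed.

Section cylinder_geometry.
Context (R : realType) (D : set 'rV[R]_2) (h L : R).
Hypothesis oD : open D.
Hypothesis hL : - h < L.
Let B := cylinder D h L.

Lemma open_cylinder : open B.
Proof.
have -> : B = (@base R) @^-1` D `&` (fun x : 'rV[R]_3 => x ord0 ord_max) @^-1` `]-h, L[%classic.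
  apply/seteqP; split => x /=.
    by move=> [Dx /andP[x1 x2]]; split => //; rewrite in_itv /= x1.
  by move=> [Dx]; rewrite in_itv.
apply: openI.
  by apply: open_comp => // x _; exact: base_cont.
apply: open_comp; first by move=> x _; exact: cont_coord.
exact: interval_open.
Qed.

Lemma cylinder_rcons y z : B (rcons_rv y z) <-> D y /\ - h < z < L.
Proof. by rewrite /B /cylinder /= -/(base _) base_rcons rcons_rv_max. Qed.

Lemma closure_cylinder_rcons y z : closure D y -> - h <= z <= L ->
  closure B (rcons_rv y z).
Proof.
move=> cy zI; apply/closure_distP => e e0.
have [y' Dy' y'y] := (closure_distP _ _).1 cy e e0.
have [z' z'I z'z] : exists2 z', - h < z' < L & `|z' - z| < e.
  pose t := Num.min (1 / 2) (e / (2 * (L + h))).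
  have Lh : 0 < L + h by move: hL; lra.
  have t0 : 0 < t by rewrite lt_min divr_gt0//= divr_gt0// mulr_gt0.
  have [t12 te] : t <= 1 / 2 /\ t <= e / (2 * (L + h)) by rewrite /t !ge_min !lexx orbT.
  have te' : t * (L + h) <= e / 2.
    by move: te; rewrite ler_pdivlMr ?mulr_gt0//; lra.
  exists (z + t * ((L - h) / 2 - z)); first by apply/andP; split; nra.
  rewrite addrAC subrr add0r ltr_norml; apply/andP; split; nra.
exists (rcons_rv y' z'); first by apply/cylinder_rcons.
apply: (@le_lt_trans _ _ (Num.max `|y' - y| `|z' - z|)); last by rewrite gt_max y'y.
apply: rcons_dist; first by rewrite le_max normr_ge0.
  by rewrite le_max lexx.
by rewrite le_max lexx orbT.
Qed.

Lemma closure_cylinderP x : closure B x ->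
  closure D (base x) /\ - h <= x ord0 ord_max <= L.
Proof.
move=> /closure_distP cx; split.
  apply/closure_distP => e e0; have [x' [Dx' _] x'x] := cx e e0.
  exists (base x') => //; apply: le_lt_trans x'x.
  apply: rv_norm_le => // i; rewrite mxE [X in _ + X]mxE !baseE.
  by have := rv_coord_le (x' - x) (lift ord_max i); rewrite mxE [X in _ + X]mxE.
have key e : 0 < e -> - h - e <= x ord0 ord_max <= L + e.
  move=> e0; have [x' [_ x'I] x'x] := cx e e0.
  have := le_lt_trans (rv_coord_le (x' - x) ord_max) x'x.
  by rewrite mxE [X in _ + X]mxE ltr_norml; lra.
apply/andP; split; apply/ler_addgt0Pl => e /key; lra.
Qed.

Lemma compact_closure_cylinder : bounded_set D -> compact (closure B).
Proof.
move=> [C [_ bD]]; apply: bounded_closed_compact; last exact: closed_closure.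
exists (Num.max (C + 2) (`|h| + `|L|)); split; first exact: num_real.
move=> M hM x clx /=.
move: hM; rewrite gt_max => /andP[CM hM].
have [cD zI] := closure_cylinderP clx.
have M0 : 0 <= M by apply: le_trans (ltW hM); rewrite addr_ge0.
apply: rv_norm_le => // i; have [j ->|->] := unliftP ord_max i.
  rewrite -baseE; apply: le_trans (rv_coord_le _ _) _.
  have [y Dy ye] := (closure_distP _ _).1 cD 1 ltr01.
  have := bD (C + 1) _ y Dy; rewrite ltrDl ltr01 => /(_ isT) /= yC.
  rewrite -(subrK y (base x)); apply: (le_trans (ler_normD _ _)).
  by rewrite distrC; lra.
have := ler_norm h; have := ler_norm (- h); have := ler_norm L.
have := normr_ge0 L; have := normr_ge0 h.
by rewrite normrN ler_norml; lra.
Qed.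

Lemma base_line (j : 'I_2) (x : 'rV[R]_3) (e : R) :
  base (e *: delta_mx ord0 (lift ord_max j) + x) = e *: delta_mx ord0 j + base x.
Proof.
rewrite -{1}(rcons_base x) -rcons_rv_lift_line base_rcons; congr (_ + _).
Qed.

Lemma derive_base (psi : 'rV[R]_2 -> R) (j : 'I_2) :
  'D_(delta_mx ord0 (lift ord_max j)) (fun x => psi (base x)) =
  fun x => 'D_(delta_mx ord0 j) psi (base x).
Proof.
apply/funext => x; rewrite /derive.
by under eq_fun => e do rewrite /= base_line.
Qed.

Lemma derive_base_at (psi : 'rV[R]_2 -> R) (j : 'I_2) (x : 'rV[R]_3) :
  'D_(delta_mx ord0 (lift ord_max j)) (fun x => psi (base x)) x =
  'D_(delta_mx ord0 j) psi (base x).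
Proof. exact: (congr1 (fun f => f x) (derive_base psi j)). Qed.

Lemma derivable_base (psi : 'rV[R]_2 -> R) (j : 'I_2) (x : 'rV[R]_3) :
  derivable psi (base x) (delta_mx ord0 j) ->
  derivable (fun x => psi (base x)) x (delta_mx ord0 (lift ord_max j)).
Proof.
rewrite /derivable.
by under [in X in _ -> X]eq_fun => e do rewrite /= base_line.
Qed.

Lemma der_base (psi : 'rV[R]_2 -> R) (j : 'I_2) (x : 'rV[R]_3) (e : R) :
  der (base x) (delta_mx ord0 j) psi e ->
  der x (delta_mx ord0 (lift ord_max j)) (fun x => psi (base x)) e.
Proof.
move=> [h1 h2]; split; first exact: derivable_base.
by rewrite derive_base_at.
Qed.

Lemma der_base_max (psi : 'rV[R]_2 -> R) (x : 'rV[R]_3) :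
  der x (delta_mx ord0 ord_max) (fun x => psi (base x)) 0.
Proof.
rewrite -(rcons_base x); apply/is_derive_rcons_max.
under eq_fun do rewrite base_rcons.
exact: der_cst.
Qed.

Lemma derive_base_max (psi : 'rV[R]_2 -> R) :
  'D_(delta_mx ord0 ord_max) (fun x => psi (base x)) = fun=> 0.
Proof. by apply/funext => x; exact: der_val (der_base_max psi x). Qed.

(** A defining function of D, composed with the projection, defines the cylinder
    away from its two bases. *)
Lemma lateral_normal y z psi : boundary D y -> C1_defining D y psi -> - h < z < L ->
  boundary B (rcons_rv y z) /\ C1_defining B (rcons_rv y z) (fun x => psi (base x)).
Proof.
move=> [cy ny] [n1 [i0 hi0] n2] zI.
have nDy : ~ D y by move=> Dy; apply: ny; exact: (near_open oD Dy).
split.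
  split; first by apply: closure_cylinder_rcons => //; lra.
  by move=> /interior_subset /cylinder_rcons[].
have nb (P : 'rV[R]_2 -> Prop) : (\forall x \near y, P x) ->
    \forall x \near rcons_rv y z, P (base x).
  move=> hP; have := @base_cont R (rcons_rv y z) P; rewrite base_rcons; exact.
split.
- apply: (near_imp (nb _ n1)) => x hx i.
  have [j ->|->] := unliftP ord_max i.
    have [dj cj] := hx j; split; first exact: derivable_base.
    rewrite (derive_base psi j).
    exact: (@cont_comp _ _ _ (@base R) ('D_(delta_mx ord0 j) psi) x (@base_cont R x) cj).
  split; first by have [] := der_base_max psi x.
  rewrite (derive_base_max psi); exact: cont_cst.
- by exists (lift ord_max i0); rewrite derive_base_at base_rcons.
- have c3 : continuous_at (rcons_rv y z) (fun x : 'rV[R]_3 => x ord0 ord_max).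
    exact: cont_coord.
  have n3 : \forall x \near rcons_rv y z, - h < (x : 'rV[R]_3) ord0 ord_max.
    by apply: (cvgr_gt _ c3); rewrite rcons_rv_max; case/andP: zI.
  have n4 : \forall x \near rcons_rv y z, (x : 'rV[R]_3) ord0 ord_max < L.
    by apply: (cvgr_lt _ c3); rewrite rcons_rv_max; case/andP: zI.
  apply: (near_imp (near_and (nb _ n2) (near_and n3 n4))) => x [hx [x3 x4]].
  by rewrite -hx /B /cylinder /= -/(base x) x3 x4; split=> [[] //|Dx].
Qed.

Lemma top_normal y : D y ->
  boundary B (rcons_rv y L) /\ C1_defining B (rcons_rv y L) (fun x => x ord0 ord_max - L).
Proof.
move=> Dy; split.
  split; first by apply: closure_cylinder_rcons; [exact: subset_closure|rewrite lexx andbT ltW].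
  by move=> /interior_subset /cylinder_rcons[_]; rewrite ltxx andbF.
have dd (x : 'rV[R]_3) i : der x (delta_mx ord0 i) (fun x : 'rV[R]_3 => x ord0 ord_max - L)
    ((delta_mx ord0 i : 'rV[R]_3) ord0 ord_max).
  rewrite -[X in der _ _ _ X]subr0; apply: derB; last exact: der_cst.
  exact: der_coord.
split.
- apply: (near_imp (near_open (@openT _) (I : [set: 'rV[R]_3] (rcons_rv y L)))) => x _ i.
  split; first by have [] := dd x i.
  have -> : 'D_(delta_mx ord0 i) (fun x : 'rV[R]_3 => x ord0 ord_max - L) =
      fun=> (delta_mx ord0 i : 'rV[R]_3) ord0 ord_max.
    by apply/funext => x'; exact: der_val (dd x' i).
  exact: cont_cst.
- exists ord_max; rewrite (der_val (dd _ _)) mxE !eqxx; exact: oner_neq0.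
- have n1 : \forall x \near rcons_rv y L, D (base x).
    by apply: base_cont; rewrite base_rcons; exact: (near_open oD Dy).
  have c3 : continuous_at (rcons_rv y L) (fun x : 'rV[R]_3 => x ord0 ord_max).
    exact: cont_coord.
  have n2 : \forall x \near rcons_rv y L, - h < (x : 'rV[R]_3) ord0 ord_max.
    by apply: (cvgr_gt _ c3); rewrite rcons_rv_max.
  apply: (near_imp (near_and n1 n2)) => x [Dx x3].
  rewrite /B /cylinder /= -/(base x) subr_lt0 x3; split => [[] //|xL]; by split.
Qed.
End cylinder_geometry.

(** * Decay of the flux at the boundary *)

(** The potential phi of the integrated constitutive law. *)
Definition augmented_temp (R : realType) (tauT : R) (T : 'rV[R]_3 -> R -> R) (x : 'rV[R]_3)
  (t : R) : R := prim (ext T x) t + tauT * ext T x t.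

Section boundary_flux.
Context (R : realType) (D : set 'rV[R]_2) (h L : R) (S1 S2 : set 'rV[R]_3)
  (tauq tauT : R) (a rho : 'rV[R]_3 -> R) (k : 'rV[R]_3 -> 'M[R]_3) (d : data R)
  (T : 'rV[R]_3 -> R -> R) (q : 'I_3 -> 'rV[R]_3 -> R -> R) (t1 : R).
Let B := cylinder D h L.
Hypothesis hD : bounded_regular_domain D.
Hypothesis h0 : 0 < h.
Hypothesis L0 : 0 < L.
Hypothesis tauT0 : 0 < tauT.
Hypothesis t10 : 0 < t1.
Hypothesis split : boundary_split B S1 S2.
Hypothesis supp : supported_below B S1 S2 d.
Hypothesis sol : solution B S1 S2 tauq tauT a rho k d T q.

Let oD : open D. Proof. by case: hD. Qed.
Let hL : - h < L. Proof. by move: h0 L0; lra. Qed.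
Let oB : open B. Proof. exact: open_cylinder oD. Qed.
Let cB : compact (closure B).
Proof. by apply: compact_closure_cylinder; case: hD. Qed.
Let Tclosed : cont_closed B T. Proof. by have [] := sol_T_closed sol. Qed.
Let qclosed i : cont_closed B (q i).
Proof. by have [/(_ i)[]] := sol_q_closed sol. Qed.

(** A boundary point lies in the closure of S1, where T is prescribed, or in S2,
    where the normal is a positive multiple of the gradient of psi. *)
Lemma bc_dichotomy p psi : boundary B p -> 0 < p ord0 ord_max ->
  C1_defining B p psi ->
  (forall t, 0 <= t -> T p t = 0) \/
  (forall t, 0 <= t -> \sum_i q i p t * 'D_(delta_mx ord0 i) psi p = 0).
Proof.
move=> bp p3 Cp; have [_ _ sE _] := split.
have [_ _ suppT suppq] := supp.
have : (closure S1 `|` S2) p by rewrite sE.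
move=> [c1|s2]; [left|right] => t t0.
  by rewrite (sol_T_bound sol)// suppT.
pose N := \sum_i gradient psi p ord0 i ^+ 2.
have N0 : 0 < N.
  have [_ [i hi] _] := Cp.
  rewrite /N (bigD1 i)//= ltr_pwDl ?sumr_ge0// => [|j _]; last exact: sqr_ge0.
  by rewrite mxE lt_neqAle eq_sym sqrf_eq0 hi sqr_ge0.
pose n := (Num.sqrt N)^-1 *: gradient psi p.
have nn : outward_unit_normal B p n by exists psi; split.
have := sol_flux_bound sol s2 t0 nn; rewrite suppq//.
have -> : \sum_i q i p t * n ord0 i =
   (Num.sqrt N)^-1 * \sum_i q i p t * 'D_(delta_mx ord0 i) psi p.
  by rewrite mulr_sumr; apply: eq_bigr => i _; rewrite !mxE; ring.
by move/eqP; rewrite mulf_eq0 invr_eq0 gt_eqF ?sqrtr_gt0//= => /eqP.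
Qed.

Lemma extT_contB x : B x -> continuous (ext T x).
Proof. by move=> Bx s; exact: jcont_slice (ext_cont oB Tclosed Bx). Qed.

Lemma augmented_temp_le x t w : B x -> 0 <= t <= t1 ->
  (forall s, 0 <= s <= t1 -> `|T x s| <= w) ->
  `|augmented_temp tauT T x t| <= (t1 + tauT) * w.
Proof.
move=> Bx /andP[t0 tt1] Tw.
have w0 : 0 <= w by apply: le_trans (Tw 0 _) => //; rewrite lexx ltW.
rewrite /augmented_temp mulrDl; apply: (le_trans (ler_normD _ _)); apply: lerD.
  apply: (@le_trans _ _ (t * w)); last exact: ler_wpM2r.
  apply: prim_le => //; first exact: extT_contB.
  move=> s /andP[s0 st]; rewrite ext_ge0//; apply: Tw.
  by rewrite s0 (le_trans st).
rewrite normrM gtr0_norm// ext_ge0//; apply: ler_wpM2l; first exact: ltW.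
by apply: Tw; rewrite t0.
Qed.

Lemma field_bound : exists2 C, 0 < C & forall x t, closure B x -> 0 <= t <= t1 ->
  `|T x t| <= C /\ forall i, `|q i x t| <= C.
Proof.
have [C hC] := unif_bound t1 cB Tclosed.
have /choice[Cq hq] i := unif_bound t1 cB (@qclosed i).
exists (`|C| + \sum_i `|Cq i| + 1).
  by rewrite ltr_wpDl// addr_ge0// sumr_ge0.
have s0 : 0 <= \sum_i `|Cq i| by rewrite sumr_ge0.
move=> x t cx tI; split => [|i].
  apply: (le_trans (hC x t cx tI)); have := ler_norm C; lra.
apply: (le_trans (hq i x t cx tI)).
have : `|Cq i| <= \sum_i `|Cq i| by rewrite (bigD1 i)//= lerDl sumr_ge0.
have := ler_norm (Cq i); have := normr_ge0 C; lra.
Qed.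

Lemma field_unif w : 0 < w -> exists2 r, 0 < r & forall x x' t, closure B x ->
  closure B x' -> 0 <= t <= t1 -> `|x' - x| < r ->
  `|T x' t - T x t| < w /\ forall i, `|q i x' t - q i x t| < w.
Proof.
move=> w0; have [r r0 hr] := unif_cont t1 cB Tclosed w0.
have /choice[rq hq] i : exists r, 0 < r /\ forall x x' t, closure B x ->
    closure B x' -> 0 <= t <= t1 -> `|x' - x| < r -> `|q i x' t - q i x t| < w.
  by have [r' r'0 hr'] := unif_cont t1 cB (@qclosed i) w0; exists r'.
pose m := \big[Num.min/r]_i rq i.
have m0 : 0 < m by rewrite /m; apply: lt_bigmin => // i _; exact: (hq i).1.
exists m => // x x' t cx cx' tI xx; split.
  by apply: hr => //; apply: lt_le_trans xx _; exact: bigmin_le_id.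
move=> i; apply: (hq i).2 => //; apply: lt_le_trans xx _.
exact: bigmin_le_cond.
Qed.

(** The horizontal part of phi q on the cross section, at height p.1 and time
    p.2; outside the relevant heights and times it is 0, so that the bounds below
    are uniform in p. *)
Definition lateral_flux (p : R * R) (i : 'I_2) (y : 'rV[R]_2) : R :=
  if (0 < p.1 < L) && (0 <= p.2 <= t1) then
    augmented_temp tauT T (rcons_rv y p.1) p.2 * q (lift ord_max i) (rcons_rv y p.1) p.2
  else 0.

Lemma lateral_flux_bound : exists C, forall p i y, D y -> `|lateral_flux p i y| <= C.
Proof.
have [C C0 hC] := field_bound.
have A0 : 0 < t1 + tauT by rewrite addr_gt0.
exists ((t1 + tauT) * C * C) => p i y Dy; rewrite /lateral_flux.
case: ifPn => [/andP[/andP[z0 zL] tI]|_]; last first.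
  by rewrite normr0 !mulr_ge0// ltW.
have By : B (rcons_rv y p.1) by apply/cylinder_rcons; rewrite zL andbT; split => //; move: h0; lra.
rewrite normrM; apply: ler_pM => //.
  by apply: augmented_temp_le => // s sI; apply: (hC _ s _ sI).1; exact: subset_closure.
by apply: (hC _ _ _ tI).2; exact: subset_closure.
Qed.

(** On the vertical line above y one of T and q . grad psi vanishes, at each
    height for all times; near the line it stays small by uniform continuity. *)
Lemma lateral_flux_small y psi : boundary D y -> C1_defining D y psi ->
  forall w, 0 < w -> \forall x \near y, D x -> forall p,
    `|\sum_i lateral_flux p i x * 'D_(delta_mx ord0 i) psi x| <= w.
Proof.
move=> by_ Cy w w0.
have [C C0 hC] := field_bound.
pose A := t1 + tauT; have A0 : 0 < A by rewrite addr_gt0.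
pose dp (i : 'I_2) (x : 'rV[R]_2) := 'D_(delta_mx ord0 i) psi x.
pose G := \sum_i `|dp i y| + 1.
have G1 : 1 <= G by rewrite lerDr sumr_ge0.
have G0 : 0 < G by lra.
pose e := Num.min 1 (w / (2 * A * (G * C + C * (G + C)))).
have CG : 0 < C * (G + C) by rewrite mulr_gt0// addr_gt0.
have den : 0 < 2 * A * (G * C + C * (G + C)).
  by rewrite mulr_gt0 ?mulr_gt0// addr_gt0 ?mulr_gt0// addr_gt0.
have e0 : 0 < e by rewrite lt_min ltr01 divr_gt0.
have [e1 ew] : e <= 1 /\ e * (2 * A * (G * C + C * (G + C))) <= w.
  split; first by rewrite ge_min lexx.
  by rewrite -ler_pdivlMr// ge_min lexx orbT.
have [r r0 hr] := field_unif e0.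
have [n1 _ _] := Cy.
have cdp i : continuous_at y (dp i) by have [_] := nbhs_singleton n1 i.
have n2 : \forall x \near y, forall i, `|dp i x - dp i y| < e.
  by apply: near_forall_ord => i; exact: ((cont_distP _ _).1 (cdp i)).
have yy : `|y - y| < r by rewrite subrr normr0.
apply: (near_imp (near_and n2 (near_dist_lt yy))) => x [dx xy] Dx [z t].
rewrite /lateral_flux /=.
case: (boolP ((0 < z < L) && (0 <= t <= t1))) => [/andP[/andP[z0 zL] tI]|_]; last first.
  by rewrite big1 ?normr0 ?ltW// => i _; rewrite mul0r.
have hz : - h < z < L by rewrite zL andbT; move: h0; lra.
have [bp Cp] := lateral_normal oD hL by_ Cy hz.
have z3 : 0 < rcons_rv y z ord0 ord_max by rewrite rcons_rv_max.
have Bx : B (rcons_rv x z) by apply/cylinder_rcons.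
have cx : closure B (rcons_rv x z) by exact: subset_closure.
have cy : closure B (rcons_rv y z) by case: bp.
have xyz : `|rcons_rv x z - rcons_rv y z| < r.
  by apply: le_lt_trans xy; apply: rcons_dist => //; rewrite subrr normr0.
have dG i : `|dp i x| <= G.
  have := ler_normD (dp i x - dp i y) (dp i y); rewrite subrK => h1.
  have : `|dp i y| <= \sum_i `|dp i y| by rewrite (bigD1 i)//= lerDl sumr_ge0.
  by have := dx i; rewrite /G; move: e1; lra.
have -> : \sum_i augmented_temp tauT T (rcons_rv x z) t * q (lift ord_max i) (rcons_rv x z) t * dp i x =
  augmented_temp tauT T (rcons_rv x z) t * \sum_i q (lift ord_max i) (rcons_rv x z) t * dp i x.
  by rewrite mulr_sumr; apply: eq_bigr => i _; rewrite mulrA.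
rewrite normrM.
have sum2 (f : 'I_2 -> R) c : (forall i, `|f i| <= c) -> `|\sum_i f i| <= 2 * c.
  move=> fc; apply: (le_trans (ler_norm_sum _ _ _)).
  apply: (@le_trans _ _ (\sum_(i < 2) c)); first exact: ler_sum.
  by rewrite sumr_const card_ord mulr_natl.
have [T0|q0] := bc_dichotomy bp z3 Cp.
  apply: le_trans ew; rewrite (_ : e * _ = (A * e) * (2 * (G * C + C * (G + C)))); last by ring.
  apply: ler_pM => //.
    apply: augmented_temp_le => // s sI; have [h1 _] := hr _ _ _ cy cx sI xyz.
    by move: h1; rewrite T0 ?subr0; [exact: ltW|case/andP: sI].
  apply: sum2 => i; rewrite normrM mulrC.
  apply: (@le_trans _ _ (G * C)); last by rewrite lerDl ltW.
  by apply: ler_pM => //; exact: (hC _ _ cx tI).2.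
have t0 : 0 <= t by case/andP: tI.
have q0' : \sum_i q (lift ord_max i) (rcons_rv y z) t * dp i y = 0.
  rewrite -[RHS](q0 t t0) [RHS]big_ord_recr /= (der_val (der_base_max _ _)) mulr0 addr0.
  apply: eq_bigr => i _; have -> : widen_ord (leqnSn 2) i = lift ord_max i.
    by apply: val_inj; rewrite /= /fintype.bump leqNgt ltn_ord add0n.
  by rewrite derive_base_at base_rcons.
have -> : \sum_i q (lift ord_max i) (rcons_rv x z) t * dp i x =
   \sum_i ((q (lift ord_max i) (rcons_rv x z) t - q (lift ord_max i) (rcons_rv y z) t) * dp i x
     + q (lift ord_max i) (rcons_rv y z) t * (dp i x - dp i y)).
  rewrite -[LHS]subr0 -[X in _ - X = _]q0' -sumrB; apply: eq_bigr => i _; ring.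
apply: le_trans ew; rewrite (_ : e * _ = (A * C) * (2 * (e * (G + C)))
   + e * (2 * A * (G * C))); last by ring.
apply: (@le_trans _ _ ((A * C) * (2 * (e * (G + C))))); last first.
  by rewrite lerDl ltW// mulr_gt0// mulr_gt0 ?mulr_gt0.
have [_ hq] := hr _ _ _ cy cx tI xyz.
apply: ler_pM => //.
  apply: augmented_temp_le => // s sI; exact: (hC _ _ cx sI).1.
apply: sum2 => i; apply: (le_trans (ler_normD _ _)).
rewrite !normrM mulrDr; apply: lerD; first by apply: ler_pM => //; exact: ltW.
rewrite mulrC; apply: ler_pM => //; first exact: ltW.
exact: (hC _ _ cy tI).2.
Qed.

(** On the top face the normal is the axis, and T or q_3 vanishes. *)
Lemma top_small w : 0 < w -> exists2 eps, 0 < eps & forall x t, B x ->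
  0 < x ord0 ord_max -> L - eps < x ord0 ord_max -> 0 <= t <= t1 ->
  `|augmented_temp tauT T x t * q ord_max x t| <= w.
Proof.
move=> w0; have [C C0 hC] := field_bound.
pose A := t1 + tauT; have A0 : 0 < A by rewrite addr_gt0.
have AC : 0 < A * C by rewrite mulr_gt0.
have [r r0 hr] := field_unif (divr_gt0 w0 AC).
exists r => // x t Bx x3 xL tI.
pose p := rcons_rv (base x) L.
have Dx : D (base x) by case: Bx.
have [bp Cp] := top_normal oD hL Dx.
have p3 : 0 < p ord0 ord_max by rewrite rcons_rv_max.
have cx : closure B x by exact: subset_closure.
have cp : closure B p by case: bp.
have xp : `|x - p| < r.
  have xL' : x ord0 ord_max < L by case: Bx => _ /andP[].
  apply: (@le_lt_trans _ _ (L - x ord0 ord_max)); last lra.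
  rewrite -{1}(rcons_base x); apply: rcons_dist; first lra.
    by rewrite subrr normr0; lra.
  by rewrite distrC ger0_norm//; lra.
rewrite normrM.
have [T0|q0] := bc_dichotomy bp p3 Cp.
  have -> : w = (A * (w / (A * C))) * C by field; rewrite !gt_eqF.
  apply: ler_pM => //; last exact: (hC _ _ cx tI).2.
  apply: augmented_temp_le => // s sI; have [h1 _] := hr _ _ _ cp cx sI xp.
  by move: h1; rewrite T0 ?subr0; [exact: ltW|case/andP: sI].
have t0 : 0 <= t by case/andP: tI.
have q0' : q ord_max p t = 0.
  have dd i : 'D_(delta_mx ord0 i) (fun x : 'rV[R]_3 => x ord0 ord_max - L) p =
      (i == ord_max)%:R.
    apply: der_val; rewrite -[X in der _ _ _ X]subr0; apply: derB; last exact: der_cst.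
    have := der_coord p (delta_mx ord0 i) ord_max.
    by rewrite [(delta_mx _ _ : 'rV_3) _ _]mxE eqxx /= eq_sym.
  rewrite -[RHS](q0 t t0) (bigD1 ord_max)//= dd eqxx mulr1 big1 ?addr0// => i /negPf ni.
  by rewrite dd ni mulr0.
have -> : w = (A * C) * (w / (A * C)) by field; rewrite !gt_eqF.
apply: ler_pM => //; first by apply: augmented_temp_le => // s sI; exact: (hC _ _ cx sI).1.
by have [_ /(_ ord_max)] := hr _ _ _ cp cx tI xp; rewrite q0' subr0 => /ltW.
Qed.
End boundary_flux.

(** * Quadratic forms of fields, and a Gronwall inequality *)

Lemma cont_bil (X : topologicalType) (R : realType) (n : nat) (A : X -> 'M[R]_n)
    (u v : 'I_n -> X -> R) (x : X) : (forall i j, continuous_at x (fun y => A y i j)) ->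
  (forall i, continuous_at x (u i)) -> (forall i, continuous_at x (v i)) ->
  continuous_at x (fun y => bil (A y) (fun i => u i y) (fun i => v i y)).
Proof.
move=> cA cu cv; apply: cont_sum => i; apply: cont_sum => j.
by apply: contM; [apply: contM; [exact: cA|exact: cu]|exact: cv].
Qed.

Lemma der_bil (R : realType) (n : nat) (A : 'M[R]_n) (u du : 'I_n -> R -> R) (t : R) :
  A^T = A -> (forall i, der t 1 (u i) (du i t)) ->
  der t 1 (fun s => bil A (fun i => u i s) (fun i => u i s))
    (2 * bil A (fun i => u i t) (fun i => du i t)).
Proof.
move=> sA hu; have -> : 2 * bil A (fun i => u i t) (fun i => du i t) =
    bil A (fun i => u i t) (fun i => du i t) + bil A (fun i => du i t) (fun i => u i t).
  by rewrite (bil_sym (fun i => du i t) (fun i => u i t) sA) mulr_natl mulr2n.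
rewrite /bil -big_split /=; under eq_bigr do rewrite -big_split /=.
apply: der_sum => i; apply: der_sum => j.
have h := derM (derZ (A i j) (hu i)) (hu j).
rewrite (_ : A i j * u i t * du j t + A i j * du i t * u j t =
  A i j * u i t * du j t + u j t * (A i j * du i t)); last by ring.
exact: h.
Qed.

Lemma bil_dot (R : realType) (n : nat) (A : 'M[R]_n) (u v : 'I_n -> R) :
  bil A u v = \sum_i u i * \sum_j A i j * v j.
Proof.
apply: eq_bigr => i _; rewrite mulr_sumr; apply: eq_bigr => j _; ring.
Qed.

(** By the inequality of arithmetic and geometric means, the bracket is at least
    tauq |p| sqrt (a X / (2 tauT)), while |s| <= sqrt (kM X). *)
Lemma flux_le (R : realType) (X a tauq tauT c kM p s : R) : 0 < tauq -> 0 < tauT ->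
  0 < c -> 0 < a -> 0 <= X -> 0 <= kM -> 2 * tauT * kM <= c ^+ 2 * tauq ^+ 2 * a ->
  s ^+ 2 <= kM * X -> p * s <= c * (4^-1 * tauq ^+ 2 * X + a / (2 * tauT) * p ^+ 2).
Proof.
move=> q0 T0 c0 a0 X0 k0 hc hs.
pose al := 4^-1 * tauq ^+ 2 * X; pose be := a / (2 * tauT) * p ^+ 2.
have al0 : 0 <= al by rewrite !mulr_ge0// ?invr_ge0 ?sqr_ge0//; lra.
have be0 : 0 <= be by rewrite mulr_ge0 ?sqr_ge0// divr_ge0 ?mulr_ge0// ltW.
rewrite -/al -/be.
have h2 : (p * s) ^+ 2 <= (c * (al + be)) ^+ 2.
  apply: (@le_trans _ _ (p ^+ 2 * (kM * X))).
    by rewrite exprMn ler_wpM2l ?sqr_ge0.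
  apply: (@le_trans _ _ (c ^+ 2 * (4 * (al * be)))).
    have -> : c ^+ 2 * (4 * (al * be)) =
        (c ^+ 2 * tauq ^+ 2 * a) * (p ^+ 2 * X / (2 * tauT)).
      by rewrite /al /be; field; rewrite gt_eqF.
    have -> : p ^+ 2 * (kM * X) = (2 * tauT * kM) * (p ^+ 2 * X / (2 * tauT)).
      by field; rewrite gt_eqF.
    have T2 : 0 <= 2 * tauT by move: T0; lra.
    by rewrite ler_wpM2r// divr_ge0// mulr_ge0 ?sqr_ge0.
  rewrite exprMn ler_wpM2l ?sqr_ge0//.
  by have := sqr_ge0 (al - be); rewrite !expr2; lra.
have n0 : 0 <= c * (al + be) by rewrite mulr_ge0 ?addr_ge0// ltW.
have := ler_norm (p * s).
by move: h2; rewrite -real_normK ?num_real// ler_sqr ?nnegrE//; lra.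
Qed.

(** exp (- K t) E t - d t is nonincreasing. *)
Lemma gronwall (R : realType) (E dE : R -> R) (K d t1 : R) : 0 < t1 -> 0 <= K -> 0 <= d ->
  (forall t : R, 0 <= t <= t1 -> continuous_at t E) ->
  (forall t : R, 0 < t < t1 -> der t 1 E (dE t)) ->
  (forall t, 0 < t < t1 -> dE t <= K * E t + d) -> E 0 = 0 ->
  E t1 <= d * t1 * expR (K * t1).
Proof.
move=> t10 K0 d0 cE hE dEle E0.
pose y (t : R) := expR (- K * t) * E t - d * t.
have dexp (t : R) : der t 1 (fun t : R => expR (- K * t)) (expR (- K * t) * (- K * 1)).
  apply: (der_comp (h := @expR R)); first exact: is_derive_expR.
  by apply: derZ; exact: der_id.
have dy (t : R) : 0 < t < t1 -> der t 1 y
    (expR (- K * t) * dE t + E t * (expR (- K * t) * (- K * 1)) - d * 1).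
  move=> tI; apply: derB; last by apply: derZ; exact: der_id.
  by apply: derM; [exact: dexp|exact: hE].
have cy : {within `[0, t1], continuous y}.
  apply: continuous_in_subspaceT => t; rewrite inE /= => tI.
  apply: contB; last by apply: contZ; exact: cont_id.
  apply: contM; last by apply: cE; move: tI; rewrite in_itv.
  apply: (cont_comp (g := @expR R)); last exact: continuous_expR.
  by apply: contZ; exact: cont_id.
have [s sI hs] := MVT t10 (fun t tI => dy t tI) cy.
have sI' : 0 < s < t1 by move: sI; rewrite in_itv.
have es0 := expR_gt0 (- K * s).
have es1 : expR (- K * s) <= 1.
  by rewrite -expR0 ler_expR mulNr oppr_le0 mulr_ge0// ltW//; case/andP: sI'.
have hy : y t1 - y 0 <= 0.
  rewrite hs pmulr_lle0 ?subr0//.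
  have h1 := dEle s sI'.
  have h2 : expR (- K * s) * (dE s - K * E s) <= expR (- K * s) * d.
    by rewrite ler_pM2l//; lra.
  have h3 : expR (- K * s) * d <= d by rewrite -[leRHS]mul1r ler_wpM2r.
  lra.
move: hy; rewrite /y E0 !mulr0 !subr0 subr_le0 => hy.
have e1 : expR (- K * t1) * expR (K * t1) = 1.
  by rewrite -expRD mulNr addNr expR0.
have := expR_gt0 (K * t1) => p1.
rewrite -[E t1]mul1r -e1 mulrAC; apply: ler_wpM2r; first exact: ltW.
exact: hy.
Qed.

(** * The moving weight *)

Lemma C1_height (R : realType) :
  C1 (fun x : 'rV[R]_3 => x ord0 ord_max) (fun i _ => (i == ord_max)%:R).
Proof.
split; [exact: cont_coord|by move=> i x; exact: cont_cst|move=> i x].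
have := der_coord x (delta_mx ord0 i) ord_max.
by rewrite [(delta_mx _ _ : 'rV_3) _ _]mxE eqxx /= eq_sym.
Qed.

Lemma C1_base (R : realType) (chi : 'rV[R]_2 -> R) (dchi : 'I_2 -> 'rV[R]_2 -> R) :
  C1 chi dchi -> C1 (fun x : 'rV[R]_3 => chi (base x))
    (fun i x => if unlift ord_max i is Some j then dchi j (base x) else 0).
Proof.
move=> [cc cd dd]; split.
- by move=> x; apply: cont_comp; [exact: base_cont|exact: cc].
- move=> i x; case: unliftP => [j _|_]; last exact: cont_cst.
  by apply: (cont_comp (f := @base R) (g := dchi j)); [exact: base_cont|exact: cd].
- move=> i x; have [j ->|->] := unliftP ord_max i.
    by apply: der_base; exact: dd.
  exact: der_base_max.
Qed.

Section weight.
Context (R : realType) (D : set 'rV[R]_2) (L eps c d0 : R) (chi : 'rV[R]_2 -> R)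
  (dchi : 'I_2 -> 'rV[R]_2 -> R).
Hypothesis eps0 : 0 < eps.
Hypothesis chi1 : C1 chi dchi.
Hypothesis chi_out : forall y, ~ D y -> \forall x \near y, chi x = 0.

(** Cuts off the top face: 0 for z >= L - eps, and 1 for z <= L - 2 eps. *)
Definition lid (z : R) : R := smoothstep ((L - z) / eps - 1).
Definition dlid (z : R) : R := dsmoothstep ((L - z) / eps - 1) / eps.

Lemma der_lid (z : R) : der z 1 lid (- dlid z).
Proof.
have -> : - dlid z = dsmoothstep ((L - z) / eps - 1) * (- eps^-1) by rewrite mulrN.
apply: (der_comp (h := @smoothstep R)); first exact: der_smoothstep.
have -> : (fun z => (L - z) / eps - 1) = (fun z => - eps^-1 * z + (L / eps - 1)).
  by apply/funext => s; field; rewrite gt_eqF.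
rewrite -[X in der _ _ _ X]addr0; apply: derD; last exact: der_cst.
rewrite -[X in der _ _ _ X]mulr1; apply: derZ; exact: der_id.
Qed.

Lemma dlid_cont : continuous dlid.
Proof.
move=> z; apply: contM; last exact: cont_cst.
apply: (cont_comp (g := @dsmoothstep R)); last exact: dsmoothstep_cont.
apply: contB; last exact: cont_cst.
by apply: contM; [apply: contB; [exact: cont_cst|exact: cont_id]|exact: cont_cst].
Qed.

Definition clip (x : 'rV[R]_3) : R := chi (base x) * lid (x ord0 ord_max).
Definition dclip (i : 'I_3) (x : 'rV[R]_3) : R :=
  chi (base x) * (- dlid (x ord0 ord_max) * (i == ord_max)%:R) +
  (if unlift ord_max i is Some j then dchi j (base x) else 0) * lid (x ord0 ord_max).

Lemma C1_clip : C1 clip dclip.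
Proof.
apply: (C1M (C1_base chi1) (C1_comp (h := lid) (dh := fun z => - dlid z) der_lid _ (C1_height R))).
by move=> z; apply: contN; exact: dlid_cont.
Qed.

(** The margin d0 > 0 keeps the support within x_3 > 0 also for slightly negative
    times, whence continuity up to t = 0. *)
Definition front (x : 'rV[R]_3) (t : R) : R := pos2 (x ord0 ord_max - d0 - c * t).
Definition dfront (x : 'rV[R]_3) (t : R) : R := dpos2 (x ord0 ord_max - d0 - c * t).
Definition weight (x : 'rV[R]_3) (t : R) : R := clip x * front x t.
Definition weight_dt (x : 'rV[R]_3) (t : R) : R := clip x * (- c * dfront x t).
Definition weight_dx (t : R) (i : 'I_3) (x : 'rV[R]_3) : R :=
  clip x * (dfront x t * (i == ord_max)%:R) + dclip i x * front x t.

Lemma C1_weight (t : R) : C1 (fun x => weight x t) (weight_dx t).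
Proof.
apply: (C1M C1_clip).
apply: (C1_comp (h := fun z => pos2 (z - d0 - c * t)) (dh := fun z => dpos2 (z - d0 - c * t))
  _ _ (C1_height R)).
  move=> z; rewrite -[X in der _ _ _ X]mulr1; apply: (der_comp (h := @pos2 R)).
    exact: der_pos2.
  rewrite -[X in der _ _ _ X]subr0; apply: derB; last exact: der_cst.
  rewrite -[X in der _ _ _ X]subr0; apply: derB; last exact: der_cst.
  exact: der_id.
move=> z; apply: (cont_comp (g := @dpos2 R)); last exact: dpos2_cont.
apply: contB; last exact: cont_cst.
by apply: contB; [exact: cont_id|exact: cont_cst].
Qed.

Lemma der_weight (x : 'rV[R]_3) (t : R) : der t 1 (weight x) (weight_dt x t).
Proof.
apply: derZ; rewrite mulrC; apply: (der_comp (h := @pos2 R)).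
  exact: der_pos2.
rewrite -[X in der _ _ _ X]add0r; apply: derD; first exact: der_cst.
rewrite (_ : (fun t => - (c * t)) = (fun t => - c * t)).
  rewrite -[X in der _ _ _ X]mulr1; apply: derZ; exact: der_id.
by apply/funext => s; rewrite mulNr.
Qed.

Lemma cont_shift (x : 'rV[R]_3) (t : R) :
  continuous_at (t, x) (fun p : R * 'rV[R]_3 => p.2 ord0 ord_max - d0 - c * p.1).
Proof.
apply: contB; last by apply: contZ; exact: cont_fst.
apply: contB; last exact: cont_cst.
by apply: (cont_comp (f := snd) (g := fun x : 'rV[R]_3 => x ord0 ord_max));
  [exact: cont_snd|exact: cont_coord].
Qed.

Lemma clip_cont2 (x : 'rV[R]_3) (t : R) :
  continuous_at (t, x) (fun p : R * 'rV[R]_3 => clip p.2).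
Proof.
have [cc _ _] := C1_clip.
by apply: (cont_comp (f := snd) (g := clip)); [exact: cont_snd|exact: cc].
Qed.

Lemma weight_cont (x : 'rV[R]_3) (t : R) :
  continuous_at (t, x) (fun p => weight p.2 p.1).
Proof.
apply: contM; first exact: clip_cont2.
apply: (cont_comp (g := @pos2 R)); first exact: cont_shift.
by apply: contM; apply: (@cont_max0 R).
Qed.

Lemma weight_dt_cont (x : 'rV[R]_3) (t : R) :
  continuous_at (t, x) (fun p => weight_dt p.2 p.1).
Proof.
apply: contM; first exact: clip_cont2.
apply: contZ; apply: (cont_comp (g := @dpos2 R)); first exact: cont_shift.
exact: dpos2_cont.
Qed.

Lemma weight_near0 (x : 'rV[R]_3) (t : R) : 0 < c * t + d0 ->
  ~ (D (base x) /\ 0 < x ord0 ord_max < L) ->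
  \forall p \near (t, x), weight p.2 p.1 = 0 /\ weight_dt p.2 p.1 = 0.
Proof.
move=> ct nx.
have nb (P : 'rV[R]_3 -> Prop) : (\forall y \near x, P y) ->
    \forall p \near (t, x), P p.2.
  by move=> h; have := @cont_snd R 'rV[R]_3 (t, x) P; exact.
have clip0 (P : 'rV[R]_3 -> Prop) : (forall y, P y -> clip y = 0) ->
    (\forall y \near x, P y) ->
    \forall p \near (t, x), weight p.2 p.1 = 0 /\ weight_dt p.2 p.1 = 0.
  move=> h /nb hP; apply: (near_imp hP) => p /h.
  by rewrite /weight /weight_dt => ->; rewrite !mul0r.
have [Dx|nDx] := pselect (D (base x)); last first.
  apply: (clip0 (fun y => chi (base y) = 0)); first by move=> y h; rewrite /clip h mul0r.
  by have := @base_cont R x (fun y => chi y = 0); apply; exact: chi_out.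
have [x0|x0] := leP (x ord0 ord_max) 0.
  have h0 : x ord0 ord_max - d0 - c * t < 0 by lra.
  have n0 : \forall p \near (t, x), (p : R * 'rV[R]_3).2 ord0 ord_max - d0 - c * p.1 < 0.
    exact: (cvgr_lt _ (@cont_shift x t) 0 h0).
  apply: (near_imp n0) => p hp.
  have e0 : Num.max (p.2 ord0 ord_max - d0 - c * p.1) 0 = 0 by rewrite max_r// ltW.
  by rewrite /weight /weight_dt /front /dfront /pos2 /dpos2 e0 expr0n /= !mulr0.
have xL : L <= x ord0 ord_max.
  by rewrite leNgt; apply/negP => xL; apply: nx; rewrite x0.
apply: (clip0 (fun y => L - eps < y ord0 ord_max)).
  move=> y h; rewrite /clip /lid smoothstep_le0 ?mulr0// subr_le0 ler_pdivrMr//; lra.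
by apply: (cvgr_gt _ (@cont_coord R 3 ord_max x)); move: eps0; lra.
Qed.
End weight.

(** * The energy estimate *)

Section energy_density.
Context (R : realType) (Om : set 'rV[R]_3) (tauq tauT c kM : R) (a : 'rV[R]_3 -> R)
  (k kap : 'rV[R]_3 -> 'M[R]_3) (T Th phi dT : 'rV[R]_3 -> R -> R)
  (q Q q1 gphi : 'I_3 -> 'rV[R]_3 -> R -> R)
  (dq : 'I_3 -> 'I_3 -> 'rV[R]_3 -> R -> R).
Hypothesis tauq0 : 0 < tauq.
Hypothesis tauT0 : 0 < tauT.
Hypothesis c0 : 0 < c.
Hypothesis kM0 : 0 <= kM.
Hypothesis a0 : forall x, Om x -> 0 < a x.
Hypothesis speed : forall x, Om x -> 2 * tauT * kM <= c ^+ 2 * tauq ^+ 2 * a x.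
Hypothesis kap_sym : forall x, Om x -> (kap x)^T = kap x.
Hypothesis kap_inv : forall x v i, Om x ->
  \sum_j kap x i j * (\sum_l k x j l * v l) = v i.
Hypothesis kap_ge0 : forall x u, Om x -> 0 <= bil (kap x) u u.
Hypothesis kap_def : forall x u, Om x -> bil (kap x) u u = 0 -> forall i, u i = 0.
Hypothesis kap_le : forall x u i, Om x -> u i ^+ 2 <= kM * bil (kap x) u u.
Hypothesis ca : forall x, Om x -> continuous_at x a.
Hypothesis ckap : forall x i j, Om x -> continuous_at x (fun y => kap y i j).
Hypothesis cTh : forall x (t : R), Om x -> continuous_at (x, t) (fun p => Th p.1 p.2).
Hypothesis cphi : forall x (t : R), Om x -> continuous_at (x, t) (fun p => phi p.1 p.2).
Hypothesis cq : forall i x (t : R), Om x -> continuous_at (x, t) (fun p => q i p.1 p.2).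
Hypothesis cQ : forall i x (t : R), Om x -> continuous_at (x, t) (fun p => Q i p.1 p.2).
Hypothesis cgphi : forall i x (t : R), Om x -> 0 < t ->
  continuous_at (x, t) (fun p => gphi i p.1 p.2).
Hypothesis cdq : forall i j x (t : R), Om x -> 0 < t ->
  continuous_at (x, t) (fun p => dq i j p.1 p.2).
Hypothesis phiE : forall x (t : R), phi x t = Th x t + tauT * T x t.
Hypothesis dTh : forall x (t : R), Om x -> 0 < t -> der t 1 (Th x) (T x t).
Hypothesis dphi : forall x (t : R), Om x -> 0 < t -> der t 1 (phi x) (T x t + tauT * dT x t).
Hypothesis dQ : forall i x (t : R), Om x -> 0 < t -> der t 1 (Q i x) (q i x t).
Hypothesis dqt : forall i x (t : R), Om x -> 0 < t -> der t 1 (q i x) (q1 i x t).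
Hypothesis dphix : forall i x (t : R), Om x -> 0 < t ->
  der x (delta_mx ord0 i) (phi^~ t) (gphi i x t).
Hypothesis dqx : forall i j x (t : R), Om x -> 0 < t ->
  der x (delta_mx ord0 j) ((q i)^~ t) (dq i j x t).
Hypothesis law_q : forall i x (t : R), Om x -> 0 < t ->
  Q i x t + tauq * q i x t + 2^-1 * tauq ^+ 2 * q1 i x t =
  - \sum_j k x i j * gphi j x t.
Hypothesis law_T : forall x (t : R), Om x -> 0 < t -> a x * dT x t = - \sum_i dq i i x t.

(** The density e; kap x stands for the inverse of k x, since the law is tested
    against kap q. *)
Definition energy (x : 'rV[R]_3) (t : R) : R :=
  4^-1 * tauq ^+ 2 * bil (kap x) (fun i => q i x t) (fun i => q i x t) +
  2^-1 * bil (kap x) (fun i => Q i x t) (fun i => Q i x t) +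
  a x / (2 * tauT) * (phi x t ^+ 2 + Th x t ^+ 2).

(** The time derivative of the energy density, written as minus the divergence
    of phi q plus terms without derivatives. *)
Definition energy_rate (x : 'rV[R]_3) (t : R) : R :=
  - (\sum_i (phi x t * dq i i x t + gphi i x t * q i x t)) -
  tauq * bil (kap x) (fun i => q i x t) (fun i => q i x t) +
  a x / tauT ^+ 2 * (phi x t ^+ 2 - Th x t ^+ 2).

Let qq0 : 0 < 4^-1 * tauq ^+ 2. Proof. by rewrite mulr_gt0 ?invr_gt0// exprn_gt0. Qed.

Lemma energy_ge0 x (t : R) : Om x -> 0 <= energy x t.
Proof.
move=> Ox; have := a0 Ox => ax.
have h1 := kap_ge0 (fun i => q i x t) Ox; have h2 := kap_ge0 (fun i => Q i x t) Ox.
have h3 : 0 <= a x / (2 * tauT) * (phi x t ^+ 2 + Th x t ^+ 2).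
  by rewrite mulr_ge0 ?addr_ge0 ?sqr_ge0// divr_ge0 ?mulr_ge0// ltW.
have h4 : 0 <= 4^-1 * tauq ^+ 2 * bil (kap x) (fun i => q i x t) (fun i => q i x t).
  by rewrite mulr_ge0// ltW.
rewrite /energy; lra.
Qed.

Lemma energy_eq0 x (t : R) : Om x -> energy x t = 0 ->
  [/\ phi x t = 0, Th x t = 0 & forall i, q i x t = 0].
Proof.
move=> Ox; have := a0 Ox => ax.
have h1 := kap_ge0 (fun i => q i x t) Ox; have h2 := kap_ge0 (fun i => Q i x t) Ox.
have A0 : 0 < a x / (2 * tauT) by rewrite divr_gt0 ?mulr_gt0.
have p2 := sqr_ge0 (phi x t); have T2 := sqr_ge0 (Th x t).
have t2 := qq0.
have h3 : 0 <= a x / (2 * tauT) * phi x t ^+ 2 by rewrite mulr_ge0// ltW.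
have h4 : 0 <= a x / (2 * tauT) * Th x t ^+ 2 by rewrite mulr_ge0// ltW.
have h5 : 0 <= 4^-1 * tauq ^+ 2 * bil (kap x) (fun i => q i x t) (fun i => q i x t).
  by rewrite mulr_ge0// ltW.
rewrite /energy mulrDr => E0.
have z1 : a x / (2 * tauT) * phi x t ^+ 2 = 0 by lra.
have z2 : a x / (2 * tauT) * Th x t ^+ 2 = 0 by lra.
have z3 : 4^-1 * tauq ^+ 2 * bil (kap x) (fun i => q i x t) (fun i => q i x t) = 0 by lra.
split.
- by move/eqP: z1; rewrite mulf_eq0 gt_eqF//= sqrf_eq0 => /eqP.
- by move/eqP: z2; rewrite mulf_eq0 gt_eqF//= sqrf_eq0 => /eqP.
- apply: (kap_def Ox).
  by move/eqP: z3; rewrite mulf_eq0 gt_eqF//= => /eqP.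
Qed.

(** This bound determines the admissible speeds c. *)
Lemma energy_flux_le x (t : R) i : Om x -> phi x t * q i x t <= c * energy x t.
Proof.
move=> Ox; have ax := a0 Ox.
have h := flux_le (phi x t) tauq0 tauT0 c0 ax (kap_ge0 _ Ox) kM0 (speed Ox)
  (kap_le (fun i => q i x t) i Ox).
apply: (le_trans h).
rewrite ler_pM2l// /energy.
have h2 := kap_ge0 (fun i => Q i x t) Ox.
have h4 : 0 <= a x / (2 * tauT) * Th x t ^+ 2.
  by rewrite mulr_ge0 ?sqr_ge0// divr_ge0 ?mulr_ge0// ltW.
rewrite (mulrDr (a x / (2 * tauT))); lra.
Qed.

(** Apart from the divergence, the only term of positive sign is
    a / tauT^2 phi^2, that is 2 / tauT times the part a / (2 tauT) phi^2 of the
    energy. *)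
Lemma energy_rate_le x (t : R) : Om x ->
  energy_rate x t + \sum_i (phi x t * dq i i x t + gphi i x t * q i x t) <=
  2 / tauT * energy x t.
Proof.
move=> Ox; have ax := a0 Ox.
have h1 := kap_ge0 (fun i => q i x t) Ox; have h2 := kap_ge0 (fun i => Q i x t) Ox.
have h3 : 0 <= tauq * bil (kap x) (fun i => q i x t) (fun i => q i x t).
  by rewrite mulr_ge0// ltW.
have h4 : 0 <= 2 / tauT * (4^-1 * tauq ^+ 2 * bil (kap x) (fun i => q i x t) (fun i => q i x t)
    + 2^-1 * bil (kap x) (fun i => Q i x t) (fun i => Q i x t)).
  apply: mulr_ge0; first by rewrite divr_ge0// ltW.
  by apply: addr_ge0; apply: mulr_ge0 => //; exact: ltW qq0.
have h5 : 0 <= a x / tauT ^+ 2 * Th x t ^+ 2.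
  by rewrite mulr_ge0 ?sqr_ge0// divr_ge0 ?sqr_ge0// ltW.
have E : 2 / tauT * (a x / (2 * tauT) * (phi x t ^+ 2 + Th x t ^+ 2)) =
   a x / tauT ^+ 2 * (phi x t ^+ 2 + Th x t ^+ 2).
  by field; rewrite gt_eqF.
rewrite /energy_rate /energy [leRHS]mulrDr E.
move: h5 h4 h3; rewrite !(mulrDr (a x / _)) (mulrN (a x / _)); lra.
Qed.

(** The law tested against kap q gives - q . grad phi, and the heat equation
    gives - phi div q.  In the remaining term T is (phi - Th) / tauT. *)
Lemma energy_der x (t : R) : Om x -> 0 < t -> der t 1 (energy x) (energy_rate x t).
Proof.
move=> Ox t0; have ax := a0 Ox.
have d1 := der_bil (u := fun i => q i x) (du := fun i => q1 i x) (t := t) (kap_sym Ox) (fun i => dqt i Ox t0).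
have d2 := der_bil (u := fun i => Q i x) (du := fun i => q i x) (t := t) (kap_sym Ox) (fun i => dQ i Ox t0).
have d3 := derM (dphi Ox t0) (dphi Ox t0).
have d4 := derM (dTh Ox t0) (dTh Ox t0).
have d5 := derD (derD (derZ (4^-1 * tauq ^+ 2) d1) (derZ 2^-1 d2))
  (derZ (a x / (2 * tauT)) (derD d3 d4)).
suff <- : 4^-1 * tauq ^+ 2 * (2 * bil (kap x) (fun i => q i x t) (fun i => q1 i x t)) +
   2^-1 * (2 * bil (kap x) (fun i => Q i x t) (fun i => q i x t)) +
   a x / (2 * tauT) * (phi x t * (T x t + tauT * dT x t) + phi x t * (T x t + tauT * dT x t)
     + (Th x t * T x t + Th x t * T x t)) = energy_rate x t by exact: d5.
rewrite (bil_sym (fun i => Q i x t) (fun i => q i x t) (kap_sym Ox)).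
have L1 : 2^-1 * tauq ^+ 2 * bil (kap x) (fun i => q i x t) (fun i => q1 i x t) +
    bil (kap x) (fun i => q i x t) (fun i => Q i x t) =
    - (\sum_i gphi i x t * q i x t) - tauq * bil (kap x) (fun i => q i x t) (fun i => q i x t).
  rewrite !bil_dot !mulr_sumr -big_split -sumrN -sumrB /=; apply: eq_bigr => i _.
  have -> : gphi i x t = - (\sum_j kap x i j * Q j x t) - tauq * (\sum_j kap x i j * q j x t)
      - 2^-1 * tauq ^+ 2 * (\sum_j kap x i j * q1 j x t).
    rewrite -(kap_inv (fun i => gphi i x t) i Ox) !mulr_sumr -sumrN -!sumrB.
    apply: eq_bigr => j _.
    have := law_q j Ox t0; set S := \sum_l _ => hS.
    have -> : S = - (Q j x t + tauq * q j x t + 2^-1 * tauq ^+ 2 * q1 j x t).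
      by rewrite hS opprK.
    ring.
  ring.
have L2 : a x * dT x t * phi x t = - \sum_i phi x t * dq i i x t.
  by rewrite law_T// mulNr mulrC mulr_sumr.
rewrite /energy_rate big_split /= opprD.
have -> : a x / (2 * tauT) * (phi x t * (T x t + tauT * dT x t) + phi x t * (T x t + tauT * dT x t)
     + (Th x t * T x t + Th x t * T x t)) =
   a x / tauT ^+ 2 * (phi x t ^+ 2 - Th x t ^+ 2) + a x * dT x t * phi x t.
  by rewrite phiE; field; rewrite gt_eqF.
rewrite L2; move: L1; lra.
Qed.

Lemma energy_cont x (t : R) : Om x -> continuous_at (x, t) (fun p => energy p.1 p.2).
Proof.
move=> Ox.
have ck i j : continuous_at (x, t) (fun p : 'rV[R]_3 * R => kap p.1 i j).
  apply: (cont_comp (f := fst) (g := fun y => kap y i j)); first exact: cont_fst.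
  exact: ckap.
have c1 : continuous_at (x, t) (fun p : 'rV[R]_3 * R => a p.1).
  by apply: (cont_comp (f := fst) (g := a)); [exact: cont_fst|exact: ca].
apply: contD; first apply: contD.
- apply: contZ; apply: (@cont_bil _ _ _ (fun p : 'rV[R]_3 * R => kap p.1)) => // i; exact: cq.
- apply: contZ; apply: (@cont_bil _ _ _ (fun p : 'rV[R]_3 * R => kap p.1)) => // i; exact: cQ.
- apply: contM; first by apply: contM => //; exact: cont_cst.
  by apply: contD; apply: contM; do ?[exact: cphi|exact: cTh].
Qed.

Lemma energy_rate_cont x (t : R) : Om x -> 0 < t ->
  continuous_at (x, t) (fun p => energy_rate p.1 p.2).
Proof.
move=> Ox t0.
have ck i j : continuous_at (x, t) (fun p : 'rV[R]_3 * R => kap p.1 i j).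
  apply: (cont_comp (f := fst) (g := fun y => kap y i j)); first exact: cont_fst.
  exact: ckap.
have c1 : continuous_at (x, t) (fun p : 'rV[R]_3 * R => a p.1).
  by apply: (cont_comp (f := fst) (g := a)); [exact: cont_fst|exact: ca].
apply: contD; first apply: contB.
- apply: contN; apply: cont_sum => i; apply: contD; apply: contM;
    do ?[exact: cphi|exact: cdq|exact: cgphi|exact: cq].
- apply: contZ; apply: (@cont_bil _ _ _ (fun p : 'rV[R]_3 * R => kap p.1)) => // i; exact: cq.
- apply: contM; first by apply: contM => //; exact: cont_cst.
  by apply: contB; apply: contM; do ?[exact: cphi|exact: cTh].
Qed.

Context (D : set 'rV[R]_2) (L t1 : R) (I : Type) (W : I -> 'I_2 -> 'rV[R]_2 -> R)
  (C : R).
Hypothesis hD : bounded_regular_domain D.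
Hypothesis L0 : 0 < L.
Hypothesis t10 : 0 < t1.
Hypothesis OmE : forall x, Om x <-> D (base x) /\ 0 < x ord0 ord_max < L.
Hypothesis e_init : forall x, Om x -> energy x 0 = 0.
Hypothesis WE : forall x (t : R), Om x -> 0 <= t <= t1 -> exists s, forall i,
  W s i (base x) = phi x t * q (lift ord_max i) x t.

Section weighted_energy.
Context (chi : 'rV[R]_2 -> R) (dchi : 'I_2 -> 'rV[R]_2 -> R) (m : 'rV[R]_2 -> R)
  (M eps d0 w : R).
Hypothesis cut : cutoff D W chi dchi m.
Hypothesis chi_out : forall y, ~ D y -> \forall x \near y, chi x = 0.
Hypothesis eps0 : 0 < eps.
Hypothesis d00 : 0 < d0.
Hypothesis MD : forall y, closure D y -> `|y| + 1 <= M.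
Hypothesis ML : L + 1 <= M.
Hypothesis w0 : 0 <= w.
Hypothesis top : forall x (t : R), Om x -> L - 2 * eps < x ord0 ord_max ->
  0 <= t <= t1 -> `|phi x t * q ord_max x t| <= w.

Let wt := weight L eps c d0 chi.
Let chi1 : C1 chi dchi. Proof. by case: cut. Qed.
Let M0 : 0 < M. Proof. by move: L0 ML; lra. Qed.

Let we (t : R) (x : 'rV[R]_3) : R := wt x t * energy x t.
Let we_dt (t : R) (x : 'rV[R]_3) : R :=
  wt x t * energy_rate x t + energy x t * weight_dt L eps c d0 chi x t.

Let near0 x (t : R) : ~ Om x -> 0 < c * t + d0 ->
  \forall p \near (t, x), wt p.2 p.1 = 0 /\ weight_dt L eps c d0 chi p.2 p.1 = 0.
Proof.
by move=> nO ct; apply: (weight_near0 eps0 chi_out ct); rewrite -OmE.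
Qed.

Let we_cont x (t : R) : 0 < c * t + d0 -> continuous_at (t, x) (fun p => we p.1 p.2).
Proof.
move=> ct; have [Ox|nO] := pselect (Om x).
  apply: contM; first exact: (weight_cont eps0 chi1).
  by apply: cont_swap; exact: energy_cont.
apply: (@cont_near _ _ _ (fun=> 0)); last exact: cont_cst.
by apply: (near_imp (near0 nO ct)) => p [h _]; rewrite /we h mul0r.
Qed.

Let pos_time (t : R) : 0 <= t -> 0 < c * t + d0.
Proof. by move=> t0; rewrite ltr_wpDl// mulr_ge0// ltW. Qed.

Let we_dt_cont x (t : R) : 0 < t -> continuous_at (t, x) (fun p => we_dt p.1 p.2).
Proof.
move=> t0; have ct := pos_time (ltW t0); have [Ox|nO] := pselect (Om x).
  apply: contD; apply: contM.
  - exact: (weight_cont eps0 chi1).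
  - by apply: cont_swap; exact: energy_rate_cont.
  - by apply: cont_swap; exact: energy_cont.
  - exact: (weight_dt_cont eps0 chi1).
apply: (@cont_near _ _ _ (fun=> 0)); last exact: cont_cst.
by apply: (near_imp (near0 nO ct)) => p [h1 h2]; rewrite /we_dt h1 h2 mul0r mulr0 addr0.
Qed.

Let we_der x (t : R) : 0 < t -> der t 1 (we^~ x) (we_dt t x).
Proof.
move=> t0; have ct := pos_time (ltW t0); have [Ox|nO] := pselect (Om x).
  apply: derM; first exact: der_weight.
  exact: energy_der.
have [h1 h2] := nbhs_singleton (near0 nO ct).
have -> : we_dt t x = 0 by rewrite /we_dt h1 h2 mul0r mulr0 addr0.
apply: (@der_near _ _ _ _ (fun=> 0)); last exact: der_cst.
have h := near0 nO ct.
have cs : continuous_at t (fun s : R => (s, x)).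
  by apply: cont_pair; [exact: cont_id|exact: cont_cst].
by apply: (near_imp (cs _ h)) => s [/= h3 _]; rewrite /we h3 mul0r.
Qed.

Let flux (i : 'I_3) (t : R) (x : 'rV[R]_3) := wt x t * (phi x t * q i x t).
Let dflux (i : 'I_3) (t : R) (x : 'rV[R]_3) :=
  wt x t * (phi x t * dq i i x t + q i x t * gphi i x t) +
  weight_dx L eps c d0 chi dchi t i x * (phi x t * q i x t).

Let flux_C1 i (t : R) : 0 < t ->
  C1 (flux i t) (fun j x => wt x t * (phi x t * dq i j x t + q i x t * gphi j x t) +
     weight_dx L eps c d0 chi dchi t j x * (phi x t * q i x t)).
Proof.
move=> t0; have ct := pos_time (ltW t0).
have sl (f : 'rV[R]_3 -> R -> R) x : continuous_at (x, t) (fun p => f p.1 p.2) ->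
  continuous_at x (f^~ t) by exact: jcont_slice2.
apply: (C1_glue (O := Om) (C1_weight L c d0 eps0 chi1 t)).
- by move=> x Ox; apply: contM; apply: sl; [exact: cphi|exact: cq].
- move=> j x Ox; apply: contD; apply: contM; apply: sl;
    do ?[exact: cphi|exact: cq|exact: cdq|exact: cgphi].
- by move=> j x Ox; apply: derM; [exact: dphix|exact: dqx].
- move=> x nO; have h := near0 nO ct.
  have cs : continuous_at x (fun y : 'rV[R]_3 => (t, y)).
    by apply: cont_pair; [exact: cont_cst|exact: cont_id].
  by apply: (near_imp (cs _ h)) => y [].
Qed.

Let flux_free i (t : R) : 0 < t -> bint M (dflux i t) = 0.
Proof.
move=> t0; have [cf cdf ff] := flux_C1 i t0.
apply: (@bint_partial R M 3 i (flux i t) (dflux i t) M0 cf (cdf i) (ff i)).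
move=> x xM; suff nO : ~ Om x.
  have [h _] := nbhs_singleton (near0 nO (pos_time (ltW t0))).
  by rewrite /flux h mul0r.
move=> /OmE[Dx /andP[x0 xL]]; move: xM; have [j ->|->] := unliftP ord_max i.
  rewrite -baseE => xM; have := rv_coord_le (base x) j; rewrite xM.
  by have := MD (subset_closure Dx); lra.
by rewrite gtr0_norm//; move: ML; lra.
Qed.

(** Majorant of the flux through the two cutoffs; the factor L ^+ 2 bounds the
    front. *)
Definition leak (x : 'rV[R]_3) : R :=
  L ^+ 2 * (m (base x) + w * dlid L eps (x ord0 ord_max)).

Lemma dlid_ge0 z : 0 <= dlid L eps z.
Proof.
by apply: divr_ge0; [case/andP: (dsmoothstep_itv ((L - z) / eps - 1))|exact: ltW].
Qed.

Let cm : continuous m. Proof. by case: cut. Qed.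
Let m_ge0 y : 0 <= m y. Proof. by case: cut. Qed.

Let leak_cont : continuous leak.
Proof.
move=> x; apply: contZ; apply: contD.
  by apply: (cont_comp (f := @base R) (g := m)); [exact: base_cont|exact: cm].
apply: contZ; apply: (cont_comp (f := fun x : 'rV[R]_3 => x ord0 ord_max) (g := dlid L eps)).
  exact: cont_coord.
exact: dlid_cont.
Qed.

Lemma leak_ge0 x : 0 <= leak x.
Proof.
apply: mulr_ge0; first exact: sqr_ge0.
by apply: addr_ge0; [exact: m_ge0|apply: mulr_ge0; [exact: w0|exact: dlid_ge0]].
Qed.

(** The moving front contributes - c times its slope times the energy, which
    absorbs the flux through the front; the flux through the cutoffs is bounded by
    the leak. *)
Let balance_le x (t : R) : 0 < t <= t1 ->
  we_dt t x + \sum_i dflux i t x <= 2 / tauT * we t x + leak x.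
Proof.
move=> /andP[t0 tt1]; have ct := pos_time (ltW t0).
have [Ox|nO] := pselect (Om x); last first.
  have [h1 h2] := nbhs_singleton (near0 nO ct).
  rewrite big1 => [|i _]; last first.
    have [cf cdf ff] := C1_weight L c d0 eps0 chi1 t.
    have cs : continuous_at x (fun y : 'rV[R]_3 => (t, y)).
      by apply: cont_pair; [exact: cont_cst|exact: cont_id].
    have n0 : \forall y \near x, wt y t = 0.
      by apply: (near_imp (cs _ (near0 nO ct))) => y [].
    have := nbhs_singleton (C1_near0 i (C1_weight L c d0 eps0 chi1 t) n0).
    by rewrite /dflux h1 => ->; rewrite !mul0r addr0.
  by rewrite /we_dt /we h1 h2 !mul0r !mulr0 !addr0 add0r leak_ge0.
have tI : 0 <= t <= t1 by rewrite ltW.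
have [_ chiI _ _ mW] := cut.
have [Dx /andP[x0 xL]] := (OmE x).1 Ox.
pose A := clip L eps chi x; pose g := front c d0 x t; pose g' := dfront c d0 x t.
pose l := lid L eps (x ord0 ord_max); pose l' := dlid L eps (x ord0 ord_max).
pose y := base x.
have /andP[ch0 ch1] := chiI y.
have /andP[l0 l1] : 0 <= l <= 1 by exact: smoothstep_itv.
have l'0 : 0 <= l' by exact: dlid_ge0.
have A0 : 0 <= A by rewrite mulr_ge0.
have g0 : 0 <= g by exact: sqr_ge0.
have g'0 : 0 <= g' by rewrite mulr_ge0// le_max lexx orbT.
have gL : g <= L ^+ 2.
  have s1 : x ord0 ord_max - d0 - c * t <= L.
    have : 0 <= c * t by rewrite mulr_ge0// ltW.
    by move: xL d00; lra.
  have sL : Num.max (x ord0 ord_max - d0 - c * t) 0 <= L by rewrite ge_max s1 ltW.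
  have s0 : 0 <= Num.max (x ord0 ord_max - d0 - c * t) 0 by rewrite le_max lexx orbT.
  by rewrite /g /front /pos2 ler_sqr// nnegrE ltW.
have [s hs] := WE Ox tI.
(* The first sum cancels against that of energy_rate_le, and the last term is
   absorbed by the moving front; the two others are the cost of the cutoffs. *)
have E1 : \sum_i dflux i t x = A * g * (\sum_i (phi x t * dq i i x t + gphi i x t * q i x t))
   + (g * l * \sum_i W s i y * dchi i y
      - g * chi y * l' * (phi x t * q ord_max x t)
      + A * g' * (phi x t * q ord_max x t)).
  rewrite /dflux big_split /=; congr (_ + _).
    rewrite mulr_sumr; apply: eq_bigr => i _; rewrite /wt /weight -/A -/g; ring.
  rewrite big_ord_recr /= /weight_dx /dclip unlift_none eqxx -/A -/g -/g' -/l -/l' -/y.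
  rewrite mul0r addr0 !mulr1.
  have -> : \sum_(i < 2) (clip L eps chi x * (dfront c d0 x t * (widen_ord (leqnSn 2) i == ord_max)%:R) +
     (chi (base x) * (- dlid L eps (x ord0 ord_max) * (widen_ord (leqnSn 2) i == ord_max)%:R) +
      match unlift ord_max (widen_ord (leqnSn 2) i) with
      | Some j => dchi j (base x) | None => 0 end * lid L eps (x ord0 ord_max)) * front c d0 x t) *
     (phi x t * q (widen_ord (leqnSn 2) i) x t) = g * l * \sum_i W s i y * dchi i y.
    rewrite mulr_sumr; apply: eq_bigr => i _.
    have -> : widen_ord (leqnSn 2) i = lift ord_max i.
      by apply: val_inj; rewrite /= /fintype.bump leqNgt ltn_ord add0n.
    rewrite liftK eq_sym (negPf (neq_lift _ _)) hs /= -/g -/l -/y; ring.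
  ring.
have e0 := energy_ge0 t Ox.
have h1 : A * g * (energy_rate x t + \sum_i (phi x t * dq i i x t + gphi i x t * q i x t))
   <= A * g * (2 / tauT * energy x t).
  by apply: ler_wpM2l; [rewrite mulr_ge0|exact: energy_rate_le].
have h2 : A * g' * (phi x t * q ord_max x t) <= A * g' * (c * energy x t).
  by apply: ler_wpM2l; [rewrite mulr_ge0|exact: energy_flux_le].
have h3 : g * l * (\sum_i W s i y * dchi i y) <= L ^+ 2 * m y.
  apply: (le_trans (ler_norm _)); rewrite normrM (ger0_norm (mulr_ge0 g0 l0)).
  apply: ler_pM => //; first by rewrite mulr_ge0.
    by rewrite -[leRHS]mulr1; apply: ler_pM.
  exact: mW.
have h4 : - (g * chi y * l' * (phi x t * q ord_max x t)) <= L ^+ 2 * (w * l').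
  rewrite -mulrN; have [z1|z1] := leP (x ord0 ord_max) (L - 2 * eps).
    have -> : l' = 0.
      rewrite /l' /dlid dsmoothstep_ge1 ?mul0r// lerBrDr ler_pdivlMr//.
      by move: z1; lra.
    by rewrite !(mulr0, mul0r).
  have -> : g * chi y * l' * - (phi x t * q ord_max x t) =
     (g * chi y) * (- (phi x t * q ord_max x t) * l') by ring.
  have h5 : - (phi x t * q ord_max x t) * l' <= w * l'.
    apply: ler_wpM2r => //; apply: le_trans (top Ox z1 tI).
    by rewrite -normrN ler_norm.
  apply: (@le_trans _ _ (g * chi y * (w * l'))).
    by apply: ler_wpM2l => //; rewrite mulr_ge0.
  apply: ler_wpM2r; first by rewrite mulr_ge0.
  by rewrite -[leRHS]mulr1; apply: ler_pM.
rewrite E1 /we_dt /we /leak /wt /weight /weight_dt -/A -/g -/g' -/l' -/y.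
move: h1 h2 h3 h4; lra.
Qed.

(** Adding the integrals of dflux, which are zero, to the derivative of the
    weighted energy makes balance_le applicable. *)
Lemma weighted_energy_le :
  bint M (we t1) <= bint M leak * t1 * expR (2 / tauT * t1).
Proof.
have T0 : 0 <= 2 / tauT by apply: divr_ge0 => //; exact: ltW.
have oJ : open [set t : R | 0 < c * t + d0].
  apply: (@open_comp _ _ (fun t => c * t + d0) [set s | 0 < s]); last exact: open_gt.
  move=> t _; apply: contD; last exact: cont_cst.
  by apply: contZ; exact: cont_id.
have oP : open [set t : R | 0 < t] by exact: open_gt.
have cwe (t : R) : 0 < c * t + d0 -> continuous (we t).
  by move=> ct x; exact: (@jcont_slice _ _ _ we t x (we_cont ct)).
have cwd (t : R) : 0 < t -> continuous (we_dt t).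
  by move=> t0 x; exact: (@jcont_slice _ _ _ we_dt t x (we_dt_cont t0)).
apply: (@gronwall R (fun t => bint M (we t)) (fun t => bint M (we_dt t))) => //.
- have z0 : bint M (fun _ : 'rV[R]_3 => 0) = 0 :> R by rewrite bint_cst// mulr0.
  rewrite -z0; apply: le_bint => //; last exact: leak_ge0.
  by move=> x; exact: cont_cst.
- move=> t /andP[t0 _]; apply: (@bint_cont R M 3 R [set t : R | 0 < c * t + d0] we) => //.
    exact: pos_time.
  by move=> s v; exact: we_cont.
- move=> t /andP[t0 _].
  have h1 (s : R) v : [set t : R | 0 < t] s -> continuous_at (s, v) (fun p => we p.1 p.2).
    by move=> /= s0; apply: we_cont; apply: pos_time; exact: ltW.
  have h2 (s : R) v : [set t : R | 0 < t] s -> continuous_at (s, v) (fun p => we_dt p.1 p.2).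
    exact: we_dt_cont.
  have h3 (s : R) v : [set t : R | 0 < t] s -> is_derive s 1 (we^~ v) (we_dt s v).
    exact: we_der.
  exact: (@bint_derive R M 3 _ we we_dt t M0 oP t0 h1 h2 h3).
- move=> t /andP[t0 tt1].
  have cF i : continuous (dflux i t) by have [_ cdf _] := flux_C1 i t0; exact: cdf.
  have cS : continuous (fun x => \sum_i dflux i t x) by move=> x; apply: cont_sum => i; exact: cF.
  have cw := cwe t (pos_time (ltW t0)).
  have -> : bint M (we_dt t) = bint M (fun x => we_dt t x + \sum_i dflux i t x).
    rewrite (bintD M0 (cwd t t0) cS).
    suff -> : bint M (fun x => \sum_i dflux i t x) = 0 by rewrite addr0.
    have -> : (fun x => \sum_i dflux i t x) =
        (fun x => dflux ord0 t x + (dflux (lift ord0 ord0) t x + dflux (lift ord0 (lift ord0 ord0)) t x)).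
      by apply/funext => x; rewrite !big_ord_recl big_ord0 addr0.
    have zi i : bint M (fun x => dflux i t x) = 0 by exact: flux_free.
    have c2 : continuous (fun x => dflux (lift ord0 ord0) t x +
        dflux (lift ord0 (lift ord0 ord0)) t x) by move=> x; apply: contD; exact: cF.
    rewrite (bintD M0 (cF _) c2) (bintD M0 (cF _) (cF _)).
    by rewrite !zi !addr0.
  have cK : continuous (fun x => 2 / tauT * we t x) by move=> x; apply: contZ; exact: cw.
  rewrite -(bintZ (2 / tauT) M0 cw) -(bintD M0 cK leak_cont).
  have c1 : continuous (fun x => we_dt t x + \sum_i dflux i t x).
    by move=> x; apply: contD; [exact: cwd|exact: cS].
  have c2 : continuous (fun x => 2 / tauT * we t x + leak x).
    by move=> x; apply: contD; [exact: cK|exact: leak_cont].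
  apply: (le_bint M0 c1 c2) => x.
  by apply: balance_le; rewrite t0 ltW.
- have z0 : bint M (fun _ : 'rV[R]_3 => 0) = 0 :> R by rewrite bint_cst// mulr0.
  rewrite -[RHS]z0; congr (bint M _); apply/funext => x; rewrite /we.
  have [Ox|nO] := pselect (Om x); first by rewrite e_init// mulr0.
  by have [h _] := nbhs_singleton (near0 nO (pos_time (lexx 0))); rewrite h mul0r.
Qed.

Lemma bint_leak_le : bint M leak <= L ^+ 2 * (2 * M * bint M m + w * (2 * M) ^+ 2).
Proof.
have c1 : continuous (fun x : 'rV[R]_3 => m (base x)).
  by move=> x; apply: (cont_comp (f := @base R) (g := m)); [exact: base_cont|exact: cm].
have c2 : continuous (fun x : 'rV[R]_3 => dlid L eps (x ord0 ord_max)).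
  move=> x; apply: (cont_comp (f := fun x : 'rV[R]_3 => x ord0 ord_max) (g := dlid L eps)).
    exact: cont_coord.
  exact: dlid_cont.
have c3 : continuous (fun x : 'rV[R]_3 => w * dlid L eps (x ord0 ord_max)).
  by move=> x; apply: contZ; exact: c2.
have MM : - M < M by move: M0; lra.
have c4 : continuous (fun x : 'rV[R]_3 => m (base x) + w * dlid L eps (x ord0 ord_max)).
  by move=> x; apply: contD; [exact: c1|exact: c3].
rewrite /leak (bintZ _ M0 c4) (bintD M0 c1 c3) (bintZ _ M0 c2); apply: ler_wpM2l; first exact: sqr_ge0.
apply: lerD.
  have -> : bint M (fun x : 'rV[R]_3 => m (base x)) = int1 (- M) M (fun=> bint M m).
    rewrite bintS; apply: eq_int1 => s _.
    by congr (bint M _); apply/funext => v; rewrite base_rcons.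
  rewrite int1_cst; last exact: ltW.
  by rewrite opprK mulr_natl mulr2n.
apply: ler_wpM2l => //.
have -> : bint M (fun x : 'rV[R]_3 => dlid L eps (x ord0 ord_max)) =
    int1 (- M) M (fun s => (2 * M) ^+ 2 * dlid L eps s).
  rewrite bintS; apply: eq_int1 => s _.
  rewrite -(bint_cst 2 _ M0); congr (bint M _).
  by apply/funext => v; rewrite rcons_rv_max.
have cd : continuous (dlid L eps) by exact: dlid_cont.
rewrite int1Z//.
have /andP[l0 l1] : 0 <= lid L eps M <= 1 by exact: smoothstep_itv.
have /andP[l0' l1'] : 0 <= lid L eps (- M) <= 1 by exact: smoothstep_itv.
have -> : int1 (- M) M (dlid L eps) = - lid L eps M - - lid L eps (- M).
  have dF (s : R) : - M <= s <= M -> is_derive s 1 (fun s => - lid L eps s) (dlid L eps s).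
    move=> _; have h := derZ (-1) (der_lid L eps0 s).
    have -> : (fun s => - lid L eps s) = (fun s => -1 * lid L eps s).
      by apply/funext => z; rewrite mulN1r.
    by rewrite -[dlid L eps s]mul1r -mulrNN.
  exact: (int1_ftc MM cd dF).
rewrite -[leRHS]mulr1; apply: ler_wpM2l; first exact: sqr_ge0.
by lra.
Qed.

Lemma weighted_energy_bound (F : 'rV[R]_3 -> R) : continuous F ->
  (forall x, F x <= weight L eps c d0 chi x t1 * energy x t1) ->
  bint M F <= L ^+ 2 * (2 * M * bint M m + w * (2 * M) ^+ 2) * t1 * expR (2 / tauT * t1).
Proof.
move=> cF hF; have h1 : bint M F <= bint M (we t1).
  apply: (le_bint M0 cF _ hF) => x.
  exact: (@jcont_slice _ _ _ we t1 x (we_cont (pos_time (ltW t10)))).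
apply: (le_trans h1); apply: (le_trans weighted_energy_le).
by rewrite !ler_pM2r ?expR_gt0//; exact: bint_leak_le.
Qed.
End weighted_energy.

Hypothesis W_le : forall s i y, D y -> `|W s i y| <= C.
Hypothesis W_small : forall y psi, boundary D y -> C1_defining D y psi ->
  forall w : R, 0 < w -> \forall x \near y, D x -> forall s,
    `|\sum_i W s i x * 'D_(delta_mx ord0 i) psi x| <= w.
Hypothesis top_flux : forall w : R, 0 < w -> exists2 eps : R, 0 < eps &
  forall x (t : R), Om x -> L - eps < x ord0 ord_max ->
  0 <= t <= t1 -> `|phi x t * q ord_max x t| <= w.

(** If the energy were positive at x0, a fixed bump F around x0, dominated by
    the weighted energy, would have a positive integral J.  The cutoffs can be
    chosen so close to the boundary that the leak forces J <= J / 2. *)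
Lemma energy_vanishes x0 : Om x0 -> c * t1 < x0 ord0 ord_max -> energy x0 t1 = 0.
Proof.
move=> Ox0 ahead; have [Dx0 /andP[z0 zL]] := (OmE x0).1 Ox0.
set z := x0 ord0 ord_max in z0 zL ahead.
(* x0 stays ahead of the front after the margin d0 is taken. *)
pose d0 := (z - c * t1) / 2; have d00 : 0 < d0 by rewrite divr_gt0//; lra.
have [oD _ _ bD _] := hD.
have [rho2 rho20 hrho] := (near_dist _ _).1 (near_open oD Dx0).
pose rho := rho2 / 2; have rho0 : 0 < rho by rewrite divr_gt0.
have [M1 hM1] : exists M1 : R, forall y, closure D y -> `|y| + 1 <= M1.
  have [C0 [_ hC0]] := bD; exists (C0 + 3) => y cy.
  have [y' Dy' yy'] := (closure_distP _ _).1 cy 1 ltr01.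
  have := hC0 (C0 + 1) _ y' Dy'; rewrite ltrDl ltr01 => /(_ isT) /= yC.
  have := ler_normD (y - y') y'; rewrite subrK; move: yy'; rewrite distrC; lra.
pose M := Num.max M1 (L + 1).
have MD y : closure D y -> `|y| + 1 <= M.
  by move=> cy; rewrite le_max hM1.
have ML : L + 1 <= M by rewrite le_max lexx orbT.
have M0 : 0 < M by move: L0 ML; lra.
pose r0 := Num.min rho (Num.min z ((L - z) / 2)).
have r00 : 0 < r0 by rewrite !lt_min rho0 z0 divr_gt0// subr_gt0.
have [r0rho [r0z r0L]] : r0 <= rho /\ r0 <= z /\ r0 <= (L - z) / 2.
  by rewrite /r0 !ge_min !lexx !orbT.
pose r := r0 / 3; have r_gt0 : 0 < r by rewrite divr_gt0.
have r2 : 2 * r < r0 by rewrite /r; lra.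
have nearx x : `|x - x0| <= 2 * r -> [/\ Om x, `|base x - base x0| < rho
    & (L - z) / 2 < L - x ord0 ord_max].
  move=> xx; have bx : `|base x - base x0| < rho.
    apply: (@le_lt_trans _ _ (2 * r)); last lra.
    apply: rv_norm_le; first lra.
    move=> i; rewrite mxE [X in _ + X]mxE !baseE; apply: le_trans xx.
    by have := rv_coord_le (x - x0) (lift ord_max i); rewrite mxE [X in _ + X]mxE.
  have := rv_coord_le (x - x0) ord_max; rewrite mxE [X in _ + X]mxE -/z => h3.
  have /andP[h4 h5] : - (2 * r) <= x ord0 ord_max - z <= 2 * r.
    by rewrite -ler_norml; apply: le_trans xx.
  split => //; last lra.
  apply/OmE; split; last by apply/andP; split; lra.
  by apply: hrho; move: bx; rewrite /rho; lra.
have bump0 x : 2 * r < `|x - x0| -> ball_bump x0 r x = 0.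
  move=> h; apply: ball_bump_out => //.
  have r20 : 0 <= 2 * r by lra.
  have := sqdist_far r20 h; have := sqr_ge0 r.
  by rewrite (_ : (2 * r) ^+ 2 = 4 * r ^+ 2); [lra|ring].
apply/eqP; rewrite eq_le energy_ge0// andbT leNgt; apply/negP => e0.
pose F x := ball_bump x0 r x * (front c d0 x t1 * energy x t1).
have cF : continuous F.
  have [cb _ _] := C1_ball_bump x0 r.
  apply: (@cont_glue _ _ Om) => [x _|x Ox|x nO]; first exact: cb.
    apply: contM; last first.
      exact: (@jcont_slice2 _ _ _ energy x t1 (energy_cont Ox)).
    apply: (cont_comp (f := fun x : 'rV[R]_3 => x ord0 ord_max - d0 - c * t1) (g := @pos2 R)).
      apply: contB; last exact: cont_cst.
      by apply: contB; [exact: cont_coord|exact: cont_cst].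
    by apply: contM; apply: (@cont_max0 R).
  have xx : 2 * r < `|x - x0| by rewrite ltNge; apply/negP => /nearx[].
  by apply: (near_imp (near_dist_gt xx)) => y; exact: bump0.
have F0 x : 0 <= F x.
  have [/nearx[Ox _ _]|/bump0 h] := leP `|x - x0| (2 * r); last by rewrite /F h mul0r.
  have /andP[b0 _] := ball_bump_itv x0 r x.
  by apply: mulr_ge0 => //; apply: mulr_ge0; [exact: sqr_ge0|exact: energy_ge0].
have Fx0 : 0 < F x0.
  rewrite /F ball_bump_in//; last first.
    by rewrite /sqdist big1 ?sqr_ge0// => i _; rewrite subrr expr0n.
  rewrite mul1r mulr_gt0// /front /pos2 -/z exprn_gt0// lt_max.
  by rewrite /d0; apply/orP; left; lra.
have x0M i : `|x0 ord0 i| < M.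
  have [j ->|->] := unliftP ord_max i.
    rewrite -baseE; have := rv_coord_le (base x0) j.
    by have := MD _ (subset_closure Dx0); lra.
  by rewrite gtr0_norm//; move: ML zL; rewrite -/z; lra.
have I0 := bint_gt0 M0 cF F0 x0M Fx0.
set J := bint M F in I0.
pose eX := t1 * expR (2 / tauT * t1).
have eX0 : 0 < eX by rewrite mulr_gt0// expR_gt0.
have L20 : 0 < L ^+ 2 by rewrite exprn_gt0.
(* The leak at the sides (del) and at the top (w) each amount to J / 4 in the
   final bound. *)
pose w := J / (4 * L ^+ 2 * (2 * M) ^+ 2 * eX).
have M20 : 0 < (2 * M) ^+ 2 by rewrite exprn_gt0// mulr_gt0.
have L40 : 0 < 4 * L ^+ 2 by rewrite mulr_gt0.
have M21 : 0 < 2 * M by rewrite mulr_gt0.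
have w0 : 0 < w.
  by apply: divr_gt0 => //; apply: mulr_gt0 => //; exact: mulr_gt0.
pose del := J / (4 * L ^+ 2 * (2 * M) * eX).
have del0 : 0 < del.
  by apply: divr_gt0 => //; apply: mulr_gt0 => //; exact: mulr_gt0.
have [eps1 eps10 htop] := top_flux w0.
pose eps := Num.min (eps1 / 2) ((L - z) / 4).
have eps0 : 0 < eps by rewrite lt_min !divr_gt0// subr_gt0.
have [ee1 ee2] : eps <= eps1 / 2 /\ eps <= (L - z) / 4.
  by rewrite /eps !ge_min !lexx !orbT.
have ballD y : `|y - base x0| < 2 * rho -> D y.
  by move=> h; apply: hrho; apply: lt_le_trans h _; rewrite /rho; lra.
have [chi [dchi [m [cut mdel chi_in chi_out]]]] :=
  planar_cutoff hD rho0 del0 MD ballD W_le W_small.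
have tops x (t : R) : Om x -> L - 2 * eps < x ord0 ord_max -> 0 <= t <= t1 ->
    `|phi x t * q ord_max x t| <= w.
  by move=> Ox xL tI; apply: htop => //; lra.
have Fle x : F x <= weight L eps c d0 chi x t1 * energy x t1.
  have [/nearx[Ox bx xL]|/bump0 h] := leP `|x - x0| (2 * r).
    have /andP[_ b1] := ball_bump_itv x0 r x.
    rewrite /weight /clip chi_in// mul1r /lid smoothstep_ge1; last first.
      by rewrite lerBrDr ler_pdivlMr//; lra.
    rewrite mul1r /F -[leRHS]mul1r; apply: ler_wpM2r => //.
    by apply: mulr_ge0; [exact: sqr_ge0|exact: energy_ge0].
  rewrite /F h mul0r.
  have [Ox|nO] := pselect (Om x); last first.
    have ct : 0 < c * t1 + d0 by rewrite ltr_wpDl// mulr_ge0// ltW.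
    have nO' : ~ (D (base x) /\ 0 < x ord0 ord_max < L) by rewrite -OmE.
    by have [-> _] := nbhs_singleton (weight_near0 eps0 chi_out ct nO'); rewrite mul0r.
  have [_ /(_ (base x))/andP[ch0 _] _ _ _] := cut.
  have /andP[l0 _] : 0 <= lid L eps (x ord0 ord_max) <= 1 by exact: smoothstep_itv.
  by apply: mulr_ge0; [apply: mulr_ge0; [exact: mulr_ge0|exact: sqr_ge0]|exact: energy_ge0].
have := weighted_energy_bound cut chi_out eps0 d00 MD ML (ltW w0) tops cF Fle.
rewrite -/J -mulrA -/eX => hJ.
have : L ^+ 2 * (2 * M * bint M m + w * (2 * M) ^+ 2) * eX <=
  L ^+ 2 * (2 * M * del + w * (2 * M) ^+ 2) * eX.
  rewrite ler_pM2r// ler_pM2l// lerD2r ler_pM2l//; lra.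
have -> : L ^+ 2 * (2 * M * del + w * (2 * M) ^+ 2) * eX = J / 2.
  by rewrite /del /w; field; rewrite ?gt_eqF.
move: hJ I0; lra.
Qed.
End energy_density.

(** * Propagation at finite speed *)

Lemma closed_vanish (R : realType) (B : set 'rV[R]_3) (f : 'rV[R]_3 -> R -> R) x (t z : R) :
  cont_closed B f -> closure B x -> 0 <= t -> z < x ord0 ord_max ->
  (forall y, B y -> z < y ord0 ord_max -> f y t = 0) -> f x t = 0.
Proof.
move=> /within_contP cf cx t0 zx f0.
apply/eqP; rewrite -normr_eq0 eq_le normr_ge0 andbT; apply/ler_addgt0Pl => e e0.
have [r r_gt0 hr] := @near_dist2 R _ (fun y s => (closure B `*` [set t | 0 <= t]) (y, s) ->
     `|f y s - f x t| < e) x t (cf (x, t) (conj cx t0) _ e0).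
have m0 : 0 < Num.min r (x ord0 ord_max - z) by rewrite lt_min r_gt0 subr_gt0.
have [y By] := (closure_distP _ _).1 cx _ m0; rewrite lt_min => /andP[yr yz].
have tt : `|t - t| < r by rewrite subrr normr0.
have := hr y t yr tt (conj (subset_closure By) t0).
rewrite f0 ?sub0r ?normrN//; first by move=> /ltW; rewrite addr0.
have := le_lt_trans (rv_coord_le (y - x) ord_max) yz.
by rewrite mxE [X in _ + X]mxE ltr_norml; lra.
Qed.

Lemma interior_cont (R : realType) (X : topologicalType) (B : set X) (f : X -> R) x :
  open B -> {within closure B, continuous f} -> B x -> continuous_at x f.
Proof.
move=> oB /within_contP cf Bx; apply/cont_distP => e e0.
apply: (near_imp (near_and (near_open oB Bx) (cf x (subset_closure Bx) e e0))) => y [By h].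
exact: h (subset_closure By).
Qed.

(** The energy argument applies to the part x_3 > 0 of the open cylinder; the
    fields vanish at the other points of the closure by continuity. *)
Lemma propagation (R : realType) (D : set 'rV[R]_2) (h L : R) (tauq tauT c kM am : R)
    (a : 'rV[R]_3 -> R) (k : 'rV[R]_3 -> 'M[R]_3) :
  bounded_regular_domain D -> 0 < h -> 0 < L ->
  {within closure (cylinder D h L), continuous a} ->
  {within closure (cylinder D h L), continuous k} ->
  (forall x, closure (cylinder D h L) x -> (k x)^T = k x) ->
  (forall x, closure (cylinder D h L) x -> positive_definite (k x)) ->
  0 < tauq -> 0 < tauT -> 0 < c -> 0 < am -> 0 <= kM ->
  (forall x, closure (cylinder D h L) x -> am <= a x) ->
  (forall x v, closure (cylinder D h L) x -> bil (k x) v v <= kM * \sum_i v i ^+ 2) ->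
  2 * tauT * kM <= c ^+ 2 * tauq ^+ 2 * am ->
  propagation_bound (cylinder D h L) tauq tauT a k c.
Proof.
move=> hD h0 L0 ca ck ksym kpos tq0 tT0 c0 am0 kM0 ham hkM speed rho S1 S2 d T q _ split supp sol.
set B := cylinder D h L in ca ck ksym kpos ham hkM split supp sol *.
have oD : open D by case: hD.
have oB : open B := open_cylinder oD.
pose Om := upper B.
have oOm : open Om := open_upper oB.
have OB x : Om x -> B x by case.
have OC x : Om x -> closure B x by move=> [/subset_closure].
have OmE x : Om x <-> D (base x) /\ 0 < x ord0 ord_max < L.
  rewrite /Om /upper /B /cylinder /= -/(base x); split.
    by move=> [[Dx /andP[_ ->]] ->].
  move=> [Dx /andP[x0 xL]]; split => //; split => //.
  by rewrite xL andbT; move: h0; lra.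
have kposdef x : Om x -> forall v : 'rV[R]_3, v != 0 -> 0 < bil (k x) (v ord0) (v ord0).
  by move=> Ox; exact: kpos (OC x Ox).
have inv x (Ox : Om x) := inv_posdef (ksym x (OC x Ox)) (kposdef x Ox) (fun v => hkM x v (OC x Ox)).
have a0 x : Om x -> 0 < a x by move=> /OC /ham; exact: lt_le_trans.
have [P [cP dP law]] := integrated_law oB supp sol.
have [cT _ _] := sol_T_closed sol.
have cq i : cont_closed B (q i) by have [/(_ i)[]] := sol_q_closed sol.
have [Td _ _ _] := sol_T_C11 sol.
pose kap x := invmx (k x).
pose Th x (t : R) := prim (ext T x) t.
pose Q (i : 'I_3) x (t : R) := prim (ext (q i) x) t.
pose gphi (i : 'I_3) x (t : R) := prim (P i x) t + tauT * P i x t.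
have extE (f : 'rV[R]_3 -> R -> R) (t : R) : 0 <= t -> (ext f)^~ t = f^~ t.
  by move=> t0; apply/funext => y; rewrite ext_ge0.
have cTe x (t : R) : B x -> continuous_at (x, t) (fun p => ext T p.1 p.2).
  by move=> Bx; exact: (ext_cont oB cT Bx).
have cqe i x (t : R) : B x -> continuous_at (x, t) (fun p => ext (q i) p.1 p.2).
  by move=> Bx; exact: (ext_cont oB (cq i) Bx).
have cTx x : B x -> continuous (ext T x).
  by move=> Bx s; exact: jcont_slice (cTe x s Bx).
have cqx i x : B x -> continuous (ext (q i) x).
  by move=> Bx s; exact: jcont_slice (cqe i x s Bx).
have cTh x (t : R) : Om x -> continuous_at (x, t) (fun p => Th p.1 p.2).
  by move=> /OB Bx; exact: (prim_cont oB Bx cTe).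
have cphi x (t : R) : Om x -> continuous_at (x, t) (fun p => augmented_temp tauT T p.1 p.2).
  move=> Ox; apply: contD; first exact: cTh.
  by apply: contZ; apply: cTe; exact: OB.
have cQ i x (t : R) : Om x -> continuous_at (x, t) (fun p => Q i p.1 p.2).
  by move=> /OB Bx; exact: (prim_cont oB Bx (cqe i)).
have cgphi i x (t : R) : Om x -> 0 < t -> continuous_at (x, t) (fun p => gphi i p.1 p.2).
  move=> /OB Bx _; apply: contD; first exact: (prim_cont oB Bx (cP i)).
  by apply: contZ; exact: cP.
have cdq i j x (t : R) : Om x -> 0 < t -> continuous_at (x, t) (fun p => dx j (q i) p.1 p.2).
  by move=> /OB Bx t0; have [_ _ _ _ hj] := sol_q_C12 sol i; exact: hj.
have ckap x i j : Om x -> continuous_at x (fun y => kap y i j).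
  move=> Ox; apply: cont_invmx.
    move=> i' j'; apply: (interior_cont oB _ (OB x Ox)).
    exact: within_entry.
  by apply: (near_imp (near_open oOm Ox)) => y Oy; exact: posdef_unit (kposdef y Oy).
have dTh x (t : R) : Om x -> 0 < t -> der t 1 (Th x) (ext T x t).
  by move=> /OB Bx _; apply: der_prim; exact: cTx.
have dphi x (t : R) : Om x -> 0 < t -> der t 1 (augmented_temp tauT T x) (ext T x t + tauT * dt T x t).
  move=> Ox t0; apply: derD; first exact: dTh.
  by apply: derZ; apply: der_ext => //; have [] := Td x t (OB x Ox) t0.
have dQ i x (t : R) : Om x -> 0 < t -> der t 1 (Q i x) (ext (q i) x t).
  by move=> /OB Bx _; apply: der_prim; exact: cqx.
have dqt i x (t : R) : Om x -> 0 < t -> der t 1 (ext (q i) x) (dt (q i) x t).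
  move=> /OB Bx t0; apply: der_ext => //.
  by have [hd _ _ _ _] := sol_q_C12 sol i; have [] := hd x t Bx t0.
have dphix i x (t : R) : Om x -> 0 < t ->
    der x (delta_mx ord0 i) ((augmented_temp tauT T)^~ t) (gphi i x t).
  move=> Ox t0; apply: derD; last by apply: derZ; exact: dP.
  apply: (prim_der (U := Om) (f := ext T) (df := P i)) => //.
  - by move=> y s Oy; apply: cTe; exact: OB.
  - by move=> y s Oy; apply: cP; exact: OB.
  - by move=> y s Oy; exact: dP.
have dqx i j x (t : R) : Om x -> 0 < t ->
    der x (delta_mx ord0 j) ((ext (q i))^~ t) (dx j (q i) x t).
  move=> /OB Bx t0; rewrite (extE (q i) t (ltW t0)).
  have [hd _ _ _ _] := sol_q_C12 sol i; have [_ _ hj] := hd x t Bx t0.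
  by split; [exact: hj|].
have law_q i x (t : R) : Om x -> 0 < t ->
    Q i x t + tauq * ext (q i) x t + 2^-1 * tauq ^+ 2 * dt (q i) x t =
    - \sum_j k x i j * gphi j x t.
  by move=> Ox t0; rewrite ext_ge0 ?ltW//; exact: law.
have law_T x (t : R) : Om x -> 0 < t -> a x * dt T x t = - \sum_i dx i (q i) x t.
  by move=> Ox t0; exact: (energy_law supp sol Ox t0).
have phiE x (t : R) : augmented_temp tauT T x t = Th x t + tauT * ext T x t by [].
have kap_sym x : Om x -> (kap x)^T = kap x by move=> Ox; have [] := inv x Ox.
have kap_inv x v i : Om x -> \sum_j kap x i j * (\sum_l k x j l * v l) = v i.
  by move=> Ox; have [_ hi _ _ _] := inv x Ox; exact: hi.
have kap_ge0 x u : Om x -> 0 <= bil (kap x) u u.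
  by move=> Ox; have [_ _ hi _ _] := inv x Ox; exact: hi.
have kap_def x u : Om x -> bil (kap x) u u = 0 -> forall i, u i = 0.
  by move=> Ox; have [_ _ _ hi _] := inv x Ox; exact: hi.
have kap_le x u i : Om x -> u i ^+ 2 <= kM * bil (kap x) u u.
  by move=> Ox; have [_ _ _ _ hi] := inv x Ox; exact: hi.
have speed_x x : Om x -> 2 * tauT * kM <= c ^+ 2 * tauq ^+ 2 * a x.
  move=> /OC cx; apply: (le_trans speed); apply: ler_wpM2l; last exact: ham.
  by apply: mulr_ge0; exact: sqr_ge0.
have cax x : Om x -> continuous_at x a.
  by move=> Ox; exact: (interior_cont oB ca (OB x Ox)).
have e_init x : Om x ->
    energy tauq tauT a kap Th (augmented_temp tauT T) (fun i => ext (q i)) Q x 0 = 0.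
  move=> Ox; have T00 : ext T x 0 = 0 by rewrite ext_ge0// (T_at0 supp sol Ox).
  rewrite /energy phiE /Th /Q prim0 T00 mulr0 addr0.
  have -> : (fun i => ext (q i) x 0) = fun=> 0.
    by apply/funext => i; rewrite ext_ge0// (q_at0 supp sol _ Ox).
  have -> : (fun i => prim (ext (q i) x) 0) = fun=> 0.
    by apply/funext => i; rewrite prim0.
  have -> : bil (kap x) (fun=> 0) (fun=> 0) = 0.
    by rewrite /bil big1// => i _; rewrite big1// => j _; rewrite mulr0.
  by rewrite expr0n /= addr0 !mulr0 !addr0.
have inner x (t : R) : B x -> 0 < t -> c * t < x ord0 ord_max ->
    T x t = 0 /\ forall i, q i x t = 0.
  move=> Bx t0 ahead.
  have Ox : Om x by split => //; apply: le_lt_trans ahead; rewrite mulr_ge0// ltW.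
  have [C W_le] := lateral_flux_bound hD h0 tT0 t0 sol.
  have W_small := lateral_flux_small hD h0 L0 tT0 t0 split supp sol.
  have top := top_small hD h0 L0 tT0 t0 split supp sol.
  have WE y (s : R) : Om y -> 0 <= s <= t -> exists p : R * R, forall i,
      lateral_flux L tauT T q t p i (base y) = augmented_temp tauT T y s * ext (q (lift ord_max i)) y s.
    move=> Oy sI; exists (y ord0 ord_max, s) => i.
    have [_ yI] := (OmE y).1 Oy; have /andP[s0 _] := sI.
    by rewrite /lateral_flux /= yI sI /= rcons_base ext_ge0.
  have top' w : 0 < w -> exists2 eps : R, 0 < eps & forall y (s : R), Om y ->
      L - eps < y ord0 ord_max -> 0 <= s <= t -> `|augmented_temp tauT T y s * ext (q ord_max) y s| <= w.
    move=> /top[eps eps0 htop]; exists eps => // y s [By y0] yL sI.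
    by rewrite ext_ge0; [exact: htop|case/andP: sI].
  have E0 := energy_vanishes tq0 tT0 c0 kM0 a0 speed_x kap_sym kap_inv kap_ge0 kap_le cax ckap
    cTh cphi (fun i x t Ox => cqe i x t (OB x Ox)) cQ cgphi cdq phiE dTh dphi dQ dqt dphix dqx
    law_q law_T hD L0 t0 OmE e_init WE W_le W_small top' Ox ahead.
  have [p0 Th0 q0] := energy_eq0 tq0 tT0 a0 kap_ge0 kap_def Ox E0.
  split => [|i]; last by have := q0 i; rewrite ext_ge0// ltW.
  move: p0; rewrite phiE Th0 add0r => /eqP; rewrite mulf_eq0 gt_eqF//= => /eqP.
  by rewrite ext_ge0// ltW.
move=> x t cx t0 ahead; split=> [|i]; apply: (closed_vanish _ cx (ltW t0) ahead) => //.
  by move=> y By hy; have [] := inner y t By t0 hy.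
by move=> y By hy; have [_ ->] := inner y t By t0 hy.
Qed.

Lemma eigenvalue_le (R : realType) (n : nat) (A : 'M[R]_n) (kM l : R) :
  (forall v : 'I_n -> R, bil A v v <= kM * \sum_i v i ^+ 2) -> eigenvalue A l -> l <= kM.
Proof.
move=> hk /eigenvalueP[v vA v0].
have s0 : 0 < \sum_i v ord0 i ^+ 2.
  have [i vi] : exists i, v ord0 i != 0.
    apply/existsP; apply: contraR v0 => /existsPn h.
    by apply/eqP/rowP => i; rewrite mxE; apply/eqP; have := h i; rewrite negbK.
  rewrite (bigD1 i)//= ltr_pwDl ?sumr_ge0// => [|j _]; last exact: sqr_ge0.
  by rewrite lt_neqAle eq_sym sqrf_eq0 vi sqr_ge0.
have E : bil A (v ord0) (v ord0) = l * \sum_i v ord0 i ^+ 2.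
  rewrite /bil exchange_big mulr_sumr /=; apply: eq_bigr => j _.
  have := congr1 (fun u : 'rV_n => u ord0 j) vA; rewrite !mxE => h.
  rewrite expr2 mulrA -h mulr_suml; apply: eq_bigr => i _; ring.
by have := hk (v ord0); rewrite E ler_pM2r.
Qed.

Lemma speed0_sqr (R : realType) (tauq tauT am kM : R) : 0 < tauq -> 0 < tauT ->
  0 < am -> 0 < kM -> 0 < speed0 tauq tauT am kM /\
  2 * tauT * kM <= speed0 tauq tauT am kM ^+ 2 * tauq ^+ 2 * am.
Proof.
move=> q0 T0 a0 k0; have s0 : 0 < tauT + tauq by rewrite addr_gt0.
have p1 : 0 < kM / am by rewrite divr_gt0.
have p3 : 0 < (tauT + tauq)^-1 by rewrite invr_gt0.
have p2 : 0 < 2 * tauT / tauq ^+ 2 + (tauT + tauq)^-1.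
  by rewrite addr_gt0// divr_gt0 ?mulr_gt0// exprn_gt0.
split; first by rewrite /speed0 mulr_gt0 ?sqrtr_gt0.
rewrite /speed0 exprMn !sqr_sqrtr ?(ltW p1) ?(ltW p2)//.
have -> : kM / am * (2 * tauT / tauq ^+ 2 + (tauT + tauq)^-1) * tauq ^+ 2 * am =
    2 * tauT * kM + kM * tauq ^+ 2 * (tauT + tauq)^-1.
  by field; rewrite !gt_eqF.
rewrite lerDl; apply: mulr_ge0; last exact: ltW.
by apply: mulr_ge0; [exact: ltW|exact: sqr_ge0].
Qed.

(** The ratio n / d under the root is at least 2 because n - 2 * d = tauq ^+ 2. *)
Lemma speed1_sqr (R : realType) (tauq tauT am kM : R) : 0 < tauT ->
  2 * tauT < tauq -> 0 < am -> 0 < kM -> 0 < speed1 tauq tauT am kM /\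
  2 * tauT * kM <= speed1 tauq tauT am kM ^+ 2 * tauq ^+ 2 * am.
Proof.
move=> T0 Tq a0 k0; have q0 : 0 < tauq by lra.
have p1 : 0 < tauT * kM / am by rewrite divr_gt0// mulr_gt0.
pose n := 5 * tauq ^+ 2 + 2 * tauT ^+ 2 - 6 * tauq * tauT.
pose d := tauT ^+ 2 + 2 * tauq ^+ 2 - 3 * tauT * tauq.
have d0 : 0 < d.
  have -> : d = (tauq - tauT) * (2 * tauq - tauT) by rewrite /d; ring.
  by apply: mulr_gt0; lra.
have nd : 2 * d <= n by rewrite -subr_ge0 (_ : n - 2 * d = tauq ^+ 2) ?sqr_ge0// /n /d; ring.
have n0 : 0 < n by lra.
have p2 : 0 < n / d by rewrite divr_gt0.
split; first by rewrite /speed1 !mulr_gt0 ?invr_gt0 ?sqrtr_gt0.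
rewrite /speed1 -/n -/d !exprMn !sqr_sqrtr ?(ltW p1) ?(ltW p2)//.
have -> : tauq^-1 ^+ 2 * (tauT * kM / am) * (n / d) * tauq ^+ 2 * am = tauT * kM * (n / d).
  by field; rewrite !gt_eqF.
rewrite -mulrA (mulrC 2) ler_pM2l ?mulr_gt0//.
by rewrite ler_pdivlMr.
Qed.

Unset Implicit Arguments.
Set Strict Implicit.

Theorem theorem7 (R : realType) (D : set 'rV[R]_2) (h L : R)
    (a : 'rV[R]_3 -> R) (k : 'rV[R]_3 -> 'M[R]_3) (tauq tauT : R)
    (hD : bounded_regular_domain D) (h_gt0 : 0 < h) (L_gt0 : 0 < L)
    (a_cont : {within closure (cylinder D h L), continuous a})
    (k_cont : {within closure (cylinder D h L), continuous k})
    (k_sym : forall x, closure (cylinder D h L) x -> (k x)^T = k x)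
    (k_pos : forall x, closure (cylinder D h L) x -> positive_definite (k x))
    (a_pos : forall x, closure (cylinder D h L) x -> 0 < a x)
    (delays : 0 < tauq <= 2 * tauT \/ 0 < 2 * tauT < tauq) :
  (exists c : R, 0 < c /\
     propagation_bound (cylinder D h L) tauq tauT a k c) /\
  (exists am kM : R,
     [/\ is_min [set a x | x in closure (cylinder D h L)] am,
         is_max [set l | exists2 x, closure (cylinder D h L) x
                                  & greatest_eigenvalue (k x) l] kM,
         0 < tauq <= 2 * tauT ->
           0 < speed0 tauq tauT am kM /\
           propagation_bound (cylinder D h L) tauq tauT a k
             (speed0 tauq tauT am kM)
       & 0 < 2 * tauT < tauq ->
           0 < speed1 tauq tauT am kM /\
           propagation_bound (cylinder D h L) tauq tauT a k
             (speed1 tauq tauT am kM)]).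

Proof.
set B := cylinder D h L in a_cont k_cont k_sym k_pos a_pos *.
have [oD _ [y0 Dy0] bD _] := hD.
have T0 : 0 < tauT by case: delays => /andP[]; lra.
have q0 : 0 < tauq by case: delays => /andP[]; lra.
have cB : compact (closure B) by exact: compact_closure_cylinder.
have B0 : closure B !=set0.
  exists (rcons_rv y0 0); apply: subset_closure.
  by apply/cylinder_rcons; rewrite oppr_lt0 h_gt0.
have [xm /set_mem Bxm amin] := compact_EVT_min B0 cB a_cont.
have [kM [[xM BxM eM] hkM]] := max_eigenvalue cB B0 k_cont k_sym.
pose am := a xm; have am0 : 0 < am := a_pos xm Bxm.
have ham x : closure B x -> am <= a x by move=> cx; apply: amin; exact: mem_set.
have kM0 : 0 < kM.
  pose v : 'rV[R]_3 := const_mx 1.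
  have v0 : v != 0 by apply/eqP => /rowP/(_ ord0)/eqP; rewrite !mxE oner_eq0.
  have := lt_le_trans (k_pos xM BxM v v0) (hkM xM (v ord0) BxM).
  have s0 : 0 < \sum_i v ord0 i ^+ 2 :> R.
    rewrite (eq_bigr (fun=> 1)) => [|i _]; last by rewrite mxE expr1n.
    by rewrite sumr_const card_ord ltr0n.
  by rewrite pmulr_lgt0.
have key c : 0 < c -> 2 * tauT * kM <= c ^+ 2 * tauq ^+ 2 * am ->
    propagation_bound B tauq tauT a k c.
  by move=> c0 hc; exact: (propagation hD h_gt0 L_gt0 a_cont k_cont k_sym k_pos q0 T0
    c0 am0 (ltW kM0) ham hkM hc).
(* speed0 also serves as the constant of the first claim. *)
have key0 : 0 < speed0 tauq tauT am kM /\ propagation_bound B tauq tauT a k (speed0 tauq tauT am kM).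
  by have [c0 hc] := speed0_sqr q0 T0 am0 kM0; split; [|exact: key].
split; first by exists (speed0 tauq tauT am kM).
exists am, kM; split.
- by split; [exists xm|move=> _ [x Bx <-]; exact: ham].
- split; first exists xM => //.
    by split => // l; exact: eigenvalue_le (fun v => hkM xM v BxM).
  by move=> l [x Bx [el _]]; exact: eigenvalue_le (fun v => hkM x v Bx) el.
- by move=> _.
- move=> /andP[_ Tq].
  by have [c0 hc] := speed1_sqr T0 Tq am0 kM0; split; [|exact: key].
Qed.
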